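(* Let $K$ be a field, let $R$ be a Noetherian $K$-algebra, and let $f_1,\ldots,f_n\in R$ and $h\in R$. Let $\varphi: R\to S$ be a finite extension of rings such that $h\in (f_1,\ldots,f_n)S$. Then $h\in (f_1,\ldots,f_n)^{\star}$, where $^{\star}$ denotes parasolid closure in $R$.
   Context: All rings are commutative with $1$. A finite extension $R\to S$ is an injective ring homomorphism making $S$ a finitely generated $R$-module. Parasolid algebras. Let $R$ be a Noetherian local ring of dimension $d$ with maximal ideal $\mathfrak{m}$. Elements $x_1,\ldots,x_d\in R$ are called parameters if $V(x_1,\ldots,x_d)=V(\mathfrak{m})$; they define, via Čech cohomology, a class $1/(x_1\cdots x_d)\in H^d_{\mathfrak m}(R)$, called a paraclass. For an $R$-algebra $A$, $H^d_{\mathfrak m}(A)$ is the local cohomology of $A$ as an $R$-module. $A$ is called parasolid (over the local ring $R$) if every paraclass $0\neq c\in H^d_{\mathfrak m}(R)$ has non-zero image in $H^d_{\mathfrak m}(A)$. For a commutative ring $R$, an $R$-algebra $A$ is universally parasolid if for every Noetherian local ring $R'$ and every ring homomorphism $R\to R'$ the $R'$-algebra $A\otimes_R R'$ is parasolid. Parasolid closure. For $f_1,\ldots,f_n,h$ in a ring $R$, the forcing algebra is $A=R[T_1,\ldots,T_n]/(f_1T_1+\ldots+f_nT_n+h)$. One says $h$ belongs universally parasolidly to $f_1,\ldots,f_n$ if this $A$ is a universally parasolid $R$-algebra. If $R$ is a complete Noetherian local domain and $I=(f_1,\ldots,f_n)$, then the parasolid closure $I^{\star}$ is the set of $h\in R$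 for which there is a chain $f_{n+1},\ldots,f_m=h$ in $R$ such that $f_i$ belongs universally parasolidly to $f_1,\ldots,f_{i-1}$ for each $i=n+1,\ldots,m$ (this is an ideal depending only on $I$). For a general Noetherian ring $R$ and an ideal $I$, $h\in I^{\star}$ if and only if for every maximal ideal $\mathfrak m$ of $R$ and every minimal prime $\mathfrak q$ of the completion $\hat{R_{\mathfrak m}}$ the image of $h$ lies in the parasolid closure of the extended ideal in $\hat{R_{\mathfrak m}}/\mathfrak q$. *)

(* Defs.v *)
From HB Require Import structures.
From mathcomp Require Import mpoly.
From mathcomp Require Import all_boot all_algebra.
From mathcomp Require Import boolp classical_sets.
From mathcomp Require Import ring.

Set Implicit Arguments.
Unset Strict Implicit.
Unset Printing Implicit Defensive.

Import GRing.Theory.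

Local Open Scope classical_set_scope.
Local Open Scope quotient_scope.
Local Open Scope ring_scope.

(* "Commutative ring with 1" is [comPzRingType], which includes the zero ring
   (needed because a tensor product of algebras may vanish). *)

(* Quotients by Prop-valued congruences.  The library's [{ideal_quot _}] only
   covers proper decidable ideals; localizations, completions, tensor products
   and cohomology groups are also obtained from the two constructions below. *)

Record zmodSetoid := ZmodSetoid {
  zs_car :> Type;
  zs_eq : zs_car -> zs_car -> Prop;
  zs_zero : zs_car;
  zs_opp : zs_car -> zs_car;
  zs_add : zs_car -> zs_car -> zs_car;
  zs_refl : forall x, zs_eq x x;
  zs_sym : forall x y, zs_eq x y -> zs_eq y x;
  zs_trans : forall y x z, zs_eq x y -> zs_eq y z -> zs_eq x z;
  zs_oppE : forall x x', zs_eq x x' -> zs_eq (zs_opp x) (zs_opp x');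
  zs_addE : forall x x' y y', zs_eq x x' -> zs_eq y y' ->
    zs_eq (zs_add x y) (zs_add x' y');
  zs_addA : forall x y z,
    zs_eq (zs_add x (zs_add y z)) (zs_add (zs_add x y) z);
  zs_addC : forall x y, zs_eq (zs_add x y) (zs_add y x);
  zs_add0 : forall x, zs_eq (zs_add zs_zero x) x;
  zs_addN : forall x, zs_eq (zs_add (zs_opp x) x) zs_zero
}.

Record comRingSetoid := ComRingSetoid {
  rs_zmod :> zmodSetoid;
  rs_one : rs_zmod;
  rs_mul : rs_zmod -> rs_zmod -> rs_zmod;
  rs_mulE : forall x x' y y', zs_eq x x' -> zs_eq y y' ->
    zs_eq (rs_mul x y) (rs_mul x' y');
  rs_mulA : forall x y z,
    zs_eq (rs_mul x (rs_mul y z)) (rs_mul (rs_mul x y) z);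
  rs_mulC : forall x y, zs_eq (rs_mul x y) (rs_mul y x);
  rs_mul1 : forall x, zs_eq (rs_mul rs_one x) x;
  rs_mulD : forall x y z,
    zs_eq (rs_mul (zs_add x y) z) (zs_add (rs_mul x z) (rs_mul y z))
}.

Section ZmodOfSetoid.
Variable P : zmodSetoid.

Definition zs_eqb : rel {classic P} := fun x y => `[< zs_eq (x : P) (y : P) >].

Lemma zs_eqb_refl : reflexive zs_eqb.
Proof. by move=> x; apply/asboolP/zs_refl. Qed.

Lemma zs_eqb_sym : symmetric zs_eqb.
Proof. by move=> x y; apply/asboolP/asboolP; apply: zs_sym. Qed.

Lemma zs_eqb_trans : transitive zs_eqb.
Proof.
by move=> y x z /asboolP xy /asboolP yz; apply/asboolP; apply: zs_trans yz.
Qed.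

Canonical zs_eqb_equiv := EquivRel zs_eqb zs_eqb_refl zs_eqb_sym zs_eqb_trans.

Definition zmod_of := {eq_quot zs_eqb}.
HB.instance Definition _ := Choice.on zmod_of.

Definition zs_pi (x : P) : zmod_of := \pi_({eq_quot zs_eqb}) (x : {classic P}).
Definition zs_repr (u : zmod_of) : P := repr (u : {eq_quot zs_eqb}).

Lemma zs_reprK : cancel zs_repr zs_pi.
Proof. by move=> u; rewrite /zs_pi /zs_repr reprK. Qed.

Lemma zs_piP x y : zs_pi x = zs_pi y <-> zs_eq x y.
Proof.
split=> [/eqmodP/asboolP //|xy].
by apply/eqmodP/asboolP.
Qed.

Lemma zs_reprE x : zs_eq (zs_repr (zs_pi x)) x.
Proof. by apply/zs_piP; rewrite zs_reprK. Qed.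

Definition zq_add u v := zs_pi (zs_add (zs_repr u) (zs_repr v)).
Definition zq_opp u := zs_pi (zs_opp (zs_repr u)).

Lemma zq_addE x y : zq_add (zs_pi x) (zs_pi y) = zs_pi (zs_add x y).
Proof. by apply/zs_piP/zs_addE; apply: zs_reprE. Qed.

Lemma zq_oppE x : zq_opp (zs_pi x) = zs_pi (zs_opp x).
Proof. by apply/zs_piP/zs_oppE; apply: zs_reprE. Qed.

Lemma zq_addA : associative zq_add.
Proof.
move=> u v w; rewrite -(zs_reprK u) -(zs_reprK v) -(zs_reprK w) !zq_addE.
exact/zs_piP/zs_addA.
Qed.

Lemma zq_addC : commutative zq_add.
Proof.
by move=> u v; rewrite -(zs_reprK u) -(zs_reprK v) !zq_addE; apply/zs_piP/zs_addC.
Qed.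

Lemma zq_add0 : left_id (zs_pi (zs_zero P)) zq_add.
Proof. by move=> u; rewrite -(zs_reprK u) !zq_addE; apply/zs_piP/zs_add0. Qed.

Lemma zq_addN : left_inverse (zs_pi (zs_zero P)) zq_opp zq_add.
Proof.
by move=> u; rewrite -(zs_reprK u) zq_oppE zq_addE; apply/zs_piP/zs_addN.
Qed.

HB.instance Definition _ :=
  GRing.isZmodule.Build zmod_of zq_addA zq_addC zq_add0 zq_addN.

Lemma zs_pi0 : zs_pi (zs_zero P) = 0. Proof. by []. Qed.
Lemma zs_piD x y : zs_pi (zs_add x y) = zs_pi x + zs_pi y.
Proof. by rewrite -zq_addE. Qed.
Lemma zs_piN x : zs_pi (zs_opp x) = - zs_pi x.
Proof. by rewrite -zq_oppE. Qed.

End ZmodOfSetoid.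

Section RingOfSetoid.
Variable P : comRingSetoid.

Definition ring_of := zmod_of P.
HB.instance Definition _ := GRing.Zmodule.on ring_of.

Definition rs_pi (x : P) : ring_of := zs_pi x.
Definition rs_repr (u : ring_of) : P := zs_repr u.

Lemma rs_reprK : cancel rs_repr rs_pi. Proof. exact: zs_reprK. Qed.
Lemma rs_piP x y : rs_pi x = rs_pi y <-> zs_eq x y.
Proof. exact: zs_piP. Qed.
Lemma rs_reprE x : zs_eq (rs_repr (rs_pi x)) x. Proof. exact: zs_reprE. Qed.
Lemma rs_pi0 : rs_pi (zs_zero P) = 0. Proof. by []. Qed.
Lemma rs_piD x y : rs_pi (zs_add x y) = rs_pi x + rs_pi y.
Proof. exact: zs_piD. Qed.
Lemma rs_piN x : rs_pi (zs_opp x) = - rs_pi x.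
Proof. exact: zs_piN. Qed.

Definition rq_mul (u v : ring_of) := rs_pi (rs_mul (rs_repr u) (rs_repr v)).

Lemma rq_mulE x y : rq_mul (rs_pi x) (rs_pi y) = rs_pi (rs_mul x y).
Proof. by apply/rs_piP/rs_mulE; apply: rs_reprE. Qed.

Lemma rq_mulA : associative rq_mul.
Proof.
move=> u v w; rewrite -(rs_reprK u) -(rs_reprK v) -(rs_reprK w) !rq_mulE.
exact/rs_piP/rs_mulA.
Qed.

Lemma rq_mulC : commutative rq_mul.
Proof.
by move=> u v; rewrite -(rs_reprK u) -(rs_reprK v) !rq_mulE; apply/rs_piP/rs_mulC.
Qed.

Lemma rq_mul1 : left_id (rs_pi (rs_one P)) rq_mul.
Proof. by move=> u; rewrite -(rs_reprK u) !rq_mulE; apply/rs_piP/rs_mul1. Qed.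

Lemma rq_mulD : left_distributive rq_mul +%R.
Proof.
move=> u v w; rewrite -(rs_reprK u) -(rs_reprK v) -(rs_reprK w).
by rewrite -rs_piD !rq_mulE -rs_piD; apply/rs_piP/rs_mulD.
Qed.

HB.instance Definition _ :=
  GRing.Zmodule_isComPzRing.Build ring_of rq_mulA rq_mulC rq_mul1 rq_mulD.

Lemma rs_pi1 : rs_pi (rs_one P) = 1. Proof. by []. Qed.
Lemma rs_piM x y : rs_pi (rs_mul x y) = rs_pi x * rs_pi y.
Proof. by rewrite -rq_mulE. Qed.

End RingOfSetoid.

Section Ideals.
Variable R : comPzRingType.

Definition is_ideal (I : set R) : Prop :=
  [/\ I 0, forall x y, I x -> I y -> I (x + y) & forall a x, I x -> I (a * x)].

Definition is_prime (I : set R) : Prop :=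
  [/\ is_ideal I, ~ I 1 & forall x y, I (x * y) -> I x \/ I y].

Definition is_maximal (I : set R) : Prop :=
  [/\ is_ideal I, ~ I 1 &
      forall J, is_ideal J -> ~ J 1 -> I `<=` J -> J = I].

Definition is_minimal_prime (I : set R) : Prop :=
  is_prime I /\ forall J, is_prime J -> J `<=` I -> J = I.

Definition ideal_gen (A : set R) : set R :=
  [set x | forall I, is_ideal I -> A `<=` I -> I x].

Fixpoint ideal_pow (I : set R) (n : nat) : set R :=
  if n is k.+1 then
    ideal_gen [set z | exists x y, [/\ I x, ideal_pow I k y & z = x * y]]
  else setT.

Definition noetherian : Prop :=
  forall I, is_ideal I -> exists s : seq R, I = ideal_gen [set` s].

Definition local_ring (m : set R) : Prop :=
  is_maximal m /\ forall m', is_maximal m' -> m' = m.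

Definition prime_chain (d : nat) : Prop :=
  exists p : 'I_d.+1 -> set R,
    (forall i, is_prime (p i)) /\
    (forall i j : 'I_d.+1, (i < j)%N -> p i `<` p j).

Definition has_krull_dim (d : nat) : Prop :=
  prime_chain d /\ forall e, prime_chain e -> (e <= d)%N.

Definition Vset (A : set R) : set (set R) := [set p | is_prime p /\ A `<=` p].

Definition parameters (m : set R) (d : nat) (x : 'I_d -> R) : Prop :=
  Vset (range x) = Vset m.

Lemma ideal_genP (A : set R) : is_ideal (ideal_gen A).
Proof.
split=> [I [] //|x y xA yA I IP AI|a x xA I IP AI]; case: (IP) => _ ID IM.
  by apply: ID; [apply: xA|apply: yA].
by apply: IM; apply: xA.
Qed.

Lemma sub_ideal_gen (A : set R) : A `<=` ideal_gen A.
Proof. by move=> x Ax I _; apply. Qed.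

Lemma is_idealN (I : set R) x : is_ideal I -> I x -> I (- x).
Proof. by case=> _ _ IM Ix; rewrite -mulN1r; apply: IM. Qed.

Lemma ideal_powP (I : set R) n : is_ideal (ideal_pow I n).
Proof. by case: n => [|n] //=; apply: ideal_genP. Qed.

Lemma maximal_prime (I : set R) : is_maximal I -> is_prime I.
Proof.
move=> [II I1 Imax]; split=> // x y Ixy; have [I0 ID IM] := II.
have [Ix|nIx] := pselect (I x); [by left|right].
pose J := [set z | exists2 u, I u & exists a, z = u + a * x].
have JI : is_ideal J.
  split.
  - by exists 0 => //; exists 0; rewrite mul0r addr0.
  - move=> _ _ [u Iu [a ->]] [v Iv [b ->]]; exists (u + v); first exact: ID.
    by exists (a + b); rewrite mulrDl addrACA.
  - move=> c _ [u Iu [a ->]]; exists (c * u); first exact: IM.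
    by exists (c * a); rewrite mulrDr mulrA.
have [[u Iu [a e]]|J1] := pselect (J 1).
  rewrite -[y]mul1r e mulrDl; apply: ID; first by rewrite mulrC; apply: IM.
  by rewrite -mulrA; apply: IM.
case: nIx; rewrite -(Imax J JI J1).
  by exists 0 => //; exists 1; rewrite mul1r add0r.
by move=> u Iu; exists u => //; exists 0; rewrite mul0r addr0.
Qed.

End Ideals.

Arguments noetherian : clear implicits.
Arguments has_krull_dim : clear implicits.

Definition ideal_ext (R S : comPzRingType) (phi : R -> S) (I : set R) : set S :=
  ideal_gen (phi @` I).

Definition finite_extension (R S : comPzRingType) (phi : {rmorphism R -> S}) :
    Prop :=
  injective phi /\
  exists s : seq S, forall y : S, exists c : 'I_(size s) -> R,
    y = \sum_(i < size s) phi (c i) * s`_i.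

(* [quot_ring A] is the quotient R/(A) by the ideal generated by [A]; for an
   ideal [I] it is R/I. *)
Section QuotientRing.
Variables (R : comPzRingType) (A : set R).

Definition quot_eq (x y : R) : Prop := ideal_gen A (x - y).

Lemma quot_eqN x y z : z = - (x - y) -> quot_eq x y -> ideal_gen A z.
Proof. by move=> -> /(is_idealN (ideal_genP A)). Qed.

Lemma quot_eqD x y x' y' z : z = (x - y) + (x' - y') ->
  quot_eq x y -> quot_eq x' y' -> ideal_gen A z.
Proof. by move=> ->; have [_ ID _] := ideal_genP A; apply: ID. Qed.

Lemma quot_eq_of x y : x = y -> quot_eq x y.
Proof. by move=> ->; rewrite /quot_eq subrr; have [] := ideal_genP A. Qed.

Definition quot_zmodSetoid : zmodSetoid.
Proof.
refine (@ZmodSetoid R quot_eq 0 -%R +%R _ _ _ _ _ _ _ _ _).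
- by move=> x; apply: quot_eq_of.
- by move=> x y; apply: quot_eqN; ring.
- by move=> y x z; apply: quot_eqD; ring.
- by move=> x x'; apply: quot_eqN; ring.
- by move=> x x' y y'; apply: quot_eqD; ring.
- by move=> x y z; apply: quot_eq_of; ring.
- by move=> x y; apply: quot_eq_of; ring.
- by move=> x; apply: quot_eq_of; ring.
- by move=> x; apply: quot_eq_of; ring.
Defined.

Definition quot_setoid : comRingSetoid.
Proof.
refine (@ComRingSetoid quot_zmodSetoid (1 : R) *%R _ _ _ _ _).
- move=> /= x x' y y'; have [_ ID IM] := ideal_genP A.
  move=> /(IM y) xx' /(IM x') yy'; rewrite /quot_eq.
  have -> : x * y - x' * y' = y * (x - x') + x' * (y - y') by ring.
  exact: ID.
- by move=> /= x y z; apply: quot_eq_of; ring.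
- by move=> /= x y; apply: quot_eq_of; ring.
- by move=> /= x; apply: quot_eq_of; ring.
- by move=> /= x y z; apply: quot_eq_of; ring.
Defined.

Definition quot_ring : Type := ring_of quot_setoid.
HB.instance Definition _ := GRing.ComPzRing.on quot_ring.

Definition quot_map (x : R) : quot_ring := rs_pi (P := quot_setoid) x.

Lemma quot_map_zmod : zmod_morphism quot_map.
Proof. by move=> x y; rewrite /quot_map -rs_piN -rs_piD. Qed.

Lemma quot_map_monoid : monoid_morphism quot_map.
Proof. by split=> // x y; rewrite /quot_map -rs_piM. Qed.

HB.instance Definition _ :=
  GRing.isZmodMorphism.Build R quot_ring quot_map quot_map_zmod.
HB.instance Definition _ :=
  GRing.isMonoidMorphism.Build R quot_ring quot_map quot_map_monoid.

Lemma quot_mapP x y : quot_map x = quot_map y <-> ideal_gen A (x - y).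
Proof. exact: rs_piP. Qed.

Lemma quot_map_surj u : exists x, u = quot_map x.
Proof. by exists (rs_repr u); rewrite /quot_map rs_reprK. Qed.

End QuotientRing.

(* R/p again, now with the [comNzRingType] structure that [{mpoly _[_]}] asks
   for. *)
Section QuotientByPrime.
Variables (R : comPzRingType) (p : set R) (p_prime : is_prime p).

Definition quot_prime : Type := let _ := p_prime in quot_ring p.
HB.instance Definition _ := GRing.ComPzRing.copy quot_prime (quot_ring p).

Lemma quot_prime_neq0 : (1 : quot_prime) != 0.
Proof.
apply/eqP => e; have [pI p1 _] := p_prime; apply: p1.
have /quot_mapP : quot_map p 1 = quot_map p 0 by [].
by rewrite subr0; apply.
Qed.

HB.instance Definition _ :=
  GRing.PzSemiRing_isNonZero.Build quot_prime quot_prime_neq0.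

Definition quot_prime_map : R -> quot_prime := quot_map p.
HB.instance Definition _ :=
  GRing.RMorphism.copy quot_prime_map (quot_map p : R -> quot_prime).

End QuotientByPrime.

Record mulset (R : comPzRingType) := MulSet {
  ms_car :> R -> Prop;
  ms_1 : ms_car 1;
  ms_M : forall x y, ms_car x -> ms_car y -> ms_car (x * y)
}.

Section MulSets.
Variable R : comPzRingType.

Definition powers (x : R) : mulset R.
Proof.
refine (@MulSet R [set y | exists k : nat, y = x ^+ k] _ _).
- by exists 0%N.
- by move=> _ _ [k ->] [l ->]; exists (k + l)%N; rewrite exprD.
Defined.

Definition prime_compl (p : set R) (p_prime : is_prime p) : mulset R.
Proof.
refine (@MulSet R (~` p) _ _).
- by case: p_prime.
- by case: p_prime => _ _ pM x y npx npy /pM [].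
Defined.

End MulSets.

Section Localization.
Variables (R : comPzRingType) (S : mulset R).

Definition loc_car : Type := (R * {s : R | S s})%type.
Definition loc_num (x : loc_car) : R := x.1.
Definition loc_den (x : loc_car) : R := sval x.2.
Definition loc_mk (a s : R) (Ss : S s) : loc_car := (a, exist _ s Ss).

Definition loc_eq (x y : loc_car) : Prop :=
  exists2 u, S u & u * (loc_num x * loc_den y - loc_num y * loc_den x) = 0.

Lemma loc_denP (x : loc_car) : S (loc_den x). Proof. exact: (svalP x.2). Qed.

Lemma loc_eq_of (x y : loc_car) :
  loc_num x * loc_den y = loc_num y * loc_den x -> loc_eq x y.
Proof. by move=> e; exists 1; rewrite ?e ?subrr ?mulr0//; apply: ms_1. Qed.

Definition loc_zmodSetoid : zmodSetoid.
Proof.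
refine (@ZmodSetoid loc_car loc_eq (loc_mk 0 (ms_1 S))
  (fun x => loc_mk (- loc_num x) (loc_denP x))
  (fun x y => loc_mk (loc_num x * loc_den y + loc_num y * loc_den x)
                     (ms_M (loc_denP x) (loc_denP y))) _ _ _ _ _ _ _ _ _).
- by move=> x; apply: loc_eq_of.
- by move=> x y [u Su e]; exists u => //; rewrite -oppr0 -e; ring.
- move=> y x z [u Su e] [v Sv e']; exists (loc_den y * (u * v)).
    by apply: ms_M; [apply: loc_denP|apply: ms_M].
  transitivity (v * loc_den z * (u * (loc_num x * loc_den y
      - loc_num y * loc_den x)) + u * loc_den x * (v * (loc_num y * loc_den z
      - loc_num z * loc_den y))); first by ring.
  by rewrite e e' !mulr0 addr0.
- move=> x x' [u Su e]; exists u => //=; rewrite -oppr0 -e /=.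
  by rewrite /= /loc_num /loc_den /=; ring.
- move=> x x' y y' [u Su e] [v Sv e']; exists (u * v); first exact: ms_M.
  move: e e'; rewrite /loc_num /loc_den /= => e e'.
  transitivity (v * sval y.2 * sval y'.2 * (u * (x.1 * sval x'.2
      - x'.1 * sval x.2)) + u * sval x.2 * sval x'.2 * (v * (y.1 * sval y'.2
      - y'.1 * sval y.2))); first by ring.
  by rewrite e e' !mulr0 addr0.
- by move=> x y z; apply: loc_eq_of; rewrite /= /loc_num /loc_den /=; ring.
- by move=> x y; apply: loc_eq_of; rewrite /= /loc_num /loc_den /=; ring.
- by move=> x; apply: loc_eq_of; rewrite /= /loc_num /loc_den /=; ring.
- by move=> x; apply: loc_eq_of; rewrite /= /loc_num /loc_den /=; ring.
Defined.

Definition loc_setoid : comRingSetoid.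
Proof.
refine (@ComRingSetoid loc_zmodSetoid (loc_mk 1 (ms_1 S))
  (fun x y => loc_mk (loc_num x * loc_num y)
                     (ms_M (loc_denP x) (loc_denP y))) _ _ _ _ _).
- move=> x x' y y' [u Su e] [v Sv e']; exists (u * v); first exact: ms_M.
  move: e e'; rewrite /loc_num /loc_den /= => e e'.
  transitivity (v * y.1 * sval y'.2 * (u * (x.1 * sval x'.2
      - x'.1 * sval x.2)) + u * x'.1 * sval x.2 * (v * (y.1 * sval y'.2
      - y'.1 * sval y.2))); first by ring.
  by rewrite e e' !mulr0 addr0.
- by move=> x y z; apply: loc_eq_of; rewrite /= /loc_num /loc_den /=; ring.
- by move=> x y; apply: loc_eq_of; rewrite /= /loc_num /loc_den /=; ring.
- by move=> x; apply: loc_eq_of; rewrite /= /loc_num /loc_den /=; ring.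
- by move=> x y z; apply: loc_eq_of; rewrite /= /loc_num /loc_den /=; ring.
Defined.

Definition loc : Type := ring_of loc_setoid.
HB.instance Definition _ := GRing.ComPzRing.on loc.

Definition loc_frac (a s : R) (Ss : S s) : loc :=
  rs_pi (P := loc_setoid) (loc_mk a Ss).

Definition loc_map (a : R) : loc := loc_frac a (ms_1 S).

Lemma loc_fracP a s (Ss : S s) b t (St : S t) :
  loc_frac a Ss = loc_frac b St <-> exists2 u, S u & u * (a * t - b * s) = 0.
Proof. exact: rs_piP. Qed.

Lemma loc_map_zmod : zmod_morphism loc_map.
Proof.
move=> x y; rewrite /loc_map /loc_frac -rs_piN -rs_piD; apply/rs_piP.
by apply: loc_eq_of; rewrite /= /loc_num /loc_den /=; ring.
Qed.

Lemma loc_map_monoid : monoid_morphism loc_map.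
Proof.
split=> // x y; rewrite /loc_map /loc_frac -rs_piM; apply/rs_piP.
by apply: loc_eq_of; rewrite /= /loc_num /loc_den /=; ring.
Qed.

HB.instance Definition _ :=
  GRing.isZmodMorphism.Build R loc loc_map loc_map_zmod.
HB.instance Definition _ :=
  GRing.isMonoidMorphism.Build R loc loc_map loc_map_monoid.

Lemma loc_fracE a s (Ss : S s) : loc_map s * loc_frac a Ss = loc_map a.
Proof.
rewrite /loc_map /loc_frac -rs_piM; apply/rs_piP.
by apply: loc_eq_of; rewrite /= /loc_num /loc_den /=; ring.
Qed.

Lemma loc_map_unit s : S s -> exists t, loc_map s * t = 1.
Proof. by move=> Ss; exists (loc_frac 1 Ss); rewrite loc_fracE rmorph1. Qed.

Lemma locP (u : loc) : exists a s (Ss : S s), u = loc_frac a Ss.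
Proof.
rewrite -(rs_reprK u); case: (rs_repr u) => a [s Ss].
by exists a, s, Ss.
Qed.

End Localization.

(* The homomorphism a/s |-> phi(a) phi(s)^-1 induced by a homomorphism phi that
   maps S to units. *)
Section LocLift.
Variables (R B : comPzRingType) (S : mulset R) (phi : {rmorphism R -> B}).
Hypothesis phi_unit : forall s, S s -> exists t, phi s * t = 1.

Definition loc_inv (s : R) (Ss : S s) : B := sval (cid (phi_unit Ss)).

Lemma loc_invP s (Ss : S s) : phi s * loc_inv Ss = 1.
Proof. exact: (svalP (cid (phi_unit Ss))). Qed.

Definition loc_lift (u : loc S) : B :=
  phi (rs_repr u).1 * loc_inv (proj2_sig (rs_repr u).2).

Lemma loc_lift_frac a s (Ss : S s) : phi s * loc_lift (loc_frac a Ss) = phi a.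
Proof.
rewrite /loc_lift; have := rs_reprE (loc_mk a Ss : loc_setoid S).
rewrite -/(loc_frac a Ss); case: (rs_repr _) => b [t St] [u Su] /=.
rewrite /loc_num /loc_den /= => e.
have [v uv] := phi_unit Su; have tv := loc_invP St.
have /eqP : phi u * (phi b * phi s - phi a * phi t) = 0.
  by rewrite -!rmorphM -rmorphB -rmorphM e rmorph0.
rewrite mulrBr subr_eq0 => /eqP e'.
transitivity (phi u * v * (phi s * (phi b * loc_inv St))).
  by rewrite uv mul1r.
transitivity (v * loc_inv St * (phi u * (phi b * phi s))); first by ring.
rewrite e'; transitivity (phi u * v * (phi t * loc_inv St) * phi a); first by ring.
by rewrite uv tv !mul1r.
Qed.

Lemma loc_lift_eq (u : loc S) (b : B) a s (Ss : S s) :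
  u = loc_frac a Ss -> phi s * b = phi a -> loc_lift u = b.
Proof.
move=> -> e; have [t st] := phi_unit Ss.
rewrite -[b]mul1r -st mulrAC e -(loc_lift_frac a Ss).
by rewrite mulrAC st mul1r.
Qed.

Lemma loc_lift_zmod : zmod_morphism loc_lift.
Proof.
move=> u v; have [a [s [Ss ->]]] := locP u; have [b [t [St ->]]] := locP v.
apply: (@loc_lift_eq _ _ (a * t - b * s) (s * t) (ms_M Ss St)).
  rewrite /loc_frac -rs_piN -rs_piD; apply/rs_piP/loc_eq_of.
  by rewrite /= /loc_num /loc_den /=; ring.
rewrite rmorphB !rmorphM -(loc_lift_frac a Ss) -(loc_lift_frac b St).
by ring.
Qed.

Lemma loc_lift_monoid : monoid_morphism loc_lift.
Proof.
split=> [|u v].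
  apply: (@loc_lift_eq _ _ 1 1 (ms_1 S)); last by rewrite rmorph1 mul1r.
  exact: (esym (rmorph1 (loc_map S))).
have [a [s [Ss ->]]] := locP u; have [b [t [St ->]]] := locP v.
apply: (@loc_lift_eq _ _ (a * b) (s * t) (ms_M Ss St)).
  rewrite /loc_frac -rs_piM; apply/rs_piP/loc_eq_of.
  by rewrite /= /loc_num /loc_den /=; ring.
rewrite !rmorphM -(loc_lift_frac a Ss) -(loc_lift_frac b St).
by ring.
Qed.

HB.instance Definition _ :=
  GRing.isZmodMorphism.Build (loc S) B loc_lift loc_lift_zmod.
HB.instance Definition _ :=
  GRing.isMonoidMorphism.Build (loc S) B loc_lift loc_lift_monoid.

Lemma loc_lift_map a : loc_lift (loc_map S a) = phi a.
Proof.
by apply: (@loc_lift_eq _ _ a 1 (ms_1 S)) => //; rewrite rmorph1 mul1r.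
Qed.

Lemma loc_lift_uniq (g : {rmorphism loc S -> B}) :
  (forall a, g (loc_map S a) = phi a) -> forall u, loc_lift u = g u.
Proof.
move=> gE u; have [a [s [Ss ->]]] := locP u.
by apply: (@loc_lift_eq _ _ a s Ss) => //; rewrite -!gE -rmorphM loc_fracE.
Qed.

End LocLift.

(* The inverse limit of the rings R/J^n; an element of the limit is given by
   representatives a_n of its components, with a_(n+1) = a_n modulo J^n. *)
Section AdicCompletion.
Variables (R : comPzRingType) (J : set R).
Local Notation JJ := (ideal_pow J).

Definition adic_car : Type :=
  {a : nat -> R | forall n, JJ n (a n.+1 - a n)}.
Definition adic_eq (a b : adic_car) : Prop :=
  forall n, JJ n (sval a n - sval b n).

Lemma adic_of0 n z : z = 0 -> JJ n z.
Proof. by move=> ->; have [] := ideal_powP J n. Qed.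

Lemma adic_ofN n x z : z = - x -> JJ n x -> JJ n z.
Proof. by move=> -> /(is_idealN (ideal_powP J n)). Qed.

Lemma adic_ofD n x y z : z = x + y -> JJ n x -> JJ n y -> JJ n z.
Proof. by move=> ->; have [_ ID _] := ideal_powP J n; apply: ID. Qed.

Lemma adic_ofM n a b x y z : z = a * x + b * y -> JJ n x -> JJ n y -> JJ n z.
Proof.
have [_ ID IM] := ideal_powP J n.
by move=> -> Jx Jy; apply: ID; apply: IM.
Qed.

Definition adic_const (x : R) : adic_car.
Proof. by exists (fun=> x) => n; apply: adic_of0; rewrite subrr. Defined.

Definition adic_opp (a : adic_car) : adic_car.
Proof.
exists (fun n => - sval a n) => n.
by apply: adic_ofN (proj2_sig a n); ring.
Defined.

Definition adic_add (a b : adic_car) : adic_car.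
Proof.
exists (fun n => sval a n + sval b n) => n.
by apply: adic_ofD (proj2_sig a n) (proj2_sig b n); ring.
Defined.

Definition adic_mul (a b : adic_car) : adic_car.
Proof.
exists (fun n => sval a n * sval b n) => n.
apply: (@adic_ofM _ (sval b n.+1) (sval a n)) (proj2_sig a n) (proj2_sig b n).
by ring.
Defined.

Definition adic_zmodSetoid : zmodSetoid.
Proof.
refine (@ZmodSetoid adic_car adic_eq (adic_const 0) adic_opp adic_add
  _ _ _ _ _ _ _ _ _).
- by move=> a n; apply: adic_of0; rewrite subrr.
- by move=> a b ab n; apply: adic_ofN (ab n); ring.
- by move=> b a c ab bc n; apply: adic_ofD (ab n) (bc n); ring.
- by move=> a a' aa n; apply: adic_ofN (aa n); rewrite /=; ring.
- by move=> a a' b b' aa bb n; apply: adic_ofD (aa n) (bb n); rewrite /=; ring.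
- by move=> a b c n; apply: adic_of0; rewrite /=; ring.
- by move=> a b n; apply: adic_of0; rewrite /=; ring.
- by move=> a n; apply: adic_of0; rewrite /=; ring.
- by move=> a n; apply: adic_of0; rewrite /=; ring.
Defined.

Definition adic_setoid : comRingSetoid.
Proof.
refine (@ComRingSetoid adic_zmodSetoid (adic_const 1) adic_mul _ _ _ _ _).
- move=> a a' b b' aa bb n.
  apply: (@adic_ofM _ (sval b n) (sval a' n)) (aa n) (bb n).
  by rewrite /=; ring.
- by move=> a b c n; apply: adic_of0; rewrite /=; ring.
- by move=> a b n; apply: adic_of0; rewrite /=; ring.
- by move=> a n; apply: adic_of0; rewrite /=; ring.
- by move=> a b c n; apply: adic_of0; rewrite /=; ring.
Defined.

Definition adic_completion : Type := ring_of adic_setoid.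
HB.instance Definition _ := GRing.ComPzRing.on adic_completion.

Definition adic_map (x : R) : adic_completion :=
  rs_pi (P := adic_setoid) (adic_const x).

Lemma adic_map_zmod : zmod_morphism adic_map.
Proof.
move=> x y; rewrite /adic_map -rs_piN -rs_piD; apply/rs_piP => n.
by apply: adic_of0; rewrite /=; ring.
Qed.

Lemma adic_map_monoid : monoid_morphism adic_map.
Proof.
split=> // x y; rewrite /adic_map -rs_piM; apply/rs_piP => n.
by apply: adic_of0; rewrite /=; ring.
Qed.

HB.instance Definition _ :=
  GRing.isZmodMorphism.Build R adic_completion adic_map adic_map_zmod.
HB.instance Definition _ :=
  GRing.isMonoidMorphism.Build R adic_completion adic_map adic_map_monoid.

End AdicCompletion.

(* The R-algebra A (x)_R B, presented by the pure tensors and the usual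
   relations. *)
Section Tensor.
Variables (R A B : comPzRingType).
Variables (phi : {rmorphism R -> A}) (psi : {rmorphism R -> B}).

Inductive tens_term : Type :=
| TPure of A & B
| TZero
| TOne
| TOpp of tens_term
| TAdd of tens_term & tens_term
| TMul of tens_term & tens_term.

Inductive tens_eq : tens_term -> tens_term -> Prop :=
| tens_refl x : tens_eq x x
| tens_sym x y : tens_eq x y -> tens_eq y x
| tens_trans y x z : tens_eq x y -> tens_eq y z -> tens_eq x z
| tens_oppE x x' : tens_eq x x' -> tens_eq (TOpp x) (TOpp x')
| tens_addE x x' y y' :
    tens_eq x x' -> tens_eq y y' -> tens_eq (TAdd x y) (TAdd x' y')
| tens_mulE x x' y y' :
    tens_eq x x' -> tens_eq y y' -> tens_eq (TMul x y) (TMul x' y')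
| tens_addA x y z : tens_eq (TAdd x (TAdd y z)) (TAdd (TAdd x y) z)
| tens_addC x y : tens_eq (TAdd x y) (TAdd y x)
| tens_add0 x : tens_eq (TAdd TZero x) x
| tens_addN x : tens_eq (TAdd (TOpp x) x) TZero
| tens_mulA x y z : tens_eq (TMul x (TMul y z)) (TMul (TMul x y) z)
| tens_mulC x y : tens_eq (TMul x y) (TMul y x)
| tens_mul1 x : tens_eq (TMul TOne x) x
| tens_mulD x y z :
    tens_eq (TMul (TAdd x y) z) (TAdd (TMul x z) (TMul y z))
| tens_pureDl a a' b :
    tens_eq (TPure (a + a') b) (TAdd (TPure a b) (TPure a' b))
| tens_pureDr a b b' :
    tens_eq (TPure a (b + b')) (TAdd (TPure a b) (TPure a b'))
| tens_pureZ r a b : tens_eq (TPure (phi r * a) b) (TPure a (psi r * b))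
| tens_pure1 : tens_eq (TPure 1 1) TOne
| tens_pureM a a' b b' :
    tens_eq (TPure (a * a') (b * b')) (TMul (TPure a b) (TPure a' b')).

Definition tens_zmodSetoid : zmodSetoid :=
  ZmodSetoid tens_refl tens_sym tens_trans tens_oppE tens_addE
    tens_addA tens_addC tens_add0 tens_addN.

Definition tens_setoid : comRingSetoid :=
  @ComRingSetoid tens_zmodSetoid TOne TMul
    tens_mulE tens_mulA tens_mulC tens_mul1 tens_mulD.

Definition tensor : Type := ring_of tens_setoid.
HB.instance Definition _ := GRing.ComPzRing.on tensor.

Definition tens (a : A) (b : B) : tensor :=
  rs_pi (P := tens_setoid) (TPure a b).
Definition tens_l (a : A) : tensor := tens a 1.
Definition tens_r (b : B) : tensor := tens 1 b.

Lemma tens_Dl a a' b : tens (a + a') b = tens a b + tens a' b.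
Proof. by rewrite /tens -rs_piD; apply/rs_piP/tens_pureDl. Qed.
Lemma tens_Dr a b b' : tens a (b + b') = tens a b + tens a b'.
Proof. by rewrite /tens -rs_piD; apply/rs_piP/tens_pureDr. Qed.
Lemma tens_M a a' b b' : tens (a * a') (b * b') = tens a b * tens a' b'.
Proof. by rewrite /tens -rs_piM; apply/rs_piP/tens_pureM. Qed.
Lemma tens_Z r a b : tens (phi r * a) b = tens a (psi r * b).
Proof. by apply/rs_piP/tens_pureZ. Qed.
Lemma tens_1 : tens 1 1 = 1.
Proof. by apply/rs_piP/tens_pure1. Qed.

Lemma tens_l_zmod : zmod_morphism tens_l.
Proof.
move=> x y; rewrite /tens_l; apply: (canRL (addrK _)).
by rewrite -tens_Dl subrK.
Qed.
Lemma tens_l_monoid : monoid_morphism tens_l.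
Proof.
by split=> [|x y]; rewrite /tens_l ?tens_1// -tens_M mulr1.
Qed.
HB.instance Definition _ :=
  GRing.isZmodMorphism.Build A tensor tens_l tens_l_zmod.
HB.instance Definition _ :=
  GRing.isMonoidMorphism.Build A tensor tens_l tens_l_monoid.

Lemma tens_r_zmod : zmod_morphism tens_r.
Proof.
move=> x y; rewrite /tens_r; apply: (canRL (addrK _)).
by rewrite -tens_Dr subrK.
Qed.
Lemma tens_r_monoid : monoid_morphism tens_r.
Proof.
by split=> [|x y]; rewrite /tens_r ?tens_1// -tens_M mulr1.
Qed.
HB.instance Definition _ :=
  GRing.isZmodMorphism.Build B tensor tens_r tens_r_zmod.
HB.instance Definition _ :=
  GRing.isMonoidMorphism.Build B tensor tens_r tens_r_monoid.

Lemma tens_lr r : tens_l (phi r) = tens_r (psi r).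
Proof. by rewrite /tens_l /tens_r -[phi r]mulr1 tens_Z mulr1. Qed.

Lemma tensE a b : tens a b = tens_l a * tens_r b.
Proof. by rewrite /tens_l /tens_r -tens_M mulr1 mul1r. Qed.

Section TensorLift.
Variables (C : comPzRingType).
Variables (f : {rmorphism A -> C}) (g : {rmorphism B -> C}).
Hypothesis fg : forall r, f (phi r) = g (psi r).

Fixpoint tens_eval (x : tens_term) : C :=
  match x with
  | TPure a b => f a * g b
  | TZero => 0
  | TOne => 1
  | TOpp x => - tens_eval x
  | TAdd x y => tens_eval x + tens_eval y
  | TMul x y => tens_eval x * tens_eval y
  end.

Lemma tens_evalE x y : tens_eq x y -> tens_eval x = tens_eval y.
Proof.
elim=> {x y} //=.
- by move=> y x z _ -> _ ->.
- by move=> x y _ ->.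
- by move=> x x' y y' _ -> _ ->.
- by move=> x x' y y' _ -> _ ->.
- by move=> x y z; ring.
- by move=> x y; ring.
- by move=> x; ring.
- by move=> x; ring.
- by move=> x y z; ring.
- by move=> x y; ring.
- by move=> x; ring.
- by move=> x y z; ring.
- by move=> a a' b; rewrite rmorphD mulrDl.
- by move=> a b b'; rewrite rmorphD mulrDr.
- by move=> r a b; rewrite !rmorphM fg mulrAC mulrC.
- by rewrite !rmorph1 mulr1.
- by move=> a a' b b'; rewrite !rmorphM mulrACA.
Qed.

Lemma tensor_univ : exists2 F : {rmorphism tensor -> C},
  (forall a, F (tens_l a) = f a) /\ (forall b, F (tens_r b) = g b) &
  forall G : {rmorphism tensor -> C},
    (forall a, G (tens_l a) = f a) -> (forall b, G (tens_r b) = g b) -> G =1 F.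
Proof.
pose F (u : tensor) : C := tens_eval (rs_repr u).
have FE x : F (rs_pi (P := tens_setoid) x) = tens_eval x.
  exact/tens_evalE/(@rs_reprE tens_setoid).
have Fz : zmod_morphism F.
  move=> u v; rewrite -(rs_reprK u) -(rs_reprK v) -rs_piN -rs_piD.
  by rewrite !FE.
have Fm : monoid_morphism F.
  split=> [|u v]; first by rewrite -rs_pi1 FE.
  by rewrite -(rs_reprK u) -(rs_reprK v) -rs_piM !FE.
pose FM := GRing.isMonoidMorphism.Build tensor C F Fm.
pose FZ := GRing.isZmodMorphism.Build tensor C F Fz.
pose FF : {rmorphism tensor -> C} := HB.pack F FZ FM.
exists FF => [|G Gl Gr u].
  by split=> [a|b]; rewrite /= /tens_l /tens_r FE /= rmorph1 ?mulr1 ?mul1r.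
rewrite -(rs_reprK u) /= FE; elim: (rs_repr u) => //=.
- by move=> a b; rewrite -Gl -Gr -rmorphM -tensE.
- by rewrite rs_pi0 rmorph0.
- by rewrite rs_pi1 rmorph1.
- by move=> x <-; rewrite rs_piN rmorphN.
- by move=> x <- y <-; rewrite rs_piD rmorphD.
- by move=> x <- y <-; rewrite rs_piM rmorphM.
Qed.

End TensorLift.
End Tensor.

(* Top local cohomology, computed by the Cech complex
     ... -> \bigoplus_i A_{x_1..x_i^..x_d} -> A_{x_1..x_d} -> 0. *)
Section Cech.
Variables (A : comPzRingType) (d : nat) (x : 'I_d -> A).

Definition cech_prod : A := \prod_(j < d) x j.
Definition cech_face_prod (i : 'I_d) : A := \prod_(j < d | j != i) x j.

Lemma cech_face_unit (i : 'I_d) s : powers (cech_face_prod i) s ->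
  exists t, loc_map (powers cech_prod) s * t = 1.
Proof.
move=> [k ->].
have [|t e] := @loc_map_unit A (powers cech_prod) (cech_prod ^+ k).
  by exists k.
have xE : cech_face_prod i * x i = cech_prod.
  by rewrite mulrC /cech_prod (bigD1 i).
by exists (loc_map _ (x i ^+ k) * t); rewrite mulrA -rmorphM -exprMn xE.
Qed.

Definition cech_face (i : 'I_d) :
    loc (powers (cech_face_prod i)) -> loc (powers cech_prod) :=
  loc_lift (cech_face_unit (i := i)).

Definition cech_diff (b : forall i : 'I_d, loc (powers (cech_face_prod i))) :
    loc (powers cech_prod) :=
  \sum_(i < d) (-1) ^+ i * cech_face (b i).

Definition cech_eq (u v : loc (powers cech_prod)) : Prop :=
  range cech_diff (u - v).

Lemma cech_face0 i : cech_face (i := i) 0 = 0.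
Proof. exact: rmorph0. Qed.
Lemma cech_faceN i b : cech_face (i := i) (- b) = - cech_face b.
Proof. exact: rmorphN. Qed.
Lemma cech_faceD i b c : cech_face (i := i) (b + c) = cech_face b + cech_face c.
Proof. exact: rmorphD. Qed.

Lemma cech_eq_of u v : u = v -> cech_eq u v.
Proof.
move=> ->; exists (fun=> 0) => //; rewrite subrr.
by apply: big1 => i _; rewrite cech_face0 mulr0.
Qed.

Lemma cech_eqN u v u' v' : u' - v' = - (u - v) -> cech_eq u v -> cech_eq u' v'.
Proof.
rewrite /cech_eq => -> [b _ <-]; exists (fun i => - b i) => //.
by rewrite -sumrN; apply: eq_bigr => i _; rewrite cech_faceN mulrN.
Qed.

Lemma cech_eqD u v u' v' w z : w - z = (u - v) + (u' - v') ->
  cech_eq u v -> cech_eq u' v' -> cech_eq w z.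
Proof.
rewrite /cech_eq => -> [b _ <-] [c _ <-]; exists (fun i => b i + c i) => //.
by rewrite -big_split; apply: eq_bigr => i _; rewrite cech_faceD mulrDr.
Qed.

Definition cech_setoid : zmodSetoid.
Proof.
refine (@ZmodSetoid (loc (powers cech_prod)) cech_eq 0 -%R +%R
  _ _ _ _ _ _ _ _ _).
- by move=> u; apply: cech_eq_of.
- by move=> u v; apply: cech_eqN; ring.
- by move=> v u w; apply: cech_eqD; ring.
- by move=> u u'; apply: cech_eqN; ring.
- by move=> u u' v v'; apply: cech_eqD; ring.
- by move=> u v w; apply: cech_eq_of; ring.
- by move=> u v; apply: cech_eq_of; ring.
- by move=> u; apply: cech_eq_of; ring.
- by move=> u; apply: cech_eq_of; ring.
Defined.

Definition top_cohomology : Type := zmod_of cech_setoid.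
HB.instance Definition _ := GRing.Zmodule.on top_cohomology.

Definition cech_class (u : loc (powers cech_prod)) : top_cohomology :=
  zs_pi (P := cech_setoid) u.

Lemma cech_prod_powers : powers cech_prod cech_prod.
Proof. by exists 1%N. Qed.

Definition paraclass : top_cohomology :=
  cech_class (loc_frac 1 cech_prod_powers).

End Cech.

Section CechFunctor.
Variables (R A : comPzRingType) (phi : {rmorphism R -> A}).
Variables (d : nat) (x : 'I_d -> R).
Local Notation y := (phi \o x).

Lemma cech_map_unit s : powers (cech_prod x) s ->
  exists t, (loc_map (powers (cech_prod y)) \o phi) s * t = 1.
Proof.
move=> [k ->] /=; apply: loc_map_unit; exists k.
by rewrite rmorphXn /= /cech_prod rmorph_prod.
Qed.

Definition cech_loc_map :
    loc (powers (cech_prod x)) -> loc (powers (cech_prod y)) :=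
  loc_lift cech_map_unit.

Definition cech_map (c : top_cohomology x) : top_cohomology y :=
  cech_class (cech_loc_map (zs_repr c)).

Lemma cech_loc_mapE a s (Ss : powers (cech_prod x) s)
    (Ss' : powers (cech_prod y) (phi s)) :
  cech_loc_map (loc_frac a Ss) = loc_frac (phi a) Ss'.
Proof. by apply: (loc_lift_eq _ erefl); rewrite /= loc_fracE. Qed.

Lemma cech_loc_map_face i (b : loc (powers (cech_face_prod x i))) :
  exists c : loc (powers (cech_face_prod y i)),
    cech_loc_map (cech_face b) = cech_face c.
Proof.
have [a [s [Ss ->]]] := locP b.
have Ss' : powers (cech_face_prod y i) (phi s).
  by case: Ss => k ->; exists k; rewrite rmorphXn /cech_face_prod rmorph_prod.
exists (loc_frac (phi a) Ss'); symmetry.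
apply: (loc_lift_eq _ erefl) => /=.
have e := loc_lift_frac (cech_face_unit (i := i)) a Ss.
have := congr1 cech_loc_map e; rewrite /cech_loc_map rmorphM /= !loc_lift_map.
by [].
Qed.

(* [cech_map] does not depend on the choice of representatives. *)
Lemma cech_mapE (u : loc (powers (cech_prod x))) :
  cech_map (cech_class u) = cech_class (cech_loc_map u).
Proof.
apply/zs_piP => /=; have [b _ e] := @zs_reprE (cech_setoid x) u.
have [c cE] : exists c : forall i, loc (powers (cech_face_prod y i)),
    forall i, cech_loc_map (cech_face (b i)) = cech_face (c i).
  by exists (fun i => sval (cid (cech_loc_map_face (b i)))) => i; case: cid.
exists c => //; rewrite /cech_class /cech_loc_map -rmorphB -e rmorph_sum.
apply: eq_bigr => i _; rewrite rmorphM rmorphXn rmorphN rmorph1.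
by rewrite -cE.
Qed.

End CechFunctor.

(* Here [R] is meant to be a Noetherian local ring with maximal ideal [m], and
   H^d_m is computed by the Cech complex of each system of parameters. *)
Definition parasolid (R A : comPzRingType) (m : set R)
    (phi : {rmorphism R -> A}) : Prop :=
  forall d (x : 'I_d -> R), has_krull_dim R d -> parameters m x ->
    paraclass x != 0 -> cech_map phi (paraclass x) != 0.

Definition universally_parasolid (R A : comPzRingType)
    (phi : {rmorphism R -> A}) : Prop :=
  forall (R' : comPzRingType) (m : set R') (psi : {rmorphism R -> R'}),
    noetherian R' -> local_ring m ->
    parasolid m (tens_r phi psi : {rmorphism R' -> tensor phi psi}).

(* Forcing algebras are only formed over nonzero rings because [{mpoly R[n]}]
   requires a [comNzRingType]. *)
Definition forcing_poly (R : comNzRingType) (f : seq R) (h : R) :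
    {mpoly R[size f]} :=
  \sum_(i < size f) f`_i *: 'X_i + h%:MP.

Definition forcing_algebra (R : comNzRingType) (f : seq R) (h : R) :
    comPzRingType :=
  quot_ring [set forcing_poly f h].

Definition forcing_map (R : comNzRingType) (f : seq R) (h : R) :
    {rmorphism R -> forcing_algebra f h} :=
  quot_map [set forcing_poly f h] \o @mpolyC (size f) R.

Definition belongs_universally_parasolidly (R : comNzRingType) (f : seq R)
    (h : R) : Prop :=
  universally_parasolid (forcing_map f h).

(* This is only meant for complete Noetherian local domains [R]; [rcons g h] is
   the chain f_(n+1), ..., f_m = h. *)
Definition parasolid_closure_dom (R : comNzRingType) (f : seq R) : set R :=
  [set h | exists g : seq R, forall i, (i < size (rcons g h))%N ->
     belongs_universally_parasolidly
       (f ++ take i (rcons g h)) (rcons g h)`_i].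

Section ParasolidClosure.
Variables (R : comPzRingType) (m : set R) (m_max : is_maximal m).

Definition local_at : comPzRingType := loc (prime_compl (maximal_prime m_max)).

Definition local_at_map : {rmorphism R -> local_at} :=
  loc_map (prime_compl (maximal_prime m_max)).

Definition completion_at : comPzRingType :=
  adic_completion (ideal_ext local_at_map m).

Definition completion_at_map : {rmorphism R -> completion_at} :=
  adic_map (ideal_ext local_at_map m) \o local_at_map.

Definition completion_quot_map (q : set completion_at) (q_prime : is_prime q) :
    {rmorphism R -> quot_prime q_prime} :=
  quot_prime_map q_prime \o completion_at_map.

End ParasolidClosure.

(* In the quotients of the completions the closure is a property of the extended
   ideal, not of its generators; membership is required for every finite
   generating sequence. *)
Definition parasolid_closure (R : comPzRingType) (I : set R) : set R :=
  [set h | forall (m : set R) (m_max : is_maximal m)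
      (q : set (completion_at m_max)) (q_prime : is_prime q),
    is_minimal_prime q ->
    forall f : seq (quot_prime q_prime),
      ideal_gen [set` f] = ideal_ext (completion_quot_map q_prime) I ->
      parasolid_closure_dom f (completion_quot_map q_prime h)].

(* Main.v *)
(* The class 1/(x_1 ... x_d) vanishes in H^d(A) iff (x_1 ... x_d)^k lies in
   (x_1^(k+1), ..., x_d^(k+1)) A for some k ("x is degenerate in A").  Since
   h lies in (f_1, ..., f_n) S, every base change R' of a forcing algebra of h maps to
   A = S (x)_R R', so it suffices that degeneracy descends from A to R'.  The ring A is
   finite over R', and R' -> A has nil kernel because Fitting ideals commute with base
   change.

   Characteristic p: Frobenius makes all of H^d(A) vanish.  Choose an ideal q maximal
   with H^d(R'/q) <> 0.  It is prime, H^d(R'/q) is divisible by every nonzero element of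
   R'/q, and a nonzero R'/q-linear map A/qA -> R'/q yields such an element that kills it.

   Characteristic 0: complete R' to W, choose a coefficient field L, and let P be the
   closure of L[x_1, ..., x_d] in W.  If x is not degenerate in W, no monomial lies in
   the ideal generated by the larger monomials (degree-lexicographic order), so nonzero
   elements of P have well-defined leading monomials; hence P is a completely integrally
   closed domain, over which W and S (x)_R W are finite.  The normalized trace is a P-linear
   retraction of P -> S (x)_R W, so degeneracy of x descends to P and thus to W. *)
Require Import Defs.
From HB Require Import structures.
From mathcomp Require Import mpoly.
From mathcomp Require Import all_boot all_order all_algebra.
From mathcomp Require Import boolp classical_sets.
From mathcomp Require Import ring zify.

Set Implicit Arguments.
Unset Strict Implicit.
Unset Printing Implicit Defensive.

Import GRing.Theory.

Local Open Scope classical_set_scope.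
Local Open Scope ring_scope.

(** * Vanishing of the paraclass *)

(** The test ring R' is an arbitrary Noetherian local K-algebra: it need be neither reduced nor a
    domain, and S (x)_R R' may have torsion. What survives base change is finiteness together with a
    nil kernel. A nil kernel is harmless as soon as a domain is involved: primes of R' are
    contracted from S (x)_R R', and a domain inside W still embeds. Torsion is harmless because
    functionals are taken from Hom_P(-, Frac P), which is nonzero whenever the domain P embeds. The
    two characteristics ask for different functionals. Frobenius makes the gap between the exponents
    k and k+1 arbitrarily large, so a functional with any nonzero value at 1 suffices. In
    characteristic 0 only the one relation is available; applying a functional to it must return the
    relation itself, so the value at 1 must be 1. This forces a normal base ring and the trace
    divided by the rank. Non-degeneracy of x, which may be assumed since otherwise nothing is left
    to prove, is what separates the monomials in x. *)

Definition monomially_degenerate (A : comPzRingType) (d : nat) (x : 'I_d -> A) :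
    Prop :=
  exists (k : nat) (a : 'I_d -> A),
    (\prod_i x i) ^+ k = \sum_i a i * x i ^+ k.+1.

Section CechCriterion.
Variables (A : comPzRingType) (d : nat) (x : 'I_d -> A).
Local Notation X := (cech_prod x).
Local Notation Y := (cech_face_prod x).
Local Notation lmap := (loc_map (powers X)).

Lemma cech_face_prodE i : X = Y i * x i.
Proof. by rewrite mulrC /cech_prod (bigD1 i). Qed.

Lemma loc_powers_cancel k u v :
  lmap (X ^+ k) * u = lmap (X ^+ k) * v -> u = v.
Proof.
have [|t e] := @loc_map_unit A (powers X) (X ^+ k); first by exists k.
by move=> /(congr1 ( *%R t)); rewrite !mulrA [t * _]mulrC e !mul1r.
Qed.

Lemma cech_face_frac i a k (Ss : powers (Y i) (Y i ^+ k)) n :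
  lmap (X ^+ (n + k)) * cech_face (loc_frac a Ss)
  = lmap (a * (Y i ^+ n * x i ^+ (n + k))).
Proof.
have e : lmap (Y i ^+ k) * cech_face (loc_frac a Ss) = lmap a.
  exact: loc_lift_frac.
have -> : X ^+ (n + k) = Y i ^+ n * x i ^+ (n + k) * Y i ^+ k.
  by rewrite [in LHS](cech_face_prodE i) exprMn exprD mulrAC.
by rewrite rmorphM -mulrA e -rmorphM mulrC.
Qed.

Lemma paraclass_eq0 : paraclass x = 0 <-> monomially_degenerate x.
Proof.
split.
- move=> /zs_piP [b _ bE].
  have /choice [k /choice [a bF]] : forall i, exists k a,
      exists Ss : powers (Y i) (Y i ^+ k), b i = loc_frac a Ss.
    move=> i; have [a [s [Ss e]]] := locP (b i); case: (Ss) => k ks.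
    by subst s; exists k, a, Ss.
  pose K := \max_i k i.
  have kK i : (K - k i + k i)%N = K by rewrite subnK // leq_bigmax.
  have bG i : lmap (X ^+ K) * cech_face (b i)
      = lmap (a i * Y i ^+ (K - k i) * x i ^+ K).
    by have [Ss ->] := bF i; rewrite -{1}(kK i) cech_face_frac kK mulrA.
  have : lmap (X ^+ K)
      = lmap (\sum_(i < d) (-1) ^+ i * (a i * Y i ^+ (K - k i) * Y i) * x i ^+ K.+1).
    have e : lmap X * loc_frac 1 (cech_prod_powers x) = 1.
      by rewrite loc_fracE rmorph1.
    rewrite -[LHS]mulr1 -e mulrCA.
    have -> : loc_frac 1 (cech_prod_powers x) = cech_diff b.
      by rewrite bE; exact: (esym (subr0 _)).
    rewrite /cech_diff mulr_sumr mulr_sumr rmorph_sum; apply: eq_bigr => i _.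
    rewrite [lmap (X ^+ K) * _]mulrCA bG.
    rewrite -[(-1) ^+ i](rmorph_sign lmap) -!rmorphM; congr (lmap _).
    by rewrite (cech_face_prodE i) exprS; ring.
  (* Equality in the localization descends to [A] only after multiplying by a further power
     [X ^+ n]. *)
  move=> /loc_fracP[_ [n ->]]; rewrite !mulr1 mulrBr => /eqP.
  rewrite subr_eq0 -exprD mulr_sumr => /eqP e.
  exists (n + K)%N, 
    (fun i : 'I_d => Y i ^+ n * ((-1) ^+ i * (a i * Y i ^+ (K - k i) * Y i))).
  rewrite -/X e; apply: eq_bigr => i _.
  by rewrite (cech_face_prodE i) exprMn -addnS exprD; ring.
- move=> [k [a]]; rewrite -/X => e; apply/zs_piP.
  have P i : powers (Y i) (Y i ^+ k.+1) by exists k.+1.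
  (* Dividing the i-th summand by X^(k+1) leaves a_i / Y_i^(k+1); the sign cancels the one in
     [cech_diff]. *)
  exists (fun i : 'I_d => (-1) ^+ i * loc_frac (a i) (P i)) => //.
  rewrite -[zs_zero _]/0 subr0; apply: (@loc_powers_cancel k.+1).
  rewrite /cech_diff mulr_sumr exprSr rmorphM -[in RHS]mulrA loc_fracE rmorph1 mulr1.
  rewrite -rmorphM -exprSr e rmorph_sum; apply: eq_bigr => i _.
  have -> : cech_face ((-1) ^+ i * loc_frac (a i) (P i))
      = (-1) ^+ i * cech_face (loc_frac (a i) (P i)).
    by rewrite /cech_face rmorphM rmorph_sign.
  rewrite (mulrA ((-1) ^+ i)) -exprMn mulrNN mulr1 expr1n mul1r.
  by have := cech_face_frac (a i) (P i) 0; rewrite add0n expr0 mul1r.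
Qed.

End CechCriterion.

Lemma monomially_degenerate_rmorph (A B : comPzRingType) (g : {rmorphism A -> B})
    d (x : 'I_d -> A) :
  monomially_degenerate x -> monomially_degenerate (g \o x).
Proof.
move=> [k [a e]]; exists k, (g \o a).
rewrite -rmorph_prod -rmorphXn e rmorph_sum; apply: eq_bigr => i _.
by rewrite rmorphM rmorphXn.
Qed.

Lemma eq_monomially_degenerate (A : comPzRingType) d (x y : 'I_d -> A) :
  x =1 y -> monomially_degenerate x -> monomially_degenerate y.
Proof. by move=> /funext ->. Qed.

Lemma cech_map_paraclass (R A : comPzRingType) (g : {rmorphism R -> A})
    d (x : 'I_d -> R) : cech_map g (paraclass x) = paraclass (g \o x).
Proof.
rewrite /paraclass cech_mapE; congr cech_class.
have P : powers (cech_prod (g \o x)) (g (cech_prod x)).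
  by exists 1%N; rewrite rmorph_prod.
rewrite (cech_loc_mapE 1 (cech_prod_powers x) P) rmorph1; apply/loc_fracP.
exists 1; first exact: ms_1.
by rewrite !mul1r /cech_prod rmorph_prod subrr.
Qed.

(** * Base change of a finite extension *)

Section BaseChange.
Variables (R S R' : comPzRingType).
Variables (phi : {rmorphism R -> S}) (psi : {rmorphism R -> R'}).
Variables (n : nat) (s : 'I_n -> S).
Hypothesis s_gen : forall y, exists c : 'I_n -> R, y = \sum_i phi (c i) * s i.

Definition lincomb (v : 'rV[R]_n) : S := \sum_i phi (v 0 i) * s i.

Lemma lincombP a u v : lincomb (a *: u + v) = phi a * lincomb u + lincomb v.
Proof.
rewrite /lincomb mulr_sumr -big_split; apply: eq_bigr => i _ /=.
by rewrite !mxE rmorphD rmorphM mulrDl mulrA.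
Qed.

Lemma lincomb_surj y : exists v, lincomb v = y.
Proof.
have [c ->] := s_gen y; exists (\row_i c i).
by apply: eq_bigr => i _; rewrite mxE.
Qed.

Definition coords y : 'rV[R]_n := sval (cid (lincomb_surj y)).
Lemma coordsK : cancel coords lincomb.
Proof. by move=> y; apply: (svalP (cid (lincomb_surj y))). Qed.

Local Notation "v ^psi" := (map_mx psi v) (at level 2, format "v ^psi").

(* The R'-module generated by the relations between the [s i]: the tensor product
   S (x)_R R' is 'rV[R']_n modulo [relmod]. *)
Inductive relmod : 'rV[R']_n -> Prop :=
| relmod_map z : lincomb z = 0 -> relmod z^psi
| relmod_lin a u v : relmod u -> relmod v -> relmod (a *: u + v).

Lemma lincomb0 : lincomb 0 = 0.
Proof. by rewrite /lincomb big1 // => i _; rewrite mxE rmorph0 mul0r. Qed.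

Lemma lincombB u v : lincomb (u - v) = lincomb u - lincomb v.
Proof.
have -> : u - v = (-1) *: v + u by rewrite scaleN1r addrC.
by rewrite lincombP rmorphN rmorph1 mulN1r addrC.
Qed.

Lemma lincomb_sum (I : finType) (F : I -> 'rV[R]_n) :
  lincomb (\sum_i F i) = \sum_i lincomb (F i).
Proof.
apply: (big_morph lincomb _ lincomb0) => w w'.
by rewrite -[w]scale1r lincombP rmorph1 mul1r scale1r.
Qed.

Lemma relmod0 : relmod 0.
Proof. by rewrite -(map_mx0 psi); apply: relmod_map; apply: lincomb0. Qed.

Lemma relmodD u v : relmod u -> relmod v -> relmod (u + v).
Proof. by move=> Nu Nv; rewrite -[u]scale1r; apply: relmod_lin. Qed.

Lemma relmodZ a u : relmod u -> relmod (a *: u).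
Proof.
by move=> Nu; rewrite -[_ *: _]addr0; apply: relmod_lin => //; apply: relmod0.
Qed.

Lemma relmodN u : relmod u -> relmod (- u).
Proof. by rewrite -scaleN1r; apply: relmodZ. Qed.

Definition is_lin (F : 'rV[R']_n -> 'rV[R']_n) :=
  forall a u v, F (a *: u + v) = a *: F u + F v.

Lemma is_linB F G : is_lin F -> is_lin G -> is_lin (fun u => F u - G u).
Proof.
move=> FL GL a u v; rewrite FL GL scalerBr opprD.
by rewrite addrACA.
Qed.

Lemma is_lin0 F : is_lin F -> F 0 = 0.
Proof.
move=> FL; have := FL 1 0 0; rewrite !scale1r addr0 => /eqP.
by rewrite -[X in X == _]addr0 (inj_eq (addrI _)) eq_sym => /eqP.
Qed.

(** The unit vectors come from R, so vectors of the form [z^psi] span. This reduces the ring axioms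
    modulo [relmod] to identities in S. *)
Lemma lin_relmod F : is_lin F -> (forall z, relmod (F z^psi)) ->
  forall u, relmod (F u).
Proof.
move=> FL FN u; rewrite (row_sum_delta u).
apply: (big_ind (fun w => relmod (F w))) => [|w w'|i _].
- by rewrite is_lin0 //; apply: relmod0.
- by move=> Nw Nw'; rewrite -[w]scale1r FL scale1r; apply: relmodD.
- rewrite -[_ *: _]addr0 FL is_lin0 // addr0; apply: relmodZ.
  by rewrite -(map_delta_mx psi); apply: FN.
Qed.

Lemma lin_relmod_stable F : is_lin F ->
  (forall z, lincomb z = 0 -> relmod (F z^psi)) ->
  forall u, relmod u -> relmod (F u).
Proof.
move=> FL FN u; elim=> [z /FN //|a v w _ Nv _ Nw]; rewrite FL.
exact: relmod_lin.
Qed.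

(** The structure constants are chosen representatives of the products s_i s_j, so this product is
    associative and unital only modulo [relmod]. *)
Definition tmul (T : comPzRingType) (g : R -> T) (u v : 'rV[T]_n) : 'rV[T]_n :=
  \sum_i \sum_j (u 0 i * v 0 j) *: map_mx g (coords (s i * s j)).

Lemma tmulC (T : comPzRingType) (g : R -> T) u v : tmul g u v = tmul g v u.
Proof.
rewrite /tmul exchange_big; apply: eq_bigr => i _; apply: eq_bigr => j _.
by rewrite mulrC [s _ * _]mulrC.
Qed.

Lemma tmul_linr u : is_lin (tmul psi u).
Proof.
move=> a v w; rewrite /tmul scaler_sumr -big_split; apply: eq_bigr => i _ /=.
rewrite scaler_sumr -big_split; apply: eq_bigr => j _ /=.
by rewrite !mxE mulrDr scalerDl scalerA mulrCA.
Qed.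

Lemma tmul_linl v : is_lin (fun u => tmul psi u v).
Proof. by move=> a u w; rewrite !(tmulC _ _ v) tmul_linr. Qed.

Local Notation "u *t v" := (tmul psi u v) (at level 40).

Lemma lincomb_tmul u v : lincomb (tmul id u v) = lincomb u * lincomb v.
Proof.
rewrite /tmul lincomb_sum.
rewrite {2}/lincomb mulr_suml; apply: eq_bigr => i _.
rewrite lincomb_sum.
rewrite /lincomb mulr_sumr; apply: eq_bigr => j _.
rewrite -/(lincomb _) -[_ *: _]addr0 lincombP lincomb0 addr0.
rewrite map_mx_id // coordsK rmorphM; ring.
Qed.

Lemma tmul_map u v : u^psi *t v^psi = (tmul id u v)^psi.
Proof.
rewrite /tmul raddf_sum; apply: eq_bigr => i _.
rewrite raddf_sum; apply: eq_bigr => j _.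
by rewrite /= map_mxZ rmorphM !mxE map_mx_id.
Qed.

Lemma relmod_mapB u v : lincomb u = lincomb v -> relmod (u^psi - v^psi).
Proof.
by move=> e; rewrite -map_mxB; apply: relmod_map; rewrite lincombB e subrr.
Qed.

Lemma relmod_tmul u v : relmod v -> relmod (u *t v).
Proof.
move=> Nv; apply: (lin_relmod (F := fun u => u *t v)); first exact: tmul_linl.
move=> {u} u; move: v Nv; apply: lin_relmod_stable; first exact: tmul_linr.
move=> z z0; rewrite tmul_map; apply: relmod_map.
by rewrite lincomb_tmul z0 mulr0.
Qed.

Definition tone := (coords 1)^psi.

Lemma relmod_tmulA u v w : relmod (u *t (v *t w) - (u *t v) *t w).
Proof.
apply: (lin_relmod (F := fun u => u *t (v *t w) - (u *t v) *t w)).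
  apply: is_linB; first exact: tmul_linl.
  by move=> a x y; rewrite tmul_linl tmul_linl.
move=> {u} u; apply: (lin_relmod (F := fun v => u^psi *t (v *t w) - (u^psi *t v) *t w)).
  apply: is_linB; first by move=> a x y; rewrite tmul_linl tmul_linr.
  by move=> a x y; rewrite tmul_linr tmul_linl.
move=> {v} v.
apply: (lin_relmod (F := fun w => u^psi *t (v^psi *t w) - (u^psi *t v^psi) *t w)).
  apply: is_linB; first by move=> a x y; rewrite !tmul_linr.
  by move=> a x y; rewrite tmul_linr.
move=> {w} w; rewrite !tmul_map; apply: relmod_mapB.
by rewrite !lincomb_tmul mulrA.
Qed.

Lemma relmod_tmul1 u : relmod (tone *t u - u).
Proof.
apply: (lin_relmod (F := fun u => tone *t u - u)).
  by apply: is_linB => //; apply: tmul_linr.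
move=> {u} u; rewrite tmul_map; apply: relmod_mapB.
by rewrite lincomb_tmul coordsK mul1r.
Qed.

Definition relmod_eq (u v : 'rV[R']_n) := relmod (u - v).

Lemma relmod_eq_of u v : u = v -> relmod_eq u v.
Proof. by move=> ->; rewrite /relmod_eq subrr; apply: relmod0. Qed.

Definition presented_zmod : zmodSetoid.
Proof.
refine (@ZmodSetoid 'rV[R']_n relmod_eq 0 -%R +%R _ _ _ _ _ _ _ _ _).
- by move=> x; apply: relmod_eq_of.
- by move=> x y /relmodN; rewrite opprB.
- by move=> y x z xy /(relmodD xy); rewrite addrA subrK.
- by move=> x x' /relmodN; rewrite opprD.
- by move=> x x' y y' xx /(relmodD xx); rewrite addrACA -opprD.
- by move=> x y z; apply: relmod_eq_of; rewrite addrA.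
- by move=> x y; apply: relmod_eq_of; rewrite addrC.
- by move=> x; apply: relmod_eq_of; rewrite add0r.
- by move=> x; apply: relmod_eq_of; rewrite addNr.
Defined.

Definition presented_setoid : comRingSetoid.
Proof.
refine (@ComRingSetoid presented_zmod tone (tmul psi) _ _ _ _ _).
- move=> /= x x' y y' xx yy; rewrite /relmod_eq.
  have -> : x *t y - x' *t y' = y *t (x - x') + x' *t (y - y').
    have L u v w : u *t (v - w) = u *t v - u *t w.
      by rewrite addrC -scaleN1r tmul_linr scaleN1r addrC.
    by rewrite !L ![y *t _]tmulC addrA subrK.
  by apply: relmodD; apply: relmod_tmul.
- exact: relmod_tmulA.
- by move=> /= x y; apply: relmod_eq_of; rewrite tmulC.
- exact: relmod_tmul1.
- move=> /= x y z; apply: relmod_eq_of.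
  by rewrite -[x in LHS]scale1r tmul_linl scale1r.
Defined.

Let C : comPzRingType := ring_of presented_setoid.
Let toC (u : 'rV[R']_n) : C := rs_pi (P := presented_setoid) u.

Let fC (y : S) : C := toC (coords y)^psi.
Let gC (r : R') : C := toC (r *: tone).

Let fC_zmod : zmod_morphism fC.
Proof.
move=> x y; rewrite /fC /toC -rs_piN -rs_piD; apply/rs_piP => /=.
rewrite /relmod_eq -map_mxB; apply: relmod_mapB.
by rewrite lincombB !coordsK.
Qed.

Let fC_monoid : monoid_morphism fC.
Proof.
split=> // x y; rewrite /fC /toC -rs_piM; apply/rs_piP => /=.
rewrite /relmod_eq tmul_map; apply: relmod_mapB.
by rewrite lincomb_tmul !coordsK.
Qed.

Let gC_zmod : zmod_morphism gC.
Proof. by move=> x y; rewrite /gC /toC -rs_piN -rs_piD /= scalerBl. Qed.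

Let gC_monoid : monoid_morphism gC.
Proof.
split=> [|x y]; first by rewrite /gC scale1r.
rewrite /gC /toC -rs_piM; apply/rs_piP => /=.
have ZL a u v : u *t (a *: v) = a *: (u *t v).
  by rewrite -[a *: v]addr0 tmul_linr (is_lin0 (@tmul_linr _)) addr0.
rewrite /relmod_eq ZL tmulC ZL scalerA [y * x]mulrC -scalerBr.
apply: relmodZ; rewrite -opprB; apply: relmodN; exact: relmod_tmul1.
Qed.

(** The concrete ring [C] receives compatible maps from S and R', hence a map from the tensor
    product. In [C], unlike in the presentation by terms, being zero is by construction membership
    in [relmod]. *)
Lemma tens_r_eq0_relmod r : tens_r phi psi r = 0 -> relmod (r *: tone).
Proof.
pose f : {rmorphism S -> C} := HB.pack fC
  (GRing.isMonoidMorphism.Build S C fC fC_monoid)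
  (GRing.isZmodMorphism.Build S C fC fC_zmod).
pose g : {rmorphism R' -> C} := HB.pack gC
  (GRing.isMonoidMorphism.Build R' C gC gC_monoid)
  (GRing.isZmodMorphism.Build R' C gC gC_zmod).
have fg a : f (phi a) = g (psi a).
  apply/rs_piP; rewrite /= /relmod_eq /tone -map_mxZ; apply: relmod_mapB.
  by rewrite -[_ *: _]addr0 lincombP !coordsK lincomb0 mulr1 addr0.
have [F [_ Fr] _] := tensor_univ fg; move=> r0.
have : g r = g 0 by rewrite -!Fr r0 !rmorph0.
by move=> /rs_piP /=; rewrite /relmod_eq scale0r subr0.
Qed.

Hypothesis phi_inj : injective phi.

(* [S] is faithful over [R], so its zeroth Fitting ideal vanishes; this survives the
   base change to [R'], and the n-th power of the annihilator of S (x)_R R' lies in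
   the zeroth Fitting ideal. *)
Lemma det_relations (Z : 'M[R]_n) :
  (forall i, lincomb (row i Z) = 0) -> \det Z = 0.
Proof.
move=> Z0; apply: phi_inj; rewrite rmorph0.
pose sc : 'cV[S]_n := \col_i s i.
have Zs : map_mx phi Z *m sc = 0.
  apply/matrixP => i j; rewrite !mxE -[RHS](Z0 i); apply: eq_bigr => k _.
  by rewrite !mxE.
have dets i : phi (\det Z) * s i = 0.
  have := congr1 (mulmx (\adj (map_mx phi Z))) Zs.
  rewrite mulmxA mul_adj_mx mulmx0 det_map_mx mul_scalar_mx => /matrixP/(_ i 0).
  by rewrite !mxE.
have [c e] := s_gen 1; rewrite -[LHS]mulr1 e mulr_sumr big1 // => i _.
by rewrite mulrCA dets mulr0.
Qed.

Lemma det_relmod (M : 'M[R']_n) : (forall i, relmod (row i M)) -> \det M = 0.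
Proof.
move=> NM; pose pure (v : 'rV_n) := exists2 z, lincomb z = 0 & v = z^psi.
(* Induction on the number of leading rows not yet known to come from R: the last of them is
   expanded along its derivation in [relmod], the determinant being linear in that row. *)
suff H k : (k <= n)%N -> forall M : 'M[R']_n, (forall i, relmod (row i M)) ->
    (forall i : 'I_n, (k <= i)%N -> pure (row i M)) -> \det M = 0.
  by apply: (H n) => // i; rewrite leqNgt ltn_ord.
elim: k => [_ {NM}M _ pM|k IH kn {NM}M NM pM].
  have /choice[z zP] : forall i, exists z, lincomb z = 0 /\ row i M = z^psi.
    by move=> i; have [//|z z0 e] := pM i; exists z.
  have -> : M = (\matrix_i z i)^psi.
    by apply/row_matrixP => i; rewrite -map_row rowK; case: (zP i).
  rewrite det_map_mx det_relations ?rmorph0 // => i.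
  by rewrite rowK; case: (zP i).
pose i0 := Ordinal kn.
pose upd (v : 'rV[R']_n) := \matrix_i if i == i0 then v else row i M.
have updr v : row i0 (upd v) = v by rewrite rowK eqxx.
have upd' v w : row' i0 (upd v) = row' i0 (upd w).
  by apply/row_matrixP => i; rewrite !row_rowsub !rowK eq_sym (negbTE (neq_lift _ _)).
have -> : M = upd (row i0 M).
  by apply/row_matrixP => i; rewrite rowK; case: eqP => [->|].
elim: (NM i0) => [z z0|a u v Nu Hu Nv Hv].
- apply: IH => [|i|i ki]; first exact: ltnW.
    by rewrite rowK; case: ifP => // _; apply: relmod_map.
  rewrite rowK; case: eqP => [_|/eqP ne]; first by exists z.
  by apply: pM; rewrite ltn_neqAle ki andbT eq_sym.
- rewrite (@determinant_multilinear _ _ _ (upd u) (upd v) i0 a 1) ?updr ?scale1r //.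
  by rewrite Hu Hv !mulr0 addr0.
Qed.

(** An element that kills 1 kills every generator, so the rows of the scalar matrix r are relations;
    its determinant is r^n. *)
Lemma tens_r_nilpotent_ord r : tens_r phi psi r = 0 -> r ^+ n = 0.
Proof.
move=> /tens_r_eq0_relmod Nr.
have -> : r ^+ n = \det (r%:M : 'M_n) by rewrite det_scalar.
apply: det_relmod => i; rewrite -scalemx1 linearZ /= row1.
have ZL a u v : u *t (a *: v) = a *: (u *t v).
  by rewrite -[a *: v]addr0 tmul_linr (is_lin0 (@tmul_linr _)) addr0.
have := relmod_tmul (delta_mx 0 i) Nr; rewrite ZL tmulC => N1.
have /(relmodZ r)/relmodN := relmod_tmul1 (delta_mx 0 i).
by rewrite scalerBr opprB => /(relmodD N1); rewrite addrC subrK.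
Qed.

End BaseChange.

Definition module_finite (R A : comPzRingType) (g : R -> A) : Prop :=
  exists (n : nat) (s : 'I_n -> A), forall y, exists c : 'I_n -> R,
    y = \sum_i g (c i) * s i.

Lemma finite_extension_module_finite (R S : comPzRingType)
    (phi : {rmorphism R -> S}) : finite_extension phi -> module_finite phi.
Proof. by move=> [_ [s sP]]; exists (size s), (fun i => s`_i). Qed.

Lemma tens_r_nilpotent (R S R' : comPzRingType) (phi : {rmorphism R -> S})
    (psi : {rmorphism R -> R'}) r : finite_extension phi ->
  tens_r phi psi r = 0 -> exists n, r ^+ n = 0.
Proof.
move=> [phi_inj [s sP]] r0; exists (size s).
exact: (tens_r_nilpotent_ord (s := fun i => s`_i) sP phi_inj r0).
Qed.

Lemma tens_r_module_finite (R S R' : comPzRingType) (phi : {rmorphism R -> S})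
    (psi : {rmorphism R -> R'}) :
  module_finite phi -> module_finite (tens_r phi psi).
Proof.
move=> [n [s sP]]; exists n, (fun i => tens_l phi psi (s i)).
pose Q u := exists c : 'I_n -> R',
  u = \sum_i tens_r phi psi (c i) * tens_l phi psi (s i).
have QD u v : Q u -> Q v -> Q (u + v).
  move=> [a ->] [b ->]; exists (fun i => a i + b i); rewrite -big_split.
  by apply: eq_bigr => i _; rewrite rmorphD mulrDl.
have Qr r u : Q u -> Q (tens_r phi psi r * u).
  move=> [a ->]; exists (fun i => r * a i); rewrite mulr_sumr.
  by apply: eq_bigr => i _; rewrite rmorphM mulrA.
have Ql y : Q (tens_l phi psi y).
  have [c ->] := sP y; exists (fun i => psi (c i)); rewrite rmorph_sum.
  by apply: eq_bigr => i _; rewrite rmorphM /= tens_lr.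
have Q0 : Q 0 by rewrite -(rmorph0 (tens_l phi psi)); apply: Ql.
have Qlu y u : Q u -> Q (tens_l phi psi y * u).
  move=> [c ->]; rewrite mulr_sumr.
  apply: (big_ind Q) => // i _; rewrite mulrCA; apply: Qr.
  by rewrite -rmorphM; apply: Ql.
have QM u v : Q u -> Q v -> Q (u * v).
  move=> [a ->] Qv; rewrite mulr_suml; apply: (big_ind Q) => // i _.
  by rewrite -mulrA; apply/Qr/Qlu.
move=> u; rewrite -/(Q u) -(rs_reprK u); elim: (rs_repr u) => //=.
- move=> a b; rewrite -[rs_pi _]/(tens phi psi a b) tensE mulrC; exact: Qr.
- by rewrite rs_pi1 -(rmorph1 (tens_l phi psi)); apply: Ql.
- by move=> x Qx; rewrite rs_piN -mulN1r -(rmorphN1 (tens_l phi psi)); apply: Qlu.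
- by move=> x Qx y Qy; rewrite rs_piD; apply: QD.
- by move=> x Qx y Qy; rewrite rs_piM; apply: QM.
Qed.

(** * Forcing algebras *)

Definition nonzero_ring (T : comPzRingType) (T1 : (1 : T) != 0) : comNzRingType :=
  HB.pack_for comNzRingType T (GRing.PzSemiRing_isNonZero.Build T T1).

Lemma quot_ring_lift (R B : comPzRingType) (A : set R) (g : {rmorphism R -> B}) :
  (forall a, A a -> g a = 0) ->
  exists F : {rmorphism quot_ring A -> B}, forall x, F (quot_map A x) = g x.
Proof.
move=> gA; have gI x : ideal_gen A x -> g x = 0.
  move=> /(_ [set y | g y = 0]); apply=> //; split=> [|y z|a y] /=.
  - exact: rmorph0.
  - by move=> y0 z0; rewrite rmorphD y0 z0 addr0.
  - by move=> y0; rewrite rmorphM y0 mulr0.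
pose F (u : quot_ring A) : B := g (rs_repr u).
have FE x : F (quot_map A x) = g x.
  apply/eqP; rewrite -subr_eq0 -rmorphB; apply/eqP/gI.
  exact: (@rs_reprE (quot_setoid A) x).
have Fz : zmod_morphism F.
  move=> u v; have [x ->] := quot_map_surj u; have [y ->] := quot_map_surj v.
  by rewrite -rmorphB !FE rmorphB.
have Fm : monoid_morphism F.
  split=> [|u v]; first by rewrite -(rmorph1 (quot_map A)) FE rmorph1.
  have [x ->] := quot_map_surj u; have [y ->] := quot_map_surj v.
  by rewrite -rmorphM !FE rmorphM.
pose FF : {rmorphism quot_ring A -> B} := HB.pack F
  (GRing.isMonoidMorphism.Build _ _ F Fm) (GRing.isZmodMorphism.Build _ _ F Fz).
by exists FF.
Qed.

(** The equation for h yields an R'-algebra map from the base-changed forcing algebra to [A], along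
    which degeneracy is pushed. The variable T_i goes to -t_i because h enters the forcing
    polynomial with a plus sign. *)
Lemma monomially_degenerate_forcing (D : comNzRingType) (f : seq D) (h : D)
    (R' A : comPzRingType) (psi : {rmorphism D -> R'}) (g : {rmorphism R' -> A})
    (t : 'I_(size f) -> A) d (x : 'I_d -> R') :
  g (psi h) = \sum_(i < size f) g (psi f`_i) * t i ->
  monomially_degenerate (tens_r (forcing_map f h) psi \o x) ->
  monomially_degenerate (g \o x).
Proof.
(* Over the zero ring every sequence is degenerate, so polynomials may be evaluated in a nonzero
   ring. *)
move=> ht degx; have [A1|A1] := eqVneq (1 : A) 0.
  exists 0%N, (fun=> 0); rewrite -[LHS]mulr1 A1 mulr0.
  by rewrite big1 // => i _; rewrite mul0r.
pose A' := nonzero_ring A1.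
pose gp : {rmorphism D -> A'} := (g \o psi : {rmorphism D -> A}).
pose ev : {rmorphism {mpoly D[size f]} -> A'} := mmap gp (fun i => - t i : A').
have [a /= -> |E EE] := @quot_ring_lift _ A [set forcing_poly f h] ev.
  rewrite /forcing_poly mmapD mmapC; apply/eqP.
  rewrite -[X in _ + X]/(g (psi h)) ht raddf_sum -big_split big1 // => i _ /=.
  rewrite mmapZ mmapX mmap1U -[gp _]/(g (psi f`_i)).
  by rewrite mulrN addNr.
have [] := @tensor_univ _ _ _ (forcing_map f h) psi A E g.
  move=> r; rewrite -[LHS]/(E (quot_map [set forcing_poly f h] r%:MP)) EE.
  by rewrite /ev /= mmapC.
move=> F [_ Fr] _; have := monomially_degenerate_rmorph F degx.
by apply: eq_monomially_degenerate => i /=; rewrite Fr.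
Qed.

(** * Finite algebras over a domain *)

Section IdomainOf.
Variable T : comPzRingType.
Hypothesis T1 : (1 : T) != 0.
Hypothesis Tint : forall x y : T, x * y = 0 -> x = 0 \/ y = 0.

Let T' : comNzRingType := nonzero_ring T1.
Let tunit : pred T' := fun x => `[< exists y, y * x = 1 >].
Let tinv (x : T') : T' :=
  if pselect (exists y, y * x = 1) is left e then sval (cid e) else x.

Let tmulVx : {in tunit, left_inverse 1 tinv *%R}.
Proof.
move=> x /asboolP e; rewrite /tinv; case: pselect => // e'.
exact: (svalP (cid e')).
Qed.

Let tunitPl (x y : T') : y * x = 1 -> tunit x.
Proof. by move=> e; apply/asboolP; exists y. Qed.

Let tinv_out : {in [predC tunit], tinv =1 id}.
Proof. by move=> x; rewrite /tinv; case: pselect => // e /asboolP[]. Qed.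

Let tU : comUnitRingType := HB.pack_for comUnitRingType T'
  (GRing.ComNzRing_hasMulInverse.Build T' tmulVx tunitPl tinv_out).

Let tidom (x y : tU) : x * y = 0 -> (x == 0) || (y == 0).
Proof. by move=> /Tint[->|->]; rewrite eqxx ?orbT. Qed.

Definition idomain_of : idomainType := HB.pack_for idomainType tU
  (GRing.ComUnitRing_isIntegral.Build tU tidom).
End IdomainOf.

Lemma common_denominator (P : idomainType) (I : finType) (F : I -> {fraction P}) :
  exists2 g : P, g != 0 & forall i, exists q, tofrac g * F i = tofrac q.
Proof.
have fr (y : {fraction P}) : exists a b : P, b != 0 /\ tofrac b * y = tofrac a.
  elim/quotW: y => y; exists (\n_y), (\d_y); split; first exact: denom_ratioP.
  rewrite !piE; apply/eqmodP; rewrite /= FracField.equivfE /FracField.mulf.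
  by rewrite !numden_Ratio ?mulf_neq0 ?oner_neq0 ?denom_ratioP //= mulr1 !mul1r mulrC.
have /choice[a /choice[b ab]] := fun i => fr (F i).
exists (\prod_i b i) => [|i].
  by apply/prodf_neq0 => i _; case: (ab i).
exists (\prod_(j | j != i) b j * a i); case: (ab i) => _ e.
by rewrite (bigD1 i) //= [b i * _]mulrC !tofracM -mulrA e.
Qed.

Section Representation.
Variables (P : idomainType) (A : comPzRingType) (b : {rmorphism P -> A}).
Variables (n : nat) (s : 'I_n -> A).
Hypothesis s_gen : forall y, exists c : 'I_n -> P, y = \sum_i b (c i) * s i.
Hypothesis b_inj : injective b.

Local Notation Q := {fraction P}.
Local Notation frac := (@tofrac P).
Local Notation lin := (lincomb b s).
Local Notation co := (coords s_gen).

Let mulmat a : 'M[P]_n := \matrix_i co (a * s i).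

Let lin_mulmat a z : lin (z *m mulmat a) = a * lin z.
Proof.
rewrite /lincomb mulr_sumr.
transitivity (\sum_j \sum_i b (z 0 j) * (b (co (a * s j) 0 i) * s i)).
  rewrite exchange_big; apply: eq_bigr => i _.
  rewrite mxE rmorph_sum mulr_suml; apply: eq_bigr => j _.
  by rewrite rmorphM !mxE mulrA.
apply: eq_bigr => j _; rewrite -mulr_sumr -/(lincomb b s _) coordsK.
by rewrite mulrCA.
Qed.

Let relmx m (W : 'M[P]_(m, n)) := forall i, lin (row i W) = 0.

(** The module of relations need not be finitely generated over P, but finitely many relations of
    maximal rank span all of them over Q. *)
Let max_relmx : exists m (W : 'M[P]_(m, n)), relmx W /\
  forall z : 'rV[P]_n, lin z = 0 -> (map_mx frac z <= map_mx frac W)%MS.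
Proof.
pose p k := `[< exists m (W : 'M[P]_(m, n)), relmx W /\ \rank (map_mx frac W) = k >].
have p0 : exists k, p k.
  exists (\rank (map_mx frac (0 : 'M[P]_(0, n)))); apply/asboolP.
  by exists 0%N, 0; split=> // -[].
have pn k : p k -> (k <= n)%N by move=> /asboolP[m [W [_ <-]]]; apply: rank_leq_col.
have [k /asboolP[m [W [WR Wk]]] kmax] := ex_maxnP p0 pn.
exists m, W; split=> // z z0.
have /kmax : p (\rank (map_mx frac (col_mx z W))).
  apply/asboolP; exists (1 + m)%N, (col_mx z W); split=> // i.
  case: (split_ordP i) => j ->; rewrite ?rowKu ?rowKd //.
  by rewrite row_id.
rewrite map_col_mx -addsmxE -Wk => le.
have := mxrank_leqif_sup (addsmxSr (map_mx frac z) (map_mx frac W)) => -[_ /esym].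
rewrite eqn_leq le mxrankS ?addsmxSr // => E.
by rewrite (submx_trans (addsmxSl _ (map_mx frac W))).
Qed.

Let lin_mul m (q : 'rV[P]_m) (W : 'M[P]_(m, n)) : relmx W -> lin (q *m W) = 0.
Proof.
move=> WR; rewrite mulmx_sum_row; apply: (big_ind (fun v => lin v = 0)).
- exact: lincomb0.
- by move=> u v u0 v0; rewrite -[u]scale1r lincombP u0 v0 mulr0 addr0.
- by move=> i _; rewrite -[_ *: _]addr0 lincombP WR lincomb0 mulr0 addr0.
Qed.

(* [A] acts by transposition on Hom_P(A, Q), a nonzero finite-dimensional space
   over Q = Frac P. *)
Lemma fraction_representation :
  exists (r : nat) (rho : A -> 'M[Q]_r) (g : P),
    [/\ (0 < r)%N, g != 0,
        forall u v, rho (u + v) = rho u + rho v,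
        forall u v, rho (u * v) = rho u *m rho v &
        (forall p, rho (b p) = (frac p)%:M) /\
        forall a i j, exists q, frac g * rho a i j = frac q].
Proof.
have [m [W [WR Wmax]]] := max_relmx.
(* The rows of [U] form a basis of the vectors orthogonal to all relations; such a vector lists the
   values at the s_i of a P-linear map from A to Q. *)
pose WF := map_mx frac W; pose U := row_base (kermx WF^T).
have UW : U *m WF^T = 0.
  by apply/sub_kermxP; rewrite eq_row_base.
have inU k (v : 'M[Q]_(k, n)) : v *m WF^T = 0 -> (v <= U)%MS.
  by move=> /sub_kermxP; rewrite eq_row_base.
have Ufree : row_free U by apply: row_base_free.
pose N a := map_mx frac (mulmat a)^T.
have relU (z : 'M[P]_n) : (forall i, lin (row i z) = 0) ->
    U *m map_mx frac z^T = 0.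
  move=> z0; have : (map_mx frac z <= WF)%MS.
    by apply/row_subP => i; rewrite -map_row; apply: Wmax.
  by move=> /submxP[Y e]; rewrite -map_trmx e trmx_mul mulmxA UW mul0mx.
have UN a : (U *m N a <= U)%MS.
  apply: inU; rewrite -mulmxA.
  have : (map_mx frac (W *m mulmat a) <= WF)%MS.
    apply/row_subP => i; rewrite -map_row; apply: Wmax.
    by rewrite row_mul lin_mulmat WR mulr0.
  move=> /submxP[Y e]; rewrite /N -map_trmx -trmx_mul -map_mxM e trmx_mul.
  by rewrite mulmxA UW mul0mx.
pose V := pinvmx U; pose rho a := U *m N a *m V.
have rhoU a : rho a *m U = U *m N a by rewrite /rho mulmxKpV.
have rhoP a X : X *m U = U *m N a -> rho a = X.
  by move=> e; rewrite /rho -e mulmxKp.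
(* Since [N a] has entries in P, denominators of [U] and [V] serve for all [a] at once. This
   uniformity is what later makes determinants almost integral. *)
have [g1 g10 g1P] := common_denominator (fun ij => U ij.1 ij.2).
have [g2 g20 g2P] := common_denominator (fun ij => V ij.1 ij.2).
exists _, rho, (g1 * g2); split.
(* If there were no functional, the relations would have full rank, and a nonzero multiple g of the
   coordinates of 1 would be a relation; then b(g) = 0, against injectivity. *)
- rewrite lt0n; apply/negP => /eqP r0.
  have U0 : U = 0 by apply/matrixP => i j; have := ltn_ord i; rewrite [X in (_ < X)%N]r0.
  have : ((cokermx WF)^T <= U)%MS.
    by apply: inU; rewrite -trmx_mul mulmx_coker trmx0.
  move=> /submxP[Z]; rewrite U0 mulmx0 => /(congr1 trmx)/eqP.
  rewrite trmxK trmx0 cokermx_eq0 => Wfull.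
  have /submxP[y] : (map_mx frac (co 1) <= WF)%MS by apply: submx_full.
  have [g g0 gP] := common_denominator (fun i => y 0 i).
  have /choice[q qP] := gP.
  move=> /(congr1 ( *:%R (frac g))); rewrite scalemxAl => e.
  have e2 : map_mx frac (g *: co 1) = map_mx frac ((\row_i q i) *m W).
    rewrite map_mxZ e map_mxM; congr (_ *m _).
    by apply/matrixP => i j; rewrite !mxE ord1; apply: qP.
  have {}e : g *: co 1 = (\row_i q i) *m W.
    apply/matrixP => i j; apply/eqP; rewrite -tofrac_eq; apply/eqP.
    by move/matrixP/(_ i j): e2; rewrite [LHS]mxE [RHS]mxE.
  have := congr1 lin e; rewrite lin_mul // -[g *: _]addr0 lincombP lincomb0 coordsK.
  by rewrite mulr1 addr0 -(rmorph0 b) => /b_inj g00; rewrite g00 eqxx in g0.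
- by rewrite mulf_neq0.
- move=> u v; apply: rhoP; rewrite mulmxDl !rhoU -mulmxDr -map_mxD -raddfD.
  apply/eqP; rewrite -subr_eq0 -mulmxBr -map_mxB -raddfB; apply/eqP/relU => i.
  rewrite linearB linearD /= lincombB -[row i (mulmat u)]scale1r lincombP.
  by rewrite rmorph1 mul1r !rowK !coordsK mulrDl subrr.
- move=> u v; apply: rhoP; rewrite -mulmxA rhoU mulmxA rhoU -mulmxA -map_mxM -trmx_mul.
  apply/eqP; rewrite -subr_eq0 -mulmxBr -map_mxB -raddfB; apply/eqP/relU => i.
  rewrite linearB /= lincombB row_mul lin_mulmat !rowK !coordsK.
  by ring.
split.
- move=> p; apply: rhoP.
  rewrite mul_scalar_mx -mul_mx_scalar -map_scalar_mx -(tr_scalar_mx).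
  apply/eqP; rewrite -subr_eq0 -mulmxBr -map_mxB -raddfB; apply/eqP/relU => i.
  rewrite linearB /= lincombB rowK coordsK -scalemx1 linearZ /= row1.
  rewrite -[_ *: _]addr0 lincombP lincomb0 addr0 {1}/lincomb (bigD1 i) //= mxE !eqxx.
  rewrite rmorph1 mul1r big1 ?addr0 ?subrr // => j ne.
  by rewrite mxE (negbTE ne) andbF rmorph0 mul0r.
- move=> a i j.
  have /choice[q1 q1P] := g1P; have /choice[q2 q2P] := g2P.
  exists (\sum_k (\sum_l q1 (i, l) * (mulmat a)^T l k) * q2 (k, j)).
  rewrite mxE mulr_sumr rmorph_sum; apply: eq_bigr => k _.
  rewrite mxE mulr_suml mulr_sumr mulr_suml rmorph_sum; apply: eq_bigr => l _.
  transitivity (frac (q1 (i, l)) * frac ((mulmat a)^T l k) * frac (q2 (k, j))).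
    by rewrite -(q1P (i, l)) -(q2P (k, j)) /= [N a _ _]mxE tofracM; ring.
  by rewrite -!tofracM.
Qed.

End Representation.

(** A diagonal entry of the representation, multiplied by the common denominator g; its value at 1
    is g. *)
Corollary nonzero_functional (P : idomainType) (A : comPzRingType)
    (b : {rmorphism P -> A}) : module_finite b -> injective b ->
  exists theta : A -> P,
    [/\ theta 1 != 0, forall u v, theta (u + v) = theta u + theta v &
        forall p u, theta (b p * u) = p * theta u].
Proof.
move=> [n [s s_gen]] b_inj.
have [r [rho [g [r0 g0 rhoD rhoM [rhob rhog]]]]] :=
  fraction_representation s_gen b_inj.
pose i0 := Ordinal r0.
have /choice[th thE] := fun a => rhog a i0 i0.
have inj : injective (@tofrac P) by move=> u v /eqP; rewrite tofrac_eq => /eqP.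
exists th; split=> [|u v|p u].
- suff -> : th 1 = g by [].
  by apply: inj; rewrite -thE -(rmorph1 b) rhob mxE eqxx rmorph1 mulr1.
- by apply: inj; rewrite tofracD -!thE rhoD mxE mulrDr.
- by apply: inj; rewrite tofracM -!thE rhoM rhob mul_scalar_mx mxE mulrCA.
Qed.

(** * Positive characteristic *)

Lemma zorn_above (T : Type) (F : set (set T)) (I0 : set T) : F I0 ->
  (forall G, G !=set0 -> G `<=` F -> total_on G subset -> F (\bigcup_(X in G) X)) ->
  exists A, [/\ F A, I0 `<=` A & forall J, F J -> A `<=` J -> J = A].
Proof.
move=> FI0 Fchain.
(* Passing to the sets A with I0 [|] A in F takes care of the empty chain, whose union would
   otherwise have to lie in F. *)
have [G GF Gtot|A [FA Amax]] := @Zorn_bigcup T [set A | F (I0 `|` A)].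
  have [G0|/set0P/negP/negPn/eqP->] := pselect (G !=set0); last first.
    by rewrite /= bigcup_set0 setU0.
  have [X0 GX0] := G0.
  suff -> : [set A | F (I0 `|` A)] (\bigcup_(X in G) X)
      = F (\bigcup_(X in [set I0 `|` X | X in G]) X).
    apply: Fchain; first by exists (I0 `|` X0); exists X0.
      by move=> _ [X GX <-]; apply: GF.
    move=> _ _ [X GX <-] [Y GY <-].
    by have [XY|YX] := Gtot _ _ GX GY; [left|right]; apply: setUS.
  rewrite /=; congr F; apply/seteqP; split=> z.
    move=> [Iz|[X GX Xz]]; first by exists (I0 `|` X0); [exists X0|left].
    by exists (I0 `|` X); [exists X|right].
  by move=> [_ [X GX <-] [Iz|Xz]]; [left|right; exists X].
exists (I0 `|` A); split=> [//|z Iz|J FJ AJ]; first by left.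
have I0J : I0 `<=` J by move=> z Iz; apply: AJ; left.
have AJ' : A `<=` J by move=> z Az; apply: AJ; right.
apply/seteqP; split=> // z Jz; right; apply: contrapT => nAz.
apply: (Amax J); last by rewrite /= (setUidr I0J).
by split=> // JA; apply/nAz/JA.
Qed.

Lemma sub_gen_chain (R : comPzRingType) (F : set (set R)) (s : seq R) :
  total_on F subset -> (exists X, F X) -> [set` s] `<=` \bigcup_(X in F) X ->
  exists2 X, F X & [set` s] `<=` X.
Proof.
move=> Ftot [X0 FX0]; elim: s => [|y s IH] sU; first by exists X0.
have [|X FX sX] := IH; first by move=> z sz; apply: sU; rewrite /= inE sz orbT.
have [|Y FY Yy] := sU y; first by rewrite /= inE eqxx.
have [XY|YX] := Ftot _ _ FX FY.
  by exists Y => // z; rewrite /= inE => /orP[/eqP->//|/sX/XY].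
by exists X => // z; rewrite /= inE => /orP[/eqP->|/sX//]; apply: YX.
Qed.

Lemma noetherian_max (R : comPzRingType) (F : set (set R)) (I0 : set R) :
  noetherian R -> F `<=` @is_ideal R -> F I0 ->
  exists I, F I /\ forall J, F J -> I `<=` J -> J = I.
Proof.
move=> noeth FI FI0.
have [G [X GX] GF Gtot|I [FI' _ Imax]] := zorn_above FI0; last by exists I.
have UI : is_ideal (\bigcup_(Y in G) Y).
  split=> [|y z [Y GY Yy] [Z GZ Zz]|a y [Y GY Yy]].
  - by exists X => //; case: (FI _ (GF _ GX)).
  - have [YZ|ZY] := Gtot _ _ GY GZ.
      by exists Z => //; have [_ ID _] := FI _ (GF _ GZ); apply: ID => //; apply: YZ.
    by exists Y => //; have [_ ID _] := FI _ (GF _ GY); apply: ID => //; apply: ZY.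
  - by exists Y => //; have [_ _ IM] := FI _ (GF _ GY); apply: IM.
have [s sE] := noeth _ UI.
have [||Y GY sY] := @sub_gen_chain _ G s Gtot; first by exists X.
  by rewrite sE; apply: sub_ideal_gen.
suff -> : \bigcup_(Z in G) Z = Y by apply: GF.
apply/seteqP; split; last by move=> z Yz; exists Y.
by rewrite sE => z; apply=> //; apply/FI/GF.
Qed.

Definition ideal_adjoin (R : comPzRingType) (I : set R) (a : R) : set R :=
  [set z | exists q u, I q /\ z = q + u * a].

Lemma ideal_adjoinP (R : comPzRingType) (I : set R) a :
  is_ideal I -> is_ideal (ideal_adjoin I a).
Proof.
move=> [I0 ID IM].
split=> [|_ _ [q [u [Iq ->]]] [q' [u' [Iq' ->]]]|c _ [q [u [Iq ->]]]].
- by exists 0, 0; rewrite mul0r addr0.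
- by exists (q + q'), (u + u'); rewrite mulrDl addrACA; split=> //; apply: ID.
- by exists (c * q), (c * u); rewrite mulrDr mulrA; split=> //; apply: IM.
Qed.

Lemma sub_ideal_adjoin (R : comPzRingType) (I : set R) a :
  I `<=` ideal_adjoin I a.
Proof. by move=> z Iz; exists z, 0; rewrite mul0r addr0. Qed.

Lemma ideal_adjoin_mem (R : comPzRingType) (I : set R) a :
  is_ideal I -> ideal_adjoin I a a.
Proof. by move=> [I0 _ _]; exists 0, 1; rewrite mul1r add0r. Qed.

Lemma ideal_gen_range (R : comPzRingType) d (y : 'I_d -> R) z :
  ideal_gen (range y) z <-> exists a, z = \sum_i a i * y i.
Proof.
split=> [|[a ->] I II yI]; last first.
  have [I0 ID IM] := II; apply: (big_ind I) => // i _.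
  by apply/IM/yI; exists i.
move=> /(_ [set z | exists a, z = \sum_i a i * y i]); apply.
- split=> [|_ _ [a ->] [b ->]|c _ [a ->]] /=.
  + by exists (fun=> 0); rewrite big1 // => i _; rewrite mul0r.
  + exists (fun i => a i + b i); rewrite -big_split.
    by apply: eq_bigr => i _; rewrite mulrDl.
  + by exists (fun i => c * a i); rewrite mulr_sumr; apply: eq_bigr => i _; rewrite mulrA.
- move=> _ [i _ <-]; exists (fun j => (j == i)%:R).
  rewrite (bigD1 i) //= eqxx mul1r big1 ?addr0 // => j /negbTE ->.
  by rewrite mul0r.
Qed.

(** * Ideals maximal among those with nonvanishing top cohomology *)

Section CechVanishing.
Variables (R : comPzRingType) (d : nat) (x : 'I_d -> R).
Local Notation X := (\prod_i x i).

(* H^d_(x) (R / a) = 0 *)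
Definition top_vanishes (a : set R) := forall n, exists N,
  exists c : 'I_d -> R, a (X ^+ N - \sum_i c i * x i ^+ (n + N)).

Variable p : set R.
Hypothesis p_ideal : is_ideal p.
Hypothesis p_max : forall J, is_ideal J -> p `<=` J -> ~ top_vanishes J -> J = p.
Hypothesis p_top : ~ top_vanishes p.

(* H^d (R / p) is divisible by every [c] outside [p]. *)
Lemma top_divisible c : ~ p c ->
  ~ (forall n, exists N, exists b : 'I_d -> R,
       p (c * X ^+ N - \sum_i b i * x i ^+ (n + N))).
Proof.
have [p0 pD pM] := p_ideal; move=> npc kill.
have [JV|nJV] := pselect (top_vanishes (ideal_adjoin p c)); last first.
  apply: npc; rewrite -(p_max (ideal_adjoinP c p_ideal) _ nJV).
    exact: ideal_adjoin_mem.
  exact: sub_ideal_adjoin.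
apply: p_top => n; have [N [a [q [u [pq e]]]]] := JV n.
(* The exponent n + N absorbs the N already spent: X^M times the first relation then has all its
   terms divisible by x_i^(n+N+M). *)
have [M [b pb]] := kill (n + N)%N.
exists (N + M)%N.
exists (fun i => a i * (\prod_(j | j != i) x j) ^+ M + u * b i).
have -> : X ^+ (N + M) - \sum_i (a i * (\prod_(j | j != i) x j) ^+ M + u * b i)
      * x i ^+ (n + (N + M))
  = X ^+ M * q + u * (c * X ^+ M - \sum_i b i * x i ^+ (n + N + M)).
  have -> : \sum_i (a i * (\prod_(j | j != i) x j) ^+ M + u * b i)
      * x i ^+ (n + (N + M))
    = X ^+ M * (\sum_i a i * x i ^+ (n + N)) + u * \sum_i b i * x i ^+ (n + N + M).
    rewrite !mulr_sumr -big_split; apply: eq_bigr => i _ /=.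
    have XE : X = (\prod_(j | j != i) x j) * x i by rewrite (bigD1 i) //= mulrC.
    rewrite [in RHS]XE exprMn addnA [x i ^+ (n + N + M)]exprD.
    by ring.
  have -> : X ^+ (N + M) = X ^+ M * (\sum_i a i * x i ^+ (n + N) + (q + u * c)).
    by rewrite -e exprD; ring.
  by ring.
by apply: pD; apply: pM.
Qed.

(** If ab lies in p and a does not, H^d of R/(p, a) vanishes; multiplying the witnesses by b shows
    that b kills H^d(R/p), so b lies in p by divisibility. *)
Lemma top_prime : is_prime p.
Proof.
have [p0 pD pM] := p_ideal; split=> //.
  move=> p1; apply: p_top => n; exists 0%N, (fun=> 0).
  by rewrite -[X in p X]mulr1; apply: pM.
move=> a b pab; apply: contrapT => /not_orP[npa npb].
have [JV|nJV] := pselect (top_vanishes (ideal_adjoin p a)); last first.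
  apply: npa; rewrite -(p_max (ideal_adjoinP a p_ideal) _ nJV).
    exact: ideal_adjoin_mem.
  exact: sub_ideal_adjoin.
apply: (top_divisible npb) => n; have [N [c [q [u [pq e]]]]] := JV n.
exists N, (fun i => b * c i).
have -> : \sum_i b * c i * x i ^+ (n + N) = b * \sum_i c i * x i ^+ (n + N).
  by rewrite mulr_sumr; apply: eq_bigr => i _; rewrite mulrA.
rewrite -mulrBr e mulrDr; apply: pD; first exact: pM.
by rewrite mulrCA [b * a]mulrC; apply: pM.
Qed.

End CechVanishing.

Lemma quot_map_eq0 (R : comPzRingType) (I : set R) r :
  is_ideal I -> quot_map I r = 0 <-> I r.
Proof.
move=> II; rewrite -(rmorph0 (quot_map I)) quot_mapP subr0.
by split=> [|/sub_ideal_gen]; first by apply.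
Qed.

Lemma ideal_ext_module_finite (R A : comPzRingType) (g : {rmorphism R -> A})
    n (s : 'I_n -> A) (I : set R) y :
  (forall z, exists c : 'I_n -> R, z = \sum_i g (c i) * s i) -> is_ideal I ->
  ideal_gen (g @` I) y ->
  exists c : 'I_n -> R, (forall i, I (c i)) /\ y = \sum_i g (c i) * s i.
Proof.
move=> s_gen [I0 ID IM].
move=> /(_ [set y | exists c : 'I_n -> R,
  (forall i, I (c i)) /\ y = \sum_i g (c i) * s i]); apply.
- split=> [|_ _ [a [Ia ->]] [b [Ib ->]]|u _ [a [Ia ->]]] /=.
  + by exists (fun=> 0); split=> //; rewrite big1 // => i _; rewrite rmorph0 mul0r.
  + exists (fun i => a i + b i); split=> [i|]; first exact: ID.
    by rewrite -big_split; apply: eq_bigr => i _; rewrite rmorphD mulrDl.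
  + have /choice[c cE] := fun i => s_gen (u * s i).
    exists (fun j => \sum_i c i j * a i); split=> [j|].
      by apply: (big_ind I) => // i _; apply/IM/Ia.
    rewrite mulr_sumr.
    transitivity (\sum_i \sum_j g (a i) * (g (c i j) * s j)).
      by apply: eq_bigr => i _; rewrite mulrCA cE mulr_sumr.
    rewrite exchange_big; apply: eq_bigr => j _; rewrite rmorph_sum mulr_suml.
    by apply: eq_bigr => i _; rewrite rmorphM mulrA [g (a i) * _]mulrC.
- move=> _ [r Ir <-]; have [c e] := s_gen 1.
  exists (fun i => c i * r); split=> [i|]; first exact: IM.
  rewrite -[LHS]mulr1 {1}e mulr_sumr; apply: eq_bigr => i _.
  by rewrite rmorphM; ring.
Qed.

(* By Cayley-Hamilton. *)
Lemma contraction_module_finite (R A : comPzRingType) (g : {rmorphism R -> A})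
    (p : set R) r : module_finite g ->
  (forall r, g r = 0 -> exists n, r ^+ n = 0) -> is_prime p ->
  ideal_gen (g @` p) (g r) -> p r.
Proof.
move=> [n [s s_gen]] g_nil [pI p1 pM] pr.
have [_ _ IM] := ideal_genP (g @` p).
have /choice[C CP] : forall i, exists c : 'I_n -> R,
    (forall j, p (c j)) /\ s i * g r = \sum_j g (c j) * s j.
  move=> i; apply: (ideal_ext_module_finite s_gen pI).
  exact: (IM (s i)).
pose M : 'M[R]_n := r%:M - \matrix_(i, j) C i j.
pose sc : 'cV[A]_n := \col_i s i.
have Ms : map_mx g M *m sc = 0.
  apply/matrixP => i j; rewrite map_mxB mulmxBl map_scalar_mx mul_scalar_mx !mxE.
  apply/eqP; rewrite subr_eq0 mulrC (CP i).2; apply/eqP.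
  by apply: eq_bigr => k _; rewrite !mxE.
have dets i : g (\det M) * s i = 0.
  have := congr1 (mulmx (\adj (map_mx g M))) Ms.
  rewrite mulmxA mul_adj_mx mulmx0 det_map_mx mul_scalar_mx => /matrixP/(_ i 0).
  by rewrite !mxE.
have /g_nil[m dm] : g (\det M) = 0.
  have [c e] := s_gen 1; rewrite -[LHS]mulr1 e mulr_sumr big1 // => i _.
  by rewrite mulrCA dets mulr0.
(* The entries of [C] lie in p, so the determinant is r^n modulo p; it also kills all of A, hence is
   nilpotent. *)
have detq : quot_map p (\det M) = quot_map p (r ^+ n).
  rewrite -det_map_mx map_mxB map_scalar_mx.
  have -> : map_mx (quot_map p) (\matrix_(i, j) C i j) = 0.
    apply/matrixP => i j; rewrite !mxE; apply/quot_map_eq0 => //.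
    exact: (CP i).1.
  by rewrite subr0 det_scalar rmorphXn.
have pX k : p (r ^+ k) -> p r.
  by elim: k => [|k IH] //; rewrite exprS => /pM[].
apply/(pX (n * m)%N)/(quot_map_eq0 _ pI).
by rewrite exprM rmorphXn /= -detq -rmorphXn dm rmorph0.
Qed.

(** Raising the relation to the power q = l^m with q >= n turns the exponents k and k+1 into kq and
    kq + q, a gap of at least n. *)
Lemma frobenius_degenerate (A : comPzRingType) d (x : 'I_d -> A) l :
  prime l -> l%:R = 0 :> A -> monomially_degenerate x -> top_vanishes x [set 0].
Proof.
move=> l_prime lA [k [a e]] n.
have [A1|A1] := eqVneq (1 : A) 0.
  by exists 0%N, (fun=> 0); apply/eqP; rewrite -[_ - _]mulr1 A1 mulr0.
pose A' := nonzero_ring A1.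
have ch : l \in [pchar A'] by rewrite inE l_prime; apply/eqP.
have [m nm] : exists m, (n <= l ^ m)%N.
  by exists n; apply/ltnW/ltn_expl/prime_gt1.
exists (k * l ^ m)%N, (fun i => a i ^+ (l ^ m) * x i ^+ (l ^ m - n)).
apply/eqP; rewrite subr_eq0 exprM e; apply/eqP.
have D (u v : A) : (u + v) ^+ (l ^ m) = u ^+ (l ^ m) + v ^+ (l ^ m).
  apply: (@exprDn_pchar A'); rewrite (eq_pnat _ (pcharf_eq ch)).
  by rewrite pnatX pnat_id.
have Z : (0 : A) ^+ (l ^ m) = 0.
  by rewrite expr0n expn_eq0 -leqn0 leqNgt prime_gt0.
rewrite (big_morph (fun u : A => u ^+ (l ^ m)) D Z); apply: eq_bigr => i _.
rewrite exprMn -mulrA -exprM -exprD; congr (_ * x i ^+ _).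
by rewrite addnA subnK // mulSn.
Qed.

Theorem degenerate_descent_pchar (R A : comPzRingType) (g : {rmorphism R -> A})
    l d (x : 'I_d -> R) :
  prime l -> l%:R = 0 :> R -> noetherian R -> module_finite g ->
  (forall r, g r = 0 -> exists n, r ^+ n = 0) ->
  monomially_degenerate (g \o x) -> monomially_degenerate x.
Proof.
move=> l_prime lR noeth g_fin g_nil degA; apply: contrapT => ndeg.
have ideal0 : is_ideal [set (0 : R)].
  by split=> // [u v -> ->|u v ->]; rewrite ?addr0 ?mulr0.
have [||p [[pI nVp] pmax]] := @noetherian_max R
    [set I | is_ideal I /\ ~ top_vanishes x I] [set 0] noeth.
- by move=> I [].
(* For the zero ideal, vanishing at n = 1 is degeneracy of x. *)
- split=> // /(_ 1%N)[N [c e]]; apply: ndeg; exists N, c.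
  by apply/eqP; rewrite -subr_eq0; apply/eqP.
have {}pmax J : is_ideal J -> p `<=` J -> ~ top_vanishes x J -> J = p.
  by move=> JI pJ nV; apply: pmax.
have p_prime := top_prime pI pmax nVp.
have B1 : (1 : quot_ring p) != 0 by apply: (quot_prime_neq0 p_prime).
have pquot r : quot_map p r = 0 <-> p r by apply: quot_map_eq0.
have Bint (u v : quot_ring p) : u * v = 0 -> u = 0 \/ v = 0.
  have [y ->] := quot_map_surj u; have [z ->] := quot_map_surj v.
  rewrite -rmorphM => /pquot; have [_ _ pM] := p_prime.
  by move=> /pM[] /pquot; [left|right].
pose B := idomain_of B1 Bint.
pose Ap : comPzRingType := quot_ring (g @` p).
pose gp : {rmorphism R -> Ap} := quot_map (g @` p) \o g.
have [r pr|b bE] := @quot_ring_lift R Ap p gp.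
  rewrite /= -(rmorph0 (quot_map _)); apply/quot_mapP; rewrite subr0.
  by apply: sub_ideal_gen; exists r.
have b_fin : module_finite b.
  have [n [s s_gen]] := g_fin; exists n, (quot_map (g @` p) \o s) => y.
  have [z ->] := quot_map_surj y; have [c ->] := s_gen z.
  exists (quot_map p \o c); rewrite rmorph_sum; apply: eq_bigr => i _ /=.
  by rewrite bE rmorphM.
have b_inj : injective b.
  apply: raddf_inj => u; have [r ->] := quot_map_surj u => /(etrans (esym (bE r))) e.
  apply/pquot; apply: (contraction_module_finite g_fin g_nil p_prime).
  by have /quot_mapP := etrans e (esym (rmorph0 (quot_map (g @` p)))); rewrite subr0.
have [theta [th1 thD thM]] := @nonzero_functional B Ap b b_fin b_inj.
have [c cE] := quot_map_surj (theta 1 : quot_ring p).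
have npc : ~ p c by move=> /pquot e; move: th1; rewrite cE e eqxx.
(* Applying [theta] to X^N = \sum a_i x_i^(n+N) in A/pA gives a relation for theta(1) X^N in R/p, so
   theta(1) kills the top cohomology. *)
apply: (top_divisible pI pmax nVp npc) => n.
have degAp : monomially_degenerate (gp \o x).
  exact: monomially_degenerate_rmorph degA.
have lAp : l%:R = 0 :> Ap by rewrite -(rmorph_nat gp) lR rmorph0.
have [N [a /eqP]] := frobenius_degenerate l_prime lAp degAp n.
rewrite subr_eq0 => /eqP e; exists N.
have /choice[v vE] := fun i => quot_map_surj (theta (a i) : quot_ring p).
exists v; apply/pquot; rewrite rmorphB rmorphM; apply/eqP; rewrite subr_eq0.
have th0 : theta 0 = 0.
  by apply: (addrI (theta 0)); rewrite -thD !addr0.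
apply/eqP; transitivity (theta (b (quot_map p ((\prod_i x i) ^+ N)) * 1)).
  by rewrite thM cE; apply: mulrC.
rewrite mulr1 bE rmorphXn rmorph_prod e (big_morph theta thD th0) rmorph_sum.
apply: eq_bigr => i _ /=.
transitivity (theta (b (quot_map p (x i ^+ (n + N))) * a i)).
  by rewrite bE rmorphXn mulrC.
by rewrite thM vE rmorphM; apply: mulrC.
Qed.

(** * Coefficient fields of complete rings *)

Definition is_subring (W : comPzRingType) (L : set W) :=
  [/\ L 1, forall u v, L u -> L v -> L (u - v) &
      forall u v, L u -> L v -> L (u * v)].

Section SubringType.
Variables (W : comNzRingType) (L : set W) (LS : is_subring L).

Definition subring_pred : {pred W} := let _ := LS in fun w => `[< L w >].

Lemma subring_predP : subring_closed subring_pred.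
Proof.
have [L1 LB LM] := LS.
split; first exact/asboolP.
  by move=> u v /asboolP Lu /asboolP Lv; apply/asboolP/LB.
by move=> u v /asboolP Lu /asboolP Lv; apply/asboolP/LM.
Qed.
HB.instance Definition _ := GRing.isSubringClosed.Build W subring_pred subring_predP.

Definition subring_of : Type := {w : W | w \in subring_pred}.
HB.instance Definition _ := SubChoice.on subring_of.
HB.instance Definition _ := [SubChoice_isSubComNzRing of subring_of by <:].

Definition subring_val : {rmorphism subring_of -> W} := \val.

Lemma subring_val_inj : injective subring_val. Proof. exact: val_inj. Qed.

Lemma subring_val_eq0 u : subring_val u = 0 -> u = 0.
Proof. by rewrite -(rmorph0 subring_val) => /subring_val_inj. Qed.

Lemma subring_valP u : L (subring_val u).
Proof. exact/asboolP/(valP u). Qed.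

Lemma subring_valS w : L w -> exists u, subring_val u = w.
Proof. by move=> /asboolP Lw; exists (exist _ w Lw). Qed.
End SubringType.

Record complete_filtration (W : comPzRingType) (K : nat -> set W) : Prop :=
  CompleteFiltration {
    cf_ideal : forall n, is_ideal (K n);
    cf_0 : forall w, K 0%N w;
    cf_S : forall n, K n.+1 `<=` K n;
    cf_M : forall m n u v, K m u -> K n v -> K (m + n)%N (u * v);
    cf_sep : forall w, (forall n, K n w) -> w = 0;
    cf_lim : forall a : nat -> W, (forall n, K n (a n.+1 - a n)) ->
      exists w, forall n, K n (w - a n);
    cf_unit : forall w, ~ K 1%N w -> exists v, v * w = 1;
    cf_proper : ~ K 1%N 1
  }.

Lemma horner_subr_dvd (W : comNzRingType) (p : {poly W}) a b :
  exists c, p.[a] - p.[b] = c * (a - b).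
Proof.
elim/poly_ind: p => [|p e [c IH]]; first by exists 0; rewrite !horner0 subrr mul0r.
exists (c * a + p.[b]); rewrite !hornerMXaddC.
have -> : p.[a] = p.[b] + c * (a - b) by rewrite -IH addrC subrK.
by ring.
Qed.

Lemma horner_taylor2 (W : comNzRingType) (p : {poly W}) a h :
  exists c, p.[a + h] = p.[a] + p^`().[a] * h + c * h ^+ 2.
Proof.
elim/poly_ind: p => [|p e [c IH]].
  by exists 0; rewrite deriv0 !horner0 !mul0r !addr0.
exists (p^`().[a] + c * a + c * h).
rewrite derivMXaddC hornerD hornerMX !hornerMXaddC IH.
by ring.
Qed.

Section Filtration.
Variables (W : comPzRingType) (K : nat -> set W).
Hypothesis KP : complete_filtration K.

Lemma cf_D n u v : K n u -> K n v -> K n (u + v).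
Proof. by case: (cf_ideal KP n) => _ ID _; apply: ID. Qed.

Lemma cf_N n u : K n u -> K n (- u).
Proof. exact: is_idealN (cf_ideal KP n). Qed.

Lemma cf_B n u v : K n u -> K n v -> K n (u - v).
Proof. by move=> Ku Kv; apply/cf_D/cf_N. Qed.

Lemma cf_Ml n a u : K n u -> K n (a * u).
Proof. by case: (cf_ideal KP n) => _ _ IM; apply: IM. Qed.

Lemma cf_z n : K n 0.
Proof. by case: (cf_ideal KP n). Qed.

Lemma cf_sum n (I : Type) (r : seq I) (P : pred I) (F : I -> W) :
  (forall i, P i -> K n (F i)) -> K n (\sum_(i <- r | P i) F i).
Proof. by move=> KF; apply: (big_ind (K n)) => //; [apply: cf_z|apply: cf_D]. Qed.

Lemma cf_le m n : (m <= n)%N -> K n `<=` K m.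
Proof.
move=> /subnK <-; elim: (n - m)%N => [|k IH] // w /(cf_S KP).
exact: IH.
Qed.

Lemma cf_chain n a b c : K n (a - b) -> K n (b - c) -> K n (a - c).
Proof. by move=> /cf_D H /H; rewrite addrA subrK. Qed.

End Filtration.

(** * Hensel's lemma and maximal coefficient subrings *)

Section CoefficientField.
Variables (W : comNzRingType) (K : nat -> set W).
Hypothesis KP : complete_filtration K.

Lemma hensel (p : {poly W}) t : K 1%N p.[t] -> ~ K 1%N p^`().[t] ->
  exists t', p.[t'] = 0 /\ K 1%N (t' - t).
Proof.
move=> pt /(cf_unit KP)[u ut].
(* Newton iteration with the derivative inverted at t only; each step gains one level of the
   filtration, which is enough for convergence. *)
pose T n := iter n (fun z => z - u * p.[z]) t.
have TP n : K n.+1 p.[T n] /\ K 1%N (T n - t).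
  elim: n => [|n [IH1 IH2]]; first by rewrite subrr; split=> //; apply: (cf_z KP).
  split; last first.
    rewrite /= -/(T n) addrAC; apply: (cf_B KP) => //.
    by apply: (cf_Ml KP); apply: (cf_le KP) IH1.
  have [c /= ->] := horner_taylor2 p (T n) (- (u * p.[T n])).
  have [e ee] := horner_subr_dvd p^`() (T n) t.
  have -> : p.[T n] + p^`().[T n] * - (u * p.[T n]) + c * (- (u * p.[T n])) ^+ 2
    = - (u * e) * (p.[T n] * (T n - t)) + c * u ^+ 2 * (p.[T n] * p.[T n]).
    have -> : p^`().[T n] = e * (T n - t) + p^`().[t] by rewrite -ee subrK.
    have -> : p.[T n] + (e * (T n - t) + p^`().[t]) * - (u * p.[T n])
        + c * (- (u * p.[T n])) ^+ 2
      = p.[T n] * (1 - u * p^`().[t]) - (u * e) * (p.[T n] * (T n - t))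
        + c * u ^+ 2 * (p.[T n] * p.[T n]) by ring.
    by rewrite ut subrr mulr0 add0r mulNr.
  apply: (cf_D KP); apply: (cf_Ml KP); first by rewrite -addn1; apply: (cf_M KP).
  by apply: (@cf_le _ _ KP _ (n.+1 + n.+1)); [rewrite addnS ltnS leq_addr|apply: (cf_M KP)].
have [n|t' t'P] := cf_lim KP (a := T).
  rewrite /= addrAC subrr add0r; apply/(cf_N KP)/(cf_Ml KP).
  by apply: (cf_le KP) (TP n).1.
exists t'; split; last by apply: (cf_chain KP) (t'P 1%N) (TP 1%N).2.
apply: (cf_sep KP) => n; rewrite -[p.[t']](subrK p.[T n]); apply: (cf_D KP).
  by have [c ->] := horner_subr_dvd p t' (T n); apply: (cf_Ml KP).
by apply: (cf_le KP) (TP n).1.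
Qed.

Hypothesis char0 : forall n, exists v : W, v * n.+1%:R = 1.

(** These are the subrings that embed in the residue field; the maximal ones turn out to be
    coefficient fields. *)
Definition coefficient_subring (L : set W) :=
  is_subring L /\ forall l, L l -> K 1%N l -> l = 0.

Lemma coefficient_subring_unit L l : coefficient_subring L -> L l -> l <> 0 ->
  exists v, v * l = 1.
Proof. by move=> [_ L0] Ll l0; apply: (cf_unit KP) => /(L0 _ Ll). Qed.

Lemma coefficient_subring_mul0 L u v : coefficient_subring L -> L u ->
  u * v = 0 -> u = 0 \/ v = 0.
Proof.
move=> LC Lu uv; have [|u0] := pselect (u = 0); [by left|right].
have [w wu] := coefficient_subring_unit LC Lu u0.
by rewrite -[v]mul1r -wu -mulrA uv mulr0.
Qed.

Lemma cf_unit_proper v w : v * w = 1 -> ~ K 1%N w.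
Proof. by move=> vw Kw; apply: (cf_proper KP); rewrite -vw; apply: (cf_Ml KP). Qed.

(** The image of the integers, from which Zorn's lemma starts: a positive integer is a unit and so
    lies outside [K 1]. *)
Lemma prime_subring_coefficient :
  coefficient_subring [set w : W | exists a b : nat, w = a%:R - b%:R].
Proof.
split.
  split=> [|_ _ [a [b ->]] [c [e ->]]|_ _ [a [b ->]] [c [e ->]]].
  - by exists 1%N, 0%N; rewrite subr0.
  - by exists (a + e)%N, (b + c)%N; rewrite !natrD; ring.
  - by exists (a * c + b * e)%N, (a * e + b * c)%N; rewrite !natrD !natrM; ring.
have H n : K 1%N n%:R -> n = 0%N.
  by case: n => // n Kn; have [v /cf_unit_proper] := char0 n.
move=> _ [a [b ->]]; have [ab|/ltnW ba] := leqP a b.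
  move=> /(cf_N KP); rewrite opprB -(natrB _ ab) => /H/eqP.
  rewrite subn_eq0 => ba.
  by have /eqP -> : a == b; [rewrite eqn_leq ab ba|rewrite subrr].
by rewrite -(natrB _ ba) => /H ->.
Qed.

Lemma coefficient_subring_chain (G : set (set W)) : G !=set0 ->
  G `<=` coefficient_subring -> total_on G subset ->
  coefficient_subring (\bigcup_(X in G) X).
Proof.
move=> [X0 GX0] GC Gtot; split; last by move=> l [X /GC[_ X_0] Xl]; apply: X_0.
split=> [|u v [X GX Xu] [Y GY Yv]|u v [X GX Xu] [Y GY Yv]].
- by exists X0 => //; have [[]] := GC _ GX0.
- have [XY|YX] := Gtot _ _ GX GY.
    by exists Y => //; have [[_ B _] _] := GC _ GY; apply: B => //; apply: XY.
  by exists X => //; have [[_ B _] _] := GC _ GX; apply: B => //; apply: YX.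
- have [XY|YX] := Gtot _ _ GX GY.
    by exists Y => //; have [[_ _ B] _] := GC _ GY; apply: B => //; apply: XY.
  by exists X => //; have [[_ _ B] _] := GC _ GX; apply: B => //; apply: YX.
Qed.

Section MaximalCoefficients.
Variable L : set W.
Hypothesis LC : coefficient_subring L.
Hypothesis Lmax : forall J, coefficient_subring J -> L `<=` J -> J = L.

Lemma coefficient_inverse v l : L l -> v * l = 1 -> L v.
Proof.
move=> Ll vl; have [[L1 LB LM] L0] := LC.
(* [J] is the fraction field of L inside W, again a coefficient subring. *)
pose J := [set w | exists b, [/\ L b, b <> 0 & L (w * b)]].
have LJ : L `<=` J.
  move=> w Lw; exists 1; rewrite mulr1; split=> //.
  by apply/eqP; rewrite oner_eq0.
have nz b b' : L b -> b <> 0 -> b' <> 0 -> b * b' <> 0.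
  by move=> Lb b0 b0' /(coefficient_subring_mul0 LC Lb) [].
suff <- : J = L.
  exists l; rewrite vl; split=> // l0; move: vl; rewrite l0 mulr0.
  by move=> /esym/eqP; rewrite oner_eq0.
apply: Lmax => //; split.
  split=> [|w w' [b [Lb b0 wb]] [b' [Lb' b0' wb']]
    |w w' [b [Lb b0 wb]] [b' [Lb' b0' wb']]].
  - exact: LJ.
  - exists (b * b'); split; [exact: LM|exact: nz|].
    have -> : (w - w') * (b * b') = (w * b) * b' - (w' * b') * b by ring.
    by apply: LB; apply: LM.
  - exists (b * b'); split; [exact: LM|exact: nz|].
    by rewrite mulrACA; apply: LM.
move=> w [b [Lb b0 wb]] Kw; have : b * w = 0.
  by apply: L0; [rewrite mulrC|apply: (cf_Ml KP)].
by move=> /(coefficient_subring_mul0 LC Lb) [].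
Qed.

Local Notation Lt := (subring_of LC.1).
Local Notation val := (subring_val LC.1).
Local Notation ev q t := (map_poly val q).[t].

(** The hypothesis says that L[t] still embeds in the residue field, so maximality gives L[t] =
    L. *)
Lemma coefficient_adjoin t :
  (forall q : {poly Lt}, K 1%N (ev q t) -> ev q t = 0) -> L t.
Proof.
move=> tP; pose J := [set w | exists q : {poly Lt}, w = ev q t].
have LJ : L `<=` J.
  move=> w Lw; have [u <-] := subring_valS LC.1 Lw.
  by exists u%:P; rewrite map_polyC hornerC.
suff <- : J = L by exists 'X; rewrite map_polyX hornerX.
apply: Lmax => //; split; last by move=> _ [q ->]; apply: tP.
split=> [|_ _ [q ->] [q' ->]|_ _ [q ->] [q' ->]].
- by apply: LJ; case: (LC) => -[].
- by exists (q - q'); rewrite rmorphB hornerD hornerN.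
- by exists (q * q'); rewrite rmorphM hornerM.
Qed.

(** Either L[t] embeds in the residue field, and t lies in L, or the residue of t is algebraic over
    L. In the latter case its minimal polynomial is separable, Hensel's lemma lifts the residue to a
    root t', and L[t'] embeds. *)
Lemma coefficient_lift t : exists2 l, L l & K 1%N (t - l).
Proof.
have [tr|/existsNP[q0 /not_implyP[Kq0 nq0]]] :=
  pselect (forall q : {poly Lt}, K 1%N (ev q t) -> ev q t = 0).
  by exists t; [apply: coefficient_adjoin|rewrite subrr; apply: (cf_z KP)].
pose bad n := `[< exists q : {poly Lt}, [/\ size q = n, q != 0 & K 1%N (ev q t)] >].
have exbad : exists n, bad n.
  exists (size q0); apply/asboolP; exists q0; split=> //.
  by apply/eqP => q00; apply: nq0; rewrite q00 rmorph0 horner0.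
have [n /asboolP[q [qn qn0 Kq]] nmin] := ex_minnP exbad.
have small (r : {poly Lt}) : (size r < n)%N -> K 1%N (ev r t) -> r = 0.
  move=> rn Kr; apply/eqP; apply: contraTT rn => r0; rewrite -leqNgt.
  by apply: nmin; apply/asboolP; exists r.
have [v vl] : exists v, v * val (lead_coef q) = 1.
  apply: (coefficient_subring_unit LC); first exact: subring_valP.
  by move=> /subring_val_eq0/eqP; rewrite lead_coef_eq0 (negbTE qn0).
have [lv lvE] := subring_valS LC.1 (coefficient_inverse (subring_valP _) vl).
have lvl : lv * lead_coef q = 1.
  by apply: (@subring_val_inj _ _ LC.1); rewrite rmorphM lvE vl rmorph1.
pose G := lv *: q.
have Gmon : G \is monic.
  have e : G`_(size q).-1 = 1 by rewrite coefZ.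
  have sG : size G = size q.
    apply/eqP; rewrite eqn_leq size_scale_leq /=.
    rewrite -(prednK (n := size q)) ?size_poly_gt0 // ltnNge; apply/negP => le.
    by move: e; rewrite nth_default // => /eqP; rewrite eq_sym oner_eq0.
  by rewrite monicE lead_coefE sG e.
have sG : (size G <= n)%N by rewrite -qn size_scale_leq.
have KG : K 1%N (ev G t).
  by rewrite map_polyZ hornerZ; apply: (cf_Ml KP).
have Gn : size G = n.
  apply/eqP; rewrite eqn_leq sG leqNgt; apply/negP => /small /(_ KG) G0.
  by move: Gmon; rewrite G0 monicE lead_coef0 eq_sym oner_eq0.
have n1 : (1 < n)%N.
  rewrite ltnNge; apply/negP => n1.
  have := size1_polyC (leq_trans sG n1) => GC.
  have G1 : G = 1 by move: Gmon; rewrite GC monicE lead_coefC => /eqP ->.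
  by apply: (cf_proper KP); move: KG; rewrite G1 rmorph1 hornerC.
(* The coefficient of the derivative in degree n - 2 is the integer n - 1, a unit; by minimality of
   n the derivative then does not vanish at the residue of t. *)
have dG : G^`() != 0.
  apply/eqP => /(congr1 (fun p : {poly Lt} => p`_n.-2)).
  rewrite coef_deriv coef0.
  have -> : G`_n.-2.+1 = 1.
    by have /monicP := Gmon; rewrite lead_coefE Gn; case: (n) n1 => [|[|]].
  have [w e] := char0 n.-2; move=> /(congr1 val); rewrite rmorphMn rmorph1 rmorph0.
  move=> e0; move: e; rewrite e0 mulr0 => /esym/eqP.
  by rewrite oner_eq0.
have [|t' [t'0 t't]] := @hensel (map_poly val G) t KG.
  rewrite deriv_map => /small dG0; move: dG; rewrite dG0 ?eqxx //.
  by rewrite -Gn; apply: lt_size_deriv; apply: monic_neq0.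
exists t'; last by rewrite -opprB; apply: (cf_N KP).
(* Modulo [G] a polynomial may be replaced by its remainder, which takes the same value at t' and
   congruent values at t and t'; minimality forces the remainder to be 0. *)
apply: coefficient_adjoin => H KH.
have HE := Pdiv.RingMonic.rdivp_eq Gmon H.
have rE : ev H t' = ev (Pdiv.Ring.rmodp H G) t'.
  by rewrite {1}HE rmorphD rmorphM hornerD hornerM t'0 mulr0 add0r.
suff r0 : Pdiv.Ring.rmodp H G = 0 by rewrite rE r0 rmorph0 horner0.
apply: small; first by rewrite -Gn; apply: Pdiv.Ring.ltn_rmodpN0; apply: monic_neq0.
rewrite -[X in K 1%N X](subrK (ev (Pdiv.Ring.rmodp H G) t')).
apply: (cf_D KP); last by rewrite -rE.
have [c ->] := horner_subr_dvd (map_poly val (Pdiv.Ring.rmodp H G)) t t'.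
by apply: (cf_Ml KP); rewrite -opprB; apply: (cf_N KP).
Qed.
End MaximalCoefficients.

Theorem exists_coefficient_field : exists2 L, coefficient_subring L &
  forall t, exists2 l, L l & K 1%N (t - l).
Proof.
have [L [LC _ Lmax]] :=
  zorn_above prime_subring_coefficient coefficient_subring_chain.
by exists L => // t; apply: coefficient_lift.
Qed.

End CoefficientField.

(** * Power series in a system of parameters *)

Lemma ideal_gen_sub (R : comPzRingType) (A I : set R) :
  is_ideal I -> A `<=` I -> ideal_gen A `<=` I.
Proof. by move=> II AI z; apply. Qed.

Lemma ideal_genM (R : comPzRingType) (A B C : set R) u v :
  (forall a b, A a -> B b -> ideal_gen C (a * b)) ->
  ideal_gen A u -> ideal_gen B v -> ideal_gen C (u * v).
Proof.
have [C0 CD CM] := ideal_genP C; move=> ABC Au; move: v.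
apply: ideal_gen_sub => [|b Bb].
  split=> [|v w|a v]; first by rewrite mulr0.
    by move=> /= Cv Cw; rewrite mulrDr; apply: CD.
  by move=> /= Cv; rewrite mulrCA; apply: CM.
move: u Au; apply: ideal_gen_sub => [|a Aa]; last exact: ABC.
split=> [|v w|a v] /=; first by rewrite mul0r.
  by move=> Cv Cw; rewrite mulrDl; apply: CD.
by move=> Cv; rewrite -mulrA; apply: CM.
Qed.

Section PowerSeries.
Variables (W : comNzRingType) (K : nat -> set W).
Hypothesis KP : complete_filtration K.
Variable L : set W.
Hypothesis LC : coefficient_subring K L.
Hypothesis Llift : forall t, exists2 l, L l & K 1%N (t - l).
Variables (d : nat) (x : 'I_d -> W) (s : nat).
Hypothesis Kx1 : forall i, K 1%N (x i).
Hypothesis Kx : forall n w, K (n + s)%N w ->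
  exists c : 'I_d -> W, (forall i, K n (c i)) /\ w = \sum_i c i * x i.
Hypothesis x_ndeg : ~ monomially_degenerate x.

Local Notation Lt := (subring_of LC.1).
Local Notation val := (subring_val LC.1).
Local Notation ev := (mmap val x).
Local Notation xm := (mmap1 x).

(** An inverse v in W is replaced by a lift v' of its residue; v' l - 1 then lies in both L and
    [K 1], hence is 0. *)
Lemma coefficient_field l : L l -> l <> 0 -> exists2 v, L v & v * l = 1.
Proof.
move=> Ll l0; have [[L1 LB LM] L0] := LC.
have [v vl] := coefficient_subring_unit KP LC Ll l0.
have [v' Lv' Kv'] := Llift v; exists v' => //.
apply/eqP; rewrite -subr_eq0; apply/eqP/L0; first by apply: LB => //; apply: LM.
rewrite -vl -mulrBl mulrC; apply: (cf_Ml KP).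
by rewrite -opprB; apply: (cf_N KP).
Qed.

Lemma xmD a b : xm (a + b)%MM = xm a * xm b.
Proof. by apply: commr_mmap1_M => i y; apply: mulrC. Qed.

Lemma K_xm a : K (mdeg a) (xm a).
Proof.
rewrite mdegE /mmap1; elim/big_rec2: _ => [|i n w _ Kw]; first exact: (cf_0 KP).
apply: (cf_M KP) => //; elim: (a i) => [|k IH]; first exact: (cf_0 KP).
by rewrite exprS -add1n; apply: (cf_M KP).
Qed.

(** * Ideals generated by the monomials beyond a given one *)

Definition above (a : 'X_{1..d}) :=
  ideal_gen [set z | exists2 b, (a < b)%O & z = xm b].
Definition weakly_above (a : 'X_{1..d}) :=
  ideal_gen [set z | exists2 b, (a <= b)%O & z = xm b].

Lemma above_ideal a : is_ideal (above a). Proof. exact: ideal_genP. Qed.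
Lemma weakly_above_ideal a : is_ideal (weakly_above a). Proof. exact: ideal_genP. Qed.

Lemma sub_above a b : (a <= b)%O -> above b `<=` above a.
Proof.
move=> ab; apply: ideal_gen_sub (ideal_genP _) _ => _ [c bc ->].
by apply: sub_ideal_gen; exists c => //; apply: Order.POrderTheory.le_lt_trans bc.
Qed.

Lemma above_weakly_above a b : (a < b)%O -> weakly_above b `<=` above a.
Proof.
move=> ab; apply: ideal_gen_sub (ideal_genP _) _ => _ [c bc ->].
by apply: sub_ideal_gen; exists c => //; apply: Order.POrderTheory.lt_le_trans bc.
Qed.

Lemma weakly_above_above a : above a `<=` weakly_above a.
Proof.
apply: ideal_gen_sub (ideal_genP _) _ => _ [c ac ->].
by apply: sub_ideal_gen; exists c => //; apply: Order.POrderTheory.ltW.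
Qed.

Lemma above_mul a b u v : above a u -> weakly_above b v -> above (a + b)%MM (u * v).
Proof.
apply: ideal_genM => _ _ [a' aa ->] [b' bb ->].
by apply: sub_ideal_gen; exists (a' + b')%MM; rewrite ?xmD //; apply: ltmc_le_add.
Qed.

Lemma weakly_above_K a : weakly_above a `<=` K (mdeg a).
Proof.
apply: ideal_gen_sub (cf_ideal KP _) _ => _ [c ac ->].
by apply: (cf_le KP) (K_xm c); apply: lemc_mdeg.
Qed.

(* A monomial of degree at least that of X^k, other than X^k, is divisible by some
   x_i^(k+1). *)
Lemma above_xm a : ~ above a (xm a).
Proof.
(* With k = deg a, the monomial x^a divides X^k; multiplying by the quotient moves a relation at x^a
   to one at X^k. *)
move=> aa; apply: x_ndeg; pose k := mdeg a; pose ck := [multinom k | _ < d].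
have acK : (a <= ck)%MM.
  by apply/mnm_lepP => i; rewrite mnmE /k mdegE (bigD1 i) //= leq_addr.
suff /ideal_gen_range[c e] : ideal_gen (range (fun i => x i ^+ k.+1)) (xm ck).
  exists k, c; rewrite -e /mmap1 -prodrXl; apply: eq_bigr => i _.
  by rewrite mnmE.
have [I0 ID IM] := ideal_genP (range (fun i => x i ^+ k.+1)).
rewrite -(submK acK) xmD; move: (xm a) aa.
apply: ideal_gen_sub => [|_ [b ab ->]].
  split=> [|v w|c v] /=; first by rewrite mulr0.
    by move=> Cv Cw; rewrite mulrDr; apply: (ID).
  by move=> Cv; rewrite mulrCA; apply: (IM).
rewrite /= -xmD; set c := (_ + _)%MM.
have [le|/existsNP[i /negP]] := pselect (forall i, (c i <= ck i)%N).
  exfalso; have /mnm_lepP ccK := le.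
  have : (ck < c)%O by rewrite -(submK acK) ltmc_add2r.
  by rewrite Order.TotalTheory.ltNge -(submK ccK) lemc_addl.
rewrite -ltnNge mnmE => ki; rewrite /mmap1 (bigD1 i) //= mulrC.
apply: (IM); rewrite -(subnK ki) exprD; apply: (IM); apply: sub_ideal_gen.
by exists i.
Qed.

Lemma above_term a l : L l -> l <> 0 -> ~ above a (l * xm a).
Proof.
move=> Ll l0 aa; have [v _ vl] := coefficient_field Ll l0.
have [_ _ IM] := above_ideal a.
by apply: (@above_xm a); rewrite -[xm a]mul1r -vl -mulrA; apply: (IM).
Qed.

(** The powers of (x_1, ..., x_d), in a form that lets one factor x_i be split off at a time. *)
Fixpoint Ipow n (w : W) : Prop :=
  if n is k.+1 then exists c : 'I_d -> W, (forall i, Ipow k (c i)) /\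
    w = \sum_i c i * x i else True.

Lemma Ipow_K n : Ipow n `<=` K n.
Proof.
elim: n => [|n IH] w; first by move=> _; apply: (cf_0 KP).
move=> [c [Ic ->]]; apply: (cf_sum KP) => i _; rewrite mulrC -add1n.
by apply: (cf_M KP) => //; apply: IH; apply: Ic.
Qed.

(** With [Ipow_K], this shows that the filtration and the powers of (x) define the same topology. *)
Lemma K_Ipow n : K (n * s)%N `<=` Ipow n.
Proof.
elim: n => [|n IH] w //; rewrite mulSn addnC => /Kx[c [Kc ->]].
by exists c; split=> // i; apply/IH/Kc.
Qed.

Lemma Ipow_above n a : (mdeg a < n)%N -> Ipow n `<=` above a.
Proof.
move=> an w Iw.
have : ideal_gen [set z | exists2 b, (n <= mdeg b)%N & z = xm b] w.
  elim: n w Iw {an} => [|n IH] w.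
    move=> _; have [_ _ IM] := ideal_genP [set z | exists2 b, (0 <= mdeg b)%N & z = xm b].
    rewrite -[w]mulr1; apply: (IM); apply: sub_ideal_gen; exists 0%MM => //.
    by rewrite mmap11.
  move=> [c [Ic ->]]; set A := ideal_gen _.
  have [I0 ID IM] : is_ideal A by apply: ideal_genP.
  apply: (big_ind A) => // i _; move: (c i) (IH _ (Ic i)).
  apply: ideal_gen_sub => [|_ [b nb ->]].
    split=> [|v w'|e v] /=; first by rewrite mul0r.
      by move=> Cv Cw; rewrite mulrDl; apply: (ID).
    by move=> Cv; rewrite -mulrA; apply: (IM).
  apply: sub_ideal_gen; exists (b + U_(i))%MM; first by rewrite mdegD mdeg1 addn1.
  by rewrite xmD mmap1U.
apply: (@ideal_gen_sub _ _ (above a)) => [|_ [b nb ->]]; first exact: above_ideal.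
apply: sub_ideal_gen; exists b => //; apply: lt_mdeg_ltmc.
exact: leq_trans nb.
Qed.

(* The image of the power series ring L[[X_1, ..., X_d]]. *)
Definition series_ring : set W :=
  [set w | forall n, exists q : {mpoly Lt[d]}, K n (w - ev q)].
Local Notation P := series_ring.

Lemma series_poly q : P (ev q).
Proof. by move=> n; exists q; rewrite subrr; apply: (cf_z KP). Qed.

Lemma series_subring : is_subring P.
Proof.
split=> [|u v Pu Pv n|u v Pu Pv n].
- by rewrite -(rmorph1 ev); apply: series_poly.
- have [q Kq] := Pu n; have [r Kr] := Pv n; exists (q - r).
  have -> : u - v - ev (q - r) = (u - ev q) - (v - ev r).
    by rewrite rmorphB /=; ring.
  exact: (cf_B KP).
- have [q Kq] := Pu n; have [r Kr] := Pv n; exists (q * r).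
  have -> : u * v - ev (q * r) = v * (u - ev q) + ev q * (v - ev r).
    by rewrite rmorphM /=; ring.
  by apply: (cf_D KP); apply: (cf_Ml KP).
Qed.

Lemma series_B u v : P u -> P v -> P (u - v).
Proof. by case: series_subring => _ B _; apply: B. Qed.
Lemma series_M u v : P u -> P v -> P (u * v).
Proof. by case: series_subring => _ _; apply. Qed.
Lemma series_1 : P 1. Proof. by case: series_subring. Qed.
Lemma series_0 : P 0. Proof. by rewrite -(subrr 1); apply: series_B series_1 series_1. Qed.
Lemma series_N u : P u -> P (- u).
Proof. by rewrite -sub0r; apply: series_B series_0. Qed.
Lemma series_D u v : P u -> P v -> P (u + v).
Proof. by move=> Pu Pv; rewrite -[v]opprK; apply/series_B/series_N. Qed.
Lemma series_X u n : P u -> P (u ^+ n).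
Proof.
move=> Pu; elim: n => [|n IH]; first exact: series_1.
by rewrite exprS; apply: series_M.
Qed.
Lemma series_sum (I : finType) (F : I -> W) :
  (forall i, P (F i)) -> P (\sum_i F i).
Proof. by move=> PF; apply: (big_ind P) => //; [apply: series_0|apply: series_D]. Qed.

Lemma series_closed w : (forall n, exists2 p, P p & K n (w - p)) -> P w.
Proof.
move=> wP n; have [p Pp Kp] := wP n; have [q Kq] := Pp n.
by exists q; apply: (cf_chain KP) Kp Kq.
Qed.

Lemma series_coef l : L l -> P l.
Proof.
move=> Ll; have [u <-] := subring_valS LC.1 Ll.
by rewrite -[val u](mmapC x); apply: series_poly.
Qed.

Lemma series_xm a : P (xm a).
Proof. by rewrite -(mmapX x val); apply: series_poly. Qed.

Lemma series_x i : P (x i).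
Proof. by rewrite -(mmap1U x); apply: series_xm. Qed.

(** * Leading monomials *)

Definition lead (y : W) a :=
  exists l, [/\ L l, l <> 0 & above a (y - l * xm a)].

Lemma lead_exists y : P y -> y <> 0 -> exists a, lead y a.
Proof.
move=> Py y0; have /existsNP[n nK] : ~ forall n, K n y.
  by move=> Ky; apply: y0; apply: (cf_sep KP).
(* An approximation modulo (x)^n determines the leading term. The smallest monomial of [q] has
   degree below n, since otherwise y would lie in [K n]; the error lies beyond that monomial. *)
have [q Kq] := Py (n * s)%N.
pose a := mlast q.
have [qa|qa] := boolP ((q != 0) && (mdeg a < n)%N); last first.
  exfalso; apply: nK; rewrite -[y](subrK (ev q)); apply: (cf_D KP).
    by apply/Ipow_K/K_Ipow.
  have [->|q0] := eqVneq q 0; first by rewrite rmorph0; apply: (cf_z KP).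
  move: qa; rewrite q0 -leqNgt => an.
  rewrite /mmap big_seq; apply: (cf_sum KP) => m mq; apply: (cf_Ml KP).
  apply: (cf_le KP) (K_xm m); apply: leq_trans an _.
  by apply/lemc_mdeg/mlast_lemc.
have [q0 an] := andP qa; have aq := mlast_supp q0.
exists a, (val q@_a); split; first exact: subring_valP.
  by move=> /subring_val_eq0/eqP; rewrite mcoeff_eq0 aq.
have [I0 ID IM] := above_ideal a.
rewrite -[y](subrK (ev q)) -addrA; apply: (ID).
  by apply: (Ipow_above an); apply: K_Ipow.
rewrite /mmap (bigD1_seq a) ?msupp_uniq //= addrAC subrr add0r.
rewrite big_seq_cond; apply: (big_ind (above a));
  [exact: I0|exact: ID|move=> m /andP[mq ma]].
apply: (IM); apply: sub_ideal_gen; exists m => //.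
by rewrite Order.POrderTheory.lt_neqAle eq_sym ma mlast_lemc.
Qed.

Lemma lead_weakly_above y a : lead y a -> weakly_above a y.
Proof.
move=> [l [Ll l0 /weakly_above_above ya]]; rewrite -[y](subrK (l * xm a)).
have [_ ID IM] := weakly_above_ideal a.
by apply: (ID) => //; apply: (IM); apply: sub_ideal_gen; exists a.
Qed.

(** Otherwise l x^a itself would lie in [above a], which non-degeneracy excludes. Uniqueness of
    leading monomials rests on this. *)
Lemma lead_above y a b : lead y a -> above b y -> (b < a)%O.
Proof.
move=> [l [Ll l0 ya]] yb; rewrite Order.TotalTheory.ltNge; apply/negP => ab.
apply: (above_term Ll l0 (a := a)).
have [_ ID _] := above_ideal a.
have -> : l * xm a = y + - (y - l * xm a) by ring.
apply: (ID); first by apply: (sub_above ab).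
by apply: is_idealN ya; apply: above_ideal.
Qed.

Lemma lead_unique y a b : lead y a -> lead y b -> a = b.
Proof.
move=> ya yb; case: (Order.TotalTheory.ltgtP a b) => // ab.
  have := lead_above ya (above_weakly_above ab (lead_weakly_above yb)).
  by rewrite Order.POrderTheory.ltxx.
have := lead_above yb (above_weakly_above ab (lead_weakly_above ya)).
by rewrite Order.POrderTheory.ltxx.
Qed.

Lemma lead_neq0 y a : lead y a -> y <> 0.
Proof.
move=> ya y0; have [I0 _ _] := above_ideal a.
have : (a < a)%O by apply: (lead_above ya); rewrite y0.
by rewrite Order.POrderTheory.ltxx.
Qed.

Lemma leadM y z a b : lead y a -> lead z b -> lead (y * z) (a + b)%MM.
Proof.
move=> [l [Ll l0 ya]] zb; have [m [Lm m0 zb']] := zb.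
have [[_ _ LM] _] := LC.
exists (l * m); split; first exact: LM.
  by move=> /(coefficient_subring_mul0 KP LC Ll) [].
have -> : y * z - l * m * xm (a + b)%MM
    = (y - l * xm a) * z + l * ((z - m * xm b) * xm a) by rewrite xmD; ring.
have [_ ID IM] := above_ideal (a + b)%MM.
apply: (ID); first by apply: above_mul => //; apply: lead_weakly_above.
apply: (IM); rewrite addmC; apply: above_mul => //.
by apply: sub_ideal_gen; exists a.
Qed.

Lemma lead1 : lead 1 0%MM.
Proof.
exists 1; split; first by case: LC => -[].
  by apply/eqP; rewrite oner_eq0.
by rewrite mmap11 mulr1 subrr; case: (above_ideal 0%MM).
Qed.

Lemma leadX y a n : lead y a -> lead (y ^+ n) (a *+ n)%MM.
Proof.
move=> ya; elim: n => [|n IH]; first by rewrite mulm0n; apply: lead1.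
by rewrite exprS mulmS; apply: leadM.
Qed.

Lemma series_integral u v : P u -> P v -> u * v = 0 -> u = 0 \/ v = 0.
Proof.
move=> Pu Pv uv; have [|u0] := pselect (u = 0); [by left|right].
apply: contrapT => v0; have [a ua] := lead_exists Pu u0.
by have [b vb] := lead_exists Pv v0; apply: lead_neq0 (leadM ua vb) uv.
Qed.

(** The shift b allows for the degree lost in a division by an element whose leading monomial has
    degree b. *)
Lemma series_lim (q : nat -> W) b : (forall n, P (q n) /\ K (n - b)%N (q n)) ->
  exists2 u, P u & forall n, K n (u - \sum_(j < n + b) q j).
Proof.
move=> qP; pose a n := \sum_(j < n + b) q j.
have [n|u uP] := cf_lim KP (a := a).
  rewrite /a addSn big_ord_recr /= addrAC subrr add0r -{1}(addnK b n).
  by case: (qP (n + b)%N).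
exists u => //; apply: series_closed => n; exists (a n) => //.
by apply: series_sum => j; case: (qP j).
Qed.


(** * Complete integral closedness, by long division of power series *)

Section CompletelyIntegrallyClosed.
Variables (e g : W).
Hypotheses (Pe : P e) (Pg : P g) (e0 : e <> 0) (g0 : g <> 0).

(* f / e is almost integral over the power series ring. *)
Definition almost_integral f := forall n, exists2 w, P w & g * f ^+ n = e ^+ n * w.

(** By the binomial formula, with the same multiplier g; the division can thus continue with the
    remainder. *)
Lemma almost_integral_sub f t : P t -> almost_integral f ->
  almost_integral (f - t * e).
Proof.
move=> Pt fP n; have /choice[w wP] : forall i,
    exists w, P w /\ g * f ^+ i = e ^+ i * w.
  by move=> i; have [w] := fP i; exists w.
exists (\sum_(i < n.+1) ((-1) ^+ i * w (n - i)%N * t ^+ i) *+ 'C(n, i)).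
  apply: series_sum => i; rewrite -mulr_natr; apply: series_M.
    apply: series_M; last exact: series_X.
    apply: series_M; last by case: (wP (n - i)%N).
    by apply/series_X/series_N/series_1.
  have -> : 'C(n, i)%:R = \sum_(j < 'C(n, i)) (1 : W) by rewrite sumr_const card_ord.
  by apply: series_sum => _; apply: series_1.
rewrite exprBn !mulr_sumr; apply: eq_bigr => i _.
rewrite !mulrnAr; congr (_ *+ _).
have [_ wE] := wP (n - i)%N; have le_in : (i <= n)%N by rewrite -ltnS.
have -> : e ^+ n = e ^+ (n - i) * e ^+ i by rewrite -exprD subnK.
rewrite exprMn.
transitivity ((-1) ^+ i * t ^+ i * e ^+ i * (g * f ^+ (n - i))); first by ring.
by rewrite wE; ring.
Qed.

Variable b : 'X_{1..d}.
Hypothesis eb : lead e b.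

(** Leading monomials of g f^n = e^n w give n b_i <= c_i + n a_i. Taking n = c_i + 1 makes the right
    side less than n (a_i + 1). *)
Lemma almost_integral_lead f a : P f -> almost_integral f -> lead f a -> (b <= a)%MM.
Proof.
move=> Pf fP fa; have [c gc] := lead_exists Pg g0.
apply/mnm_lepP => i; pose n := (c i).+1.
have [w Pw wE] := fP n.
have gfl := leadM gc (leadX n fa).
have w0 : w <> 0 by move=> w0; apply: (lead_neq0 gfl); rewrite wE w0 mulr0.
have [sg ws] := lead_exists Pw w0.
have := leadM (leadX n eb) ws; rewrite -wE => /(lead_unique gfl)/mnmP/(_ i).
rewrite !mnmDE !mulmnE => E.
have : (b i * n < (a i).+1 * n)%N.
  apply: leq_ltn_trans (leq_addr (sg i) _) _.
  by rewrite -E /n; nia.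
by rewrite ltn_mul2r ltnS => /andP[].
Qed.

Lemma almost_integral_step f a : P f -> almost_integral f -> lead f a ->
  exists t, [/\ P t, K (mdeg a - mdeg b)%N t & above a (f - t * e)].
Proof.
move=> Pf fP fa; have ba := almost_integral_lead Pf fP fa.
have [l [Ll l0 fl]] := fa; have [m [Lm m0 em]] := eb.
have [v Lv vm] := coefficient_field Lm m0.
(* The quotient of the leading terms of f and e. *)
pose t := l * v * xm (a - b)%MM; exists t; split.
- by apply: series_M (series_xm _); apply: series_M; apply: series_coef.
- apply: (cf_Ml KP); have <- : mdeg (a - b)%MM = (mdeg a - mdeg b)%N.
    by rewrite -{2}(submK ba) mdegD addnK.
  exact: K_xm.
- have [_ ID IM] := above_ideal a.
  have -> : f - t * e = (f - l * xm a) + - (l * v) * ((e - m * xm b) * xm (a - b)%MM).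
    have -> : xm a = xm (a - b)%MM * xm b by rewrite -xmD submK.
    rewrite /t.
    transitivity (f - (v * m) * (l * (xm (a - b)%MM * xm b))
        - l * v * ((e - m * xm b) * xm (a - b)%MM)).
      by ring.
    by rewrite vm; ring.
  apply: (ID) => //; apply: (IM).
  have -> : above a = above (b + (a - b))%MM by rewrite addmC submK.
  apply: above_mul => //.
  by apply: sub_ideal_gen; exists (a - b)%MM.
Qed.

(** Groups all the division steps with leading degree N, so that the leading degree of the remainder
    rises and the successive quotients tend to 0. *)
Lemma almost_integral_degree N f : P f -> almost_integral f ->
  (forall a, lead f a -> (N <= mdeg a)%N) ->
  exists t, [/\ P t, K (N - mdeg b)%N t &
    forall a, lead (f - t * e) a -> (N < mdeg a)%N].
Proof.
(* The leading monomial rises at each step, so the number of monomials of degree at most N from it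
   onwards drops. *)
pose mu (a : 'X_{1..d}) := #|[pred c : 'X_{1..d < N.+1} | (a <= c)%O]|.
suff H k : forall f, P f -> almost_integral f ->
    (forall a, lead f a -> (N <= mdeg a)%N) ->
    (forall a, lead f a -> mdeg a = N -> (mu a <= k)%N) ->
    exists t, [/\ P t, K (N - mdeg b)%N t &
      forall a, lead (f - t * e) a -> (N < mdeg a)%N].
  move=> Pf fP fN; have [f0|f0] := pselect (f = 0).
    apply: (H 0%N) => // a /lead_neq0; by rewrite f0.
  have [a fa] := lead_exists Pf f0.
  by apply: (H (mu a)) => // c /(lead_unique fa) ->.
elim: k => [|k IH] {}f Pf fP fN fk.
  exists 0; split; [exact: series_0|exact: (cf_z KP)|] => a.
  rewrite mul0r subr0 => fa; rewrite ltn_neqAle fN // andbT; apply/eqP => Na.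
  have := fk a fa (esym Na); rewrite leqn0 => /eqP/card0_eq.
  have aN : (mdeg a < N.+1)%N by rewrite -Na.
  by move=> /(_ (BMultinom aN)); rewrite inE Order.POrderTheory.lexx.
have [[a [fa aN]]|noa] := pselect (exists a, lead f a /\ mdeg a = N); last first.
  exists 0; split; [exact: series_0|exact: (cf_z KP)|] => a.
  rewrite mul0r subr0 => fa; rewrite ltn_neqAle fN // andbT; apply/eqP => Na.
  by apply: noa; exists a.
have [t [Pt Kt ta]] := almost_integral_step Pf fP fa.
have Pf1 : P (f - t * e) by apply: series_B => //; apply: series_M.
have leads c : lead (f - t * e) c -> (a < c)%O by move=> /lead_above; apply.
have [|c fc cN|t' [Pt' Kt' t'N]] := IH _ Pf1 (almost_integral_sub Pt fP).
- move=> c /leads/Order.POrderTheory.ltW/lemc_mdeg; by rewrite aN.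
- rewrite -ltnS; apply: leq_trans (fk a fa aN); apply/proper_card/properP.
  have ac := leads c fc; split.
    apply/fintype.subsetP => z; rewrite !inE; apply: Order.POrderTheory.le_trans.
    exact: Order.POrderTheory.ltW.
  have aN' : (mdeg a < N.+1)%N by rewrite aN.
  exists (BMultinom aN'); rewrite inE ?Order.POrderTheory.lexx //=.
  by rewrite -Order.TotalTheory.ltNge.
exists (t + t'); split.
- exact: series_D.
- by apply: (cf_D KP) => //; rewrite -aN.
- by move=> c; rewrite mulrDl opprD addrA; apply: t'N.
Qed.

(** The remainders [F n] have leading degree at least n and tend to 0; the quotients sum to u by
    [series_lim] with shift deg b. *)
Lemma almost_integral_dvd f : P f -> almost_integral f ->
  exists2 u, P u & f = u * e.
Proof.
move=> Pf fP.
pose good N h := [/\ P h, almost_integral h & forall a, lead h a -> (N <= mdeg a)%N].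
(* The choice is made for all pairs, with default 0 at those that are not good, so that the
   remainders can be defined by recursion. *)
have /choice[tau tauP] : forall Nh : nat * W, exists t, good Nh.1 Nh.2 ->
    [/\ P t, K (Nh.1 - mdeg b)%N t & good Nh.1.+1 (Nh.2 - t * e)].
  move=> [N h] /=; have [[Ph hP hN]|nh] := pselect (good N h); last by exists 0.
  have [t [Pt Kt tN]] := almost_integral_degree Ph hP hN; exists t; split=> //.
  split=> //; first by apply: series_B => //; apply: series_M.
  exact: almost_integral_sub.
pose F := fix F n := if n is k.+1 then F k - tau (k, F k) * e else f.
have FP n : good n (F n).
  by elim: n => [|n /(tauP (n, _))[]].
pose q n := tau (n, F n).
have [n|u Pu uP] := @series_lim q (mdeg b).
  by have [] := tauP (n, _) (FP n).
exists u => //; apply/eqP; rewrite -subr_eq0; apply/eqP/(cf_sep KP) => n.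
have FE N : f - (\sum_(j < N) q j) * e = F N.
  elim: N => [|N IH]; first by rewrite big_ord0 mul0r subr0.
  by rewrite big_ord_recr /= mulrDl opprD addrA IH.
have -> : f - u * e = F (n + mdeg b)%N - (u - \sum_(j < n + mdeg b) q j) * e.
  by rewrite -FE; ring.
apply: (cf_B KP); last by rewrite mulrC; apply: (cf_Ml KP).
have [PF _ FN] := FP (n + mdeg b)%N; have [->|F0] := pselect (F (n + mdeg b)%N = 0).
  exact: (cf_z KP).
have [a Fa] := lead_exists PF F0; have na := FN a Fa.
apply: (cf_le KP) (weakly_above_K (lead_weakly_above Fa)).
exact: leq_trans (leq_addr _ _) na.
Qed.
End CompletelyIntegrallyClosed.

Theorem series_completely_integrally_closed e g f : P e -> P g -> P f ->
  e <> 0 -> g <> 0 -> (forall n, exists2 w, P w & g * f ^+ n = e ^+ n * w) ->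
  exists2 u, P u & f = u * e.
Proof.
move=> Pe Pg Pf e0 g0 fP; have [b eb] := lead_exists Pe e0.
exact: (almost_integral_dvd Pe Pg g0 eb).
Qed.

(** Nakayama's lemma by successive approximation: an element of (x)^n is a combination of the
    generators with coefficients in P and [K n], up to an error in (x)^(n+1), and the coefficients
    can be summed in P. *)
Theorem series_module_finite (I : finType) (ee : I -> W) :
  (forall w, exists l : I -> W, (forall i, L (l i)) /\
     K s (w - \sum_i l i * ee i)) ->
  forall w, exists c : I -> W, (forall i, P (c i)) /\ w = \sum_i c i * ee i.
Proof.
move=> eeP w0.
have step n : forall w, Ipow n w -> exists q : I -> W,
    (forall i, P (q i) /\ K n (q i)) /\ Ipow n.+1 (w - \sum_i q i * ee i).
  elim: n => [|n IH] w.
    move=> _; have [l [Ll Kl]] := eeP w; exists l; split.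
      by move=> i; split; [apply: series_coef|apply: (cf_0 KP)].
    by have [c [_ ->]] := Kx (n := 0) Kl; exists c.
  move=> [c [Ic ->]]; have /choice[q qP] := fun i => IH _ (Ic i).
  exists (fun j => \sum_i q i j * x i); split=> [j|].
    split.
      by apply: series_sum => i; apply: series_M; [case: ((qP i).1 j)|apply: series_x].
    apply: (cf_sum KP) => i _; rewrite mulrC -add1n; apply: (cf_M KP) => //.
    by have [/(_ j)[]] := qP i.
  exists (fun i => c i - \sum_j q i j * ee j); split=> [i|]; first by case: (qP i).
  transitivity (\sum_i c i * x i - \sum_i \sum_j q i j * x i * ee j).
    congr (_ - _); rewrite exchange_big; apply: eq_bigr => j _.
    by rewrite mulr_suml.
  rewrite -sumrB; apply: eq_bigr => i _; rewrite mulrBl mulr_suml; congr (_ - _).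
  by apply: eq_bigr => j _; rewrite mulrAC.
have /choice[tau tauP] : forall nw : nat * W, exists q : I -> W, Ipow nw.1 nw.2 ->
    (forall i, P (q i) /\ K nw.1 (q i)) /\ Ipow nw.1.+1 (nw.2 - \sum_i q i * ee i).
  move=> [n w] /=; have [/step[q qP]|nI] := pselect (Ipow n w); first by exists q.
  by exists (fun=> 0).
pose F := fix F n := if n is k.+1 then F k - \sum_i tau (k, F k) i * ee i else w0.
have FP n : Ipow n (F n) by elim: n => [|n /(tauP (n, _))[]].
pose te n i := tau (n, F n) i.
have qP n i : P (te n i) /\ K n (te n i).
  by have [/(_ i)] := tauP (n, _) (FP n).
have /choice[u uP] : forall i, exists u, P u /\
    forall n, K n (u - \sum_(j < n) te j i).
  move=> i; have [n|u Pu uK] := @series_lim (te^~ i) 0.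
    by rewrite subn0.
  by exists u; split=> // n; have := uK n; rewrite addn0.
exists u; split=> [i|]; first by case: (uP i).
apply/eqP; rewrite -subr_eq0; apply/eqP/(cf_sep KP) => n.
have FE N : w0 - \sum_i (\sum_(j < N) te j i) * ee i = F N.
  elim: N => [|N IH].
    by rewrite big1 ?subr0 // => i _; rewrite big_ord0 mul0r.
  rewrite /= -IH -addrA -opprD -big_split; congr (_ - _).
  by apply: eq_bigr => i _; rewrite big_ord_recr /= mulrDl IH.
have -> : w0 - \sum_i u i * ee i
    = F n - \sum_i (u i - \sum_(j < n) te j i) * ee i.
  rewrite -FE -addrA -opprD -big_split; congr (_ - _).
  by apply: eq_bigr => i _ /=; rewrite -mulrDl addrC subrK.
apply: (cf_B KP); first exact/Ipow_K.
by apply: (cf_sum KP) => i _; rewrite mulrC; apply: (cf_Ml KP); case: (uP i).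
Qed.

End PowerSeries.

(** * Characteristic zero *)

Section Splitting.
Variable P : idomainType.
Local Notation frac := (@tofrac P).
Local Notation Q := {fraction P}.
Hypothesis P_cic : forall e g f : P, e <> 0 -> g <> 0 ->
  (forall n, exists w, g * f ^+ n = e ^+ n * w) -> exists u, f = u * e.
Hypothesis P_char0 : forall n, exists v : P, v * n.+1%:R = 1.

Lemma frac_inj : injective frac.
Proof. by move=> u v /eqP; rewrite tofrac_eq => /eqP. Qed.

Lemma fraction_almost_integral (u : Q) (g : P) : g != 0 ->
  (forall n, exists w, frac g * u ^+ n = frac w) -> exists v, u = frac v.
Proof.
move=> g0 uP; have [e e0 eP] := common_denominator (fun _ : 'I_1 => u).
have [f fE] := eP ord0; have [||n|v vE] := @P_cic e g f; try exact/eqP.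
  have [w wE] := uP n; exists w; apply: frac_inj.
  by rewrite !tofracM !tofracXn -fE -wE exprMn; ring.
exists v; have fe0 : frac e != 0 by rewrite tofrac_eq0.
by apply: (mulfI fe0); rewrite fE vE tofracM mulrC.
Qed.

(* By repeated division by 'X - n. *)
Lemma integral_valued_poly (q : {poly Q}) n0 :
  (forall n, (n0 <= n)%N -> exists w, q.[n%:R] = frac w) ->
  exists q0 : {poly P}, q = map_poly frac q0.
Proof.
elim: {q}_.+1 {-2}q n0 (ltnSn (size q)) => // m IH q n0 qm qP.
have [w wE] := qP n0 (leqnn _).
have /factor_theorem[q1 q1E] : root (q - (frac w)%:P) n0%:R.
  by rewrite rootE hornerD hornerN hornerC wE subrr.
have qE : q = q1 * ('X - (n0%:R)%:P) + (frac w)%:P by rewrite -q1E subrK.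
have [q10|q10] := eqVneq q1 0.
  by exists w%:P; rewrite map_polyC qE q10 mul0r add0r.
have [||q0 q0E] := IH q1 n0.+1.
- suff : (size q1 < size q)%N by move=> /leq_trans/(_ qm).
  have s1 : size (q1 * ('X - (n0%:R)%:P)) = (size q1).+1.
    by rewrite size_Mmonic ?monicXsubC // size_XsubC addn2.
  rewrite qE size_polyDl s1 // ltnS (leq_trans (size_polyC_leq1 _)) //.
  by rewrite size_poly_gt0.
(* For n > n0 the quotient has value (q(n) - q(n0)) / (n - n0) at n, which lies in P because
   positive integers are units there. *)
- move=> n nn; have [w' w'E] := qP n (ltnW nn).
  have [v vE] := P_char0 (n - n0.+1)%N.
  have nE : (n - n0.+1).+1%:R = n%:R - n0%:R :> P.
    by rewrite -subSn // subSS natrB // ltnW.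
  exists (v * (w' - w)); rewrite tofracM tofracB -w'E qE.
  rewrite hornerD hornerM hornerD hornerN hornerX !hornerC addrK.
  have -> : n%:R - n0%:R = frac (n - n0.+1).+1%:R.
    by rewrite nE tofracB !rmorph_nat.
  by rewrite mulrCA -tofracM vE tofrac1 mulr1.
exists (q0 * ('X - n0%:R%:P) + w%:P).
by rewrite rmorphD rmorphM rmorphB /= map_polyX !map_polyC /= rmorph_nat -q0E.
Qed.

Variables (A : comPzRingType) (b : {rmorphism P -> A}).

(* The splitting is 1/r times the trace of a representation over Frac P; its
   values are integral because determinants are almost integral. *)
Theorem normal_finite_splitting : module_finite b -> injective b ->
  exists tau : A -> P, [/\ tau 1 = 1, forall u v, tau (u + v) = tau u + tau v &
    forall p u, tau (b p * u) = p * tau u].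
Proof.
move=> [n [s s_gen]] b_inj.
have [r [rho [g [r0 g0 rhoD rhoM [rhob rhog]]]]] :=
  fraction_representation s_gen b_inj.
have rho0 : rho 0 = 0 by apply: (addrI (rho 0)); rewrite -rhoD !addr0.
have rhoN a : rho (- a) = - rho a.
  by apply: (addrI (rho a)); rewrite -rhoD !subrr.
have rho1 : rho 1 = 1%:M by rewrite -(rmorph1 b) rhob rmorph1.
have detX a k : \det (rho (a ^+ k)) = \det (rho a) ^+ k.
  elim: k => [|k IH]; first by rewrite rho1 det1.
  by rewrite !exprS rhoM det_mulmx IH.
(* For every k, g^r det(rho a)^k is the determinant of g rho(a^k), a matrix over P; so det(rho a) is
   almost integral. *)
have detP a : exists w, \det (rho a) = frac w.
  apply: (@fraction_almost_integral _ (g ^+ r)) => [|k]; first exact: expf_neq0.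
  have /choice[w wE] : forall ij : 'I_r * 'I_r, exists w,
      frac g * rho (a ^+ k) ij.1 ij.2 = frac w by move=> ij; apply: rhog.
  exists (\det (\matrix_(i, j) w (i, j))).
  rewrite -detX tofracXn -detZ -det_map_mx; congr (\det _).
  by apply/matrixP => i j; rewrite !mxE (wE (i, j)).
(* The characteristic polynomial at m is det(rho(m - a)), a determinant of the same kind. *)
have charP a m : exists w, (char_poly (rho a)).[m%:R] = frac w.
  have [w wE] := detP (b m%:R - a); exists w; rewrite -wE rhoD rhoN rhob.
  rewrite -horner_evalE -det_map_mx; congr (\det _).
  apply/matrixP => i j; rewrite !mxE /= /horner_eval hornerD hornerN hornerMn.
  rewrite hornerX hornerC.
  by rewrite rmorph_nat.
have trP a : exists w, \tr (rho a) = frac w.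
  have [q qE] := @integral_valued_poly _ 0 (fun m _ => charP a m).
  exists (- q`_r.-1); rewrite rmorphN /= -[RHS]opprK -(coef_map frac) -qE.
  by rewrite char_poly_trace // !opprK.
have /choice[tr trE] := trP.
have [v vr] := P_char0 r.-1; rewrite prednK // in vr.
have trD u w : tr (u + w) = tr u + tr w.
  by apply: frac_inj; rewrite tofracD -!trE rhoD mxtraceD.
have trM p u : tr (b p * u) = p * tr u.
  by apply: frac_inj; rewrite tofracM -!trE rhoM rhob mul_scalar_mx mxtraceZ.
exists (fun a => v * tr a); split=> [|u w|p u].
- suff -> : tr 1 = r%:R by [].
  by apply: frac_inj; rewrite -trE rho1 mxtrace1 rmorph_nat.
- by rewrite trD mulrDr.
- by rewrite trM mulrCA.
Qed.

End Splitting.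

Lemma module_finite_fin (R A : comPzRingType) (g : {rmorphism R -> A})
    (I : finType) (s : I -> A) :
  (forall y, exists c : I -> R, y = \sum_i g (c i) * s i) -> module_finite g.
Proof.
move=> sP; exists #|I|, (fun j => s (enum_val j)) => y.
have [c ->] := sP y; exists (fun j => c (enum_val j)).
rewrite (reindex (fun j : 'I_#|I| => enum_val j)) //.
exact/onW_bij/enum_val_bij.
Qed.

Lemma module_finite_comp (R B A : comPzRingType) (g : {rmorphism R -> B})
    (h : {rmorphism B -> A}) (I : finType) (s : I -> B) :
  (forall y, exists c : I -> R, y = \sum_i g (c i) * s i) -> module_finite h ->
  module_finite (h \o g).
Proof.
move=> sP [n [t tP]].
apply: (@module_finite_fin _ _ (h \o g) ('I_n * I)%type
  (fun ij => h (s ij.2) * t ij.1)) => y.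
have [b ->] := tP y; have /choice[c cE] := fun i => sP (b i).
exists (fun ij => c ij.1 ij.2).
rewrite -(pair_bigA _ (fun i j => h (g (c i j)) * (h (s j) * t i))) /=.
apply: eq_bigr => i _; rewrite {1}cE rmorph_sum mulr_suml.
by apply: eq_bigr => j _; rewrite rmorphM mulrA.
Qed.

Section CompleteDescent.
Variables (W : comNzRingType) (K : nat -> set W).
Hypothesis KP : complete_filtration K.
Hypothesis char0 : forall n, exists v : W, v * n.+1%:R = 1.
Variables (d : nat) (x : 'I_d -> W) (s : nat).
Hypothesis Kx1 : forall i, K 1%N (x i).
Hypothesis Kx : forall n w, K (n + s)%N w ->
  exists c : 'I_d -> W, (forall i, K n (c i)) /\ w = \sum_i c i * x i.
Variables (r : nat) (y : 'I_r -> W).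
Hypothesis Ky1 : forall j, K 1%N (y j).
Hypothesis Ky : forall n w, K n.+1 w ->
  exists c : 'I_r -> W, (forall j, K n (c j)) /\ K n.+2 (w - \sum_j c j * y j).

Section ResidualGenerators.
Variable L : set W.
Hypothesis L0 : L 0.
Hypothesis Llift : forall t, exists2 l, L l & K 1%N (t - l).

(** The family consists of the products of n of the y_j. *)
Lemma layer_generators n : exists (I : finType) (e : I -> W), forall w, K n w ->
  exists l : I -> W, (forall i, L (l i)) /\ K n.+1 (w - \sum_i l i * e i).
Proof.
elim: n => [|n [I [e eP]]].
  exists 'I_1, (fun=> 1) => w _; have [l Ll Kl] := Llift w.
  by exists (fun=> l); split=> //; rewrite big_ord1 mulr1.
exists ('I_r * I)%type, (fun ji => y ji.1 * e ji.2) => w /Ky[c [Kc Kw]].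
have /choice[l lP] := fun j => eP _ (Kc j).
exists (fun ji => l ji.1 ji.2); split=> [[j i]|]; first by case: (lP j).
have -> : w - \sum_ji l ji.1 ji.2 * (y ji.1 * e ji.2)
  = (w - \sum_j c j * y j) + \sum_j (c j - \sum_i l j i * e i) * y j.
  rewrite -(pair_bigA _ (fun j i => l j i * (y j * e i))) /=.
  rewrite -addrA; congr (_ + _); rewrite addrC -sumrN -sumrN -big_split.
  apply: eq_bigr => j _ /=; rewrite mulrBl mulr_suml -addrA addrC subrK.
  by congr (- _); apply: eq_bigr => i _; rewrite mulrCA mulrC.
apply: (cf_D KP) => //; apply: (cf_sum KP) => j _; rewrite -addn1.
by apply: (cf_M KP); [case: (lP j)|apply: Ky1].
Qed.

Lemma residual_generators k : exists (I : finType) (e : I -> W), forall w,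
  exists l : I -> W, (forall i, L (l i)) /\ K k (w - \sum_i l i * e i).
Proof.
elim: k => [|k [I [e eP]]].
  exists 'I_0, (fun=> 0) => w; exists (fun=> 0); split=> //.
  exact: (cf_0 KP).
have [J [f fP]] := layer_generators k.
exists (I + J)%type, (fun ij => match ij with inl i => e i | inr j => f j end) => w.
have [l [Ll Kl]] := eP w; have [l' [Ll' Kl']] := fP _ Kl.
exists (fun ij => match ij with inl i => l i | inr j => l' j end).
split=> [[]//|]; rewrite big_sumType /= opprD addrA.
exact: Kl'.
Qed.
End ResidualGenerators.

Theorem degenerate_descent_complete (A : comPzRingType) (g : {rmorphism W -> A}) :
  module_finite g -> (forall w, g w = 0 -> exists n, w ^+ n = 0) ->
  monomially_degenerate (g \o x) -> monomially_degenerate x.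
Proof.
move=> g_fin g_nil [k [a aE]]; apply: contrapT => ndeg.
have [L LC Llift] := exists_coefficient_field KP char0.
have L0 : L 0.
  by case: LC => -[L1 LB _] _; rewrite -(subrr 1); apply: LB.
have [I [e eP]] := residual_generators L0 Llift s.
pose PS := series_subring KP LC x.
pose v := subring_val PS.
have P1 : (1 : subring_of PS) != 0 by apply: oner_neq0.
have vinj : injective v by apply: subring_val_inj.
have Pint (p q : subring_of PS) : p * q = 0 -> p = 0 \/ q = 0.
  move=> /(congr1 v); rewrite rmorphM rmorph0.
  move=> /(series_integral KP Llift Kx1 Kx ndeg (subring_valP _) (subring_valP _)).
  by move=> [] /subring_val_eq0; [left|right].
(* The series ring is a domain, so the nil kernel of g meets it only in 0 and A is a faithful
   P-algebra. *)
have vnil n w : series_ring LC x w -> w ^+ n = 0 -> w = 0.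
  move=> Pw; elim: n => [|n IH].
    by rewrite expr0 => /eqP; rewrite oner_eq0.
  rewrite exprS => /(series_integral KP Llift Kx1 Kx ndeg Pw (series_X KP n Pw)).
  by case.
pose P := idomain_of P1 Pint.
pose vP : {rmorphism P -> W} := v.
have P_cic (e' h f : P) : e' <> 0 -> h <> 0 ->
    (forall n, exists w, h * f ^+ n = e' ^+ n * w) -> exists u, f = u * e'.
  move=> e0 h0 hf.
  have [||n|u Pu uE] := @series_completely_integrally_closed _ _ KP _ LC Llift
    _ _ _ Kx1 Kx ndeg (v e') (v h) (v f)
    (subring_valP _) (subring_valP _) (subring_valP _).
  - by move=> /subring_val_eq0.
  - by move=> /subring_val_eq0.
  - have [w /(congr1 vP)] := hf n; rewrite !rmorphM !rmorphXn => wE.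
    by exists (v w); first exact: subring_valP.
  have [u' u'E] := subring_valS PS Pu; exists u'.
  by apply: vinj; rewrite uE -u'E; apply: (esym (rmorphM vP _ _)).
have P_char0 n : exists q : P, q * n.+1%:R = 1.
  have [l Ll ln] : exists2 l, L l & l * n.+1%:R = 1.
    apply: (coefficient_field KP LC Llift).
      have [[L1 LB _] _] := LC; elim: n => [//|n IH].
      have -> : n.+2%:R = n.+1%:R - (0 - 1) :> W by rewrite -(natr1 n.+1); ring.
      by apply: (LB) => //; apply: LB.
    move=> n0; have [w] := char0 n; rewrite n0 mulr0 => /esym/eqP.
    by rewrite oner_eq0.
  have [q qE] := subring_valS PS (series_coef KP LC x Ll); exists q.
  apply: vinj; rewrite -[LHS]/(vP _) -[RHS]/(vP 1) rmorphM rmorph_nat rmorph1.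
  by rewrite [vP q]qE.
pose b : {rmorphism P -> A} := g \o vP.
have b_fin : module_finite b.
  apply: (module_finite_comp (s := e) _ g_fin) => w.
  have [c [Pc ->]] := series_module_finite KP LC Kx1 Kx eP w.
  have /choice[c' c'E] := fun i => subring_valS PS (Pc i).
  by exists c'; apply: eq_bigr => i _; rewrite -c'E.
have b_inj : injective b.
  move=> p q pq; apply: vinj; apply/eqP; rewrite -subr_eq0; apply/eqP.
  have /g_nil[n] : g (v p - v q) = 0.
    by rewrite rmorphB; apply/eqP; rewrite subr_eq0; apply/eqP.
  by apply: vnil; apply: (series_B KP); apply: subring_valP.
have [tau [tau1 tauD tauM]] := normal_finite_splitting P_cic P_char0 b_fin b_inj.
have /choice[xP xPE] := fun i => subring_valS PS (series_x KP LC x i).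
have tau0 : tau 0 = 0 by apply: (addrI (tau 0)); rewrite -tauD !addr0.
apply: ndeg; exists k, (fun i => vP (tau (a i))).
have bx i : b (xP i) = g (x i) by rewrite -xPE.
(* The x_i lie in P, so the retraction fixes both sides of the relation up to replacing a_i by
   tau(a_i). *)
have : b ((\prod_i xP i) ^+ k) * 1 = \sum_i b (xP i ^+ k.+1) * a i.
  rewrite mulr1 rmorphXn rmorph_prod.
  under eq_bigr do rewrite bx.
  rewrite aE; apply: eq_bigr => i _.
  by rewrite rmorphXn bx mulrC.
move=> /(congr1 tau); rewrite tauM tau1 mulr1 (big_morph tau tauD tau0).
move=> /(congr1 vP); rewrite rmorphXn rmorph_prod rmorph_sum.
under eq_bigr do rewrite [vP _]xPE.
move=> ->; apply: eq_bigr => i _.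
by rewrite tauM rmorphM rmorphXn mulrC [vP (xP i)]xPE.
Qed.

End CompleteDescent.

(** * Adic completions *)

Section IdealPowers.
Variables (R : comPzRingType) (m : set R).
Local Notation JJ := (ideal_pow m).

Lemma ideal_pow1 : is_ideal m -> JJ 1 = m.
Proof.
move=> mI; apply/seteqP; split=> z /=; last first.
  by move=> mz; apply: sub_ideal_gen; exists z, 1; rewrite mulr1.
by move=> /(_ m mI); apply=> _ [u [v [mu _ ->]]]; rewrite mulrC; case: mI => _ _; apply.
Qed.

Lemma ideal_powS n : JJ n.+1 `<=` JJ n.
Proof.
move=> z /(_ (JJ n) (ideal_powP _ _)); apply=> _ [u [v [mu Jv ->]]].
by case: (ideal_powP m n) => _ _; apply.
Qed.

Lemma ideal_pow_le n k : (n <= k)%N -> JJ k `<=` JJ n.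
Proof.
move=> /subnK <-; elim: (k - n)%N => [|l IH] // z /ideal_powS; exact: IH.
Qed.

Lemma ideal_pow_mul u n v : m u -> JJ n v -> JJ n.+1 (u * v).
Proof. by move=> mu Jv; apply: sub_ideal_gen; exists u, v. Qed.

Lemma ideal_powM k n u v : JJ k u -> JJ n v -> JJ (k + n)%N (u * v).
Proof.
move=> + Jv; elim: k u => [|k IH] u /=.
  by move=> _; case: (ideal_powP m n) => _ _; apply.
have [I0 ID IM] := ideal_powP m (k.+1 + n).
move=> /(_ [set u | JJ (k.+1 + n)%N (u * v)]); apply.
  split=> [|a b Ja Jb|a b Jb] /=; first by rewrite mul0r.
    by rewrite mulrDl; apply: ID.
  by rewrite -mulrA; apply: IM.
by move=> _ [a [b [ma Jb ->]]] /=; rewrite -mulrA; apply: ideal_pow_mul ma (IH _ Jb).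
Qed.

Lemma ideal_pow_sub k n (I : set R) : is_ideal I ->
  (forall u v, JJ k u -> JJ n v -> I (u * v)) -> JJ (k + n)%N `<=` I.
Proof.
elim: k I => [|k IH] I II Iuv; first by move=> v Jv; rewrite -[v]mul1r; apply: Iuv.
have [I0 ID IM] := II; apply: ideal_gen_sub II _ => _ [p [q [mp Jq ->]]].
apply: (IH [set z | I (p * z)]) Jq.
  split=> [|a b Ia Ib|a b Ib] /=; first by rewrite mulr0.
    by rewrite mulrDr; apply: ID.
  by rewrite mulrCA; apply: IM.
by move=> u v Ju Jv /=; rewrite mulrA; apply: Iuv => //; apply: ideal_pow_mul.
Qed.

Lemma ideal_pow_generators e (z : 'I_e -> R) s :
  JJ s `<=` ideal_gen (range z) -> forall n r, JJ (n + s)%N r ->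
  exists c : 'I_e -> R, (forall i, JJ n (c i)) /\ r = \sum_i c i * z i.
Proof.
move=> zs; elim=> [|n IH] r; first by move=> /zs/ideal_gen_range[c ->]; exists c.
have [I0 ID IM] := ideal_powP m n.+1.
move=> /(_ [set r | exists c : 'I_e -> R,
  (forall i, JJ n.+1 (c i)) /\ r = \sum_i c i * z i]); apply.
  split=> [|_ _ [a [Ja ->]] [b [Jb ->]]|u _ [a [Ja ->]]] /=.
  - by exists (fun=> 0); split=> //; rewrite big1 // => i _; rewrite mul0r.
  - exists (fun i => a i + b i); split=> [i|]; first exact: ID.
    by rewrite -big_split; apply: eq_bigr => i _; rewrite mulrDl.
  - exists (fun i => u * a i); split=> [i|]; first exact: IM.
    by rewrite mulr_sumr; apply: eq_bigr => i _; rewrite mulrA.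
move=> _ [u [v [mu /IH[c [Jc ->]] ->]]].
exists (fun i => u * c i); split=> [i|]; first exact: ideal_pow_mul.
by rewrite mulr_sumr; apply: eq_bigr => i _; rewrite mulrA.
Qed.

(** An ideal maximal among those that contain A but no power of m is prime, so by hypothesis it
    would contain m. *)
Lemma ideal_pow_in_radical (A : set R) : noetherian R -> is_ideal m ->
  (forall p, is_prime p -> A `<=` p -> m `<=` p) ->
  exists s, JJ s `<=` ideal_gen A.
Proof.
move=> noeth mI Am; apply: contrapT => /forallNP noS.
pose F := [set I | [/\ is_ideal I, A `<=` I & forall s, ~ JJ s `<=` I]].
have [||I [[II AI Is] Imax]] := @noetherian_max R F (ideal_gen A) noeth.
- by move=> I [].
- by split=> //; [apply: ideal_genP|apply: sub_ideal_gen].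
have [I0 ID IM] := II.
have Js a : ~ I a -> exists s, JJ s `<=` ideal_adjoin I a.
  move=> nIa; apply: contrapT => /forallNP nJ; apply: nIa.
  rewrite -(Imax (ideal_adjoin I a)); first exact: ideal_adjoin_mem.
    split=> //; first exact: ideal_adjoinP.
    by move=> z Az; apply/sub_ideal_adjoin/AI.
  exact: sub_ideal_adjoin.
have Iprime : is_prime I.
  split=> // [I1|a b Iab].
    by apply: (Is 0%N) => z _; rewrite -[z]mulr1; apply: IM.
  apply: contrapT => /not_orP[/Js[k Jk] /Js[l Jl]].
  apply: (Is (k + l)%N); apply: ideal_pow_sub => // u v.
  move=> /Jk[q [w [Iq ->]]] /Jl[q' [w' [Iq' ->]]].
  have -> : (q + w * a) * (q' + w' * b)
      = (q' + w' * b) * q + (w * a) * q' + (w * w') * (a * b).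
    by ring.
  by apply: (ID); [apply: ID; apply: IM|apply: IM].
by apply: (Is 1%N); rewrite ideal_pow1 //; apply: Am.
Qed.

End IdealPowers.

Lemma local_ring_unit (R : comPzRingType) (m : set R) a :
  noetherian R -> local_ring m -> ~ m a -> exists b, b * a = 1.
Proof.
move=> noeth [mmax muniq] nma; apply: contrapT => nu.
have aI : is_ideal [set z | exists u, z = u * a].
  split=> [|_ _ [u ->] [v ->]|c _ [u ->]]; first by exists 0; rewrite mul0r.
    by exists (u + v); rewrite mulrDl.
  by exists (c * u); rewrite mulrA.
have [||M [[MI M1 aM] Mmax]] := @noetherian_max R
    [set I | [/\ is_ideal I, ~ I 1 & [set z | exists u, z = u * a] `<=` I]]
    [set z | exists u, z = u * a] noeth.
- by move=> I [].
- by split=> // -[u e]; apply: nu; exists u.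
apply: nma; rewrite -(muniq M).
  by apply: aM; exists 1; rewrite mul1r.
split=> // J JI J1 MJ; apply: Mmax => //; split=> //.
exact: subset_trans MJ.
Qed.

(** * The completion of a Noetherian local ring *)

Section Completion.
Variables (R : comPzRingType) (m : set R).
Hypotheses (noeth : noetherian R) (loc : local_ring m).
Local Notation JJ := (ideal_pow m).
Local Notation W := (adic_completion m).
Local Notation pi := (rs_pi (P := adic_setoid m)).

(** The kernel of the projection to R/m^n; [adic_levelP] shows that any representative may be
    used. *)
Definition adic_level n : set W :=
  [set w | JJ n (sval (rs_repr (P := adic_setoid m) w : adic_car m) n)].

Lemma adic_levelP n (a : adic_car m) : adic_level n (pi a) <-> JJ n (sval a n).
Proof.
have e := @rs_reprE (adic_setoid m) a n; split=> H.
  have := adic_ofD _ (adic_ofN (erefl _) e) H; apply.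
  by rewrite opprB subrK.
by apply: (adic_ofD _ e H); rewrite subrK.
Qed.

Lemma adic_repr (w : W) : exists a, w = pi a.
Proof. by exists (rs_repr w); rewrite rs_reprK. Qed.

Let mI : is_ideal m. Proof. by case: loc => -[]. Qed.

Lemma adic_filtration : complete_filtration adic_level.
Proof.
split.
- move=> n; split.
  + by rewrite -(rs_pi0 (adic_setoid m)); apply/adic_levelP; apply: adic_of0.
  + move=> u v; have [a ->] := adic_repr u; have [b ->] := adic_repr v.
    move=> /adic_levelP Ja /adic_levelP Jb; rewrite -rs_piD; apply/adic_levelP.
    exact: adic_ofD Ja Jb.
  + move=> u v; have [a ->] := adic_repr u; have [b ->] := adic_repr v.
    move=> /adic_levelP Jb; rewrite -rs_piM; apply/adic_levelP.
    by case: (ideal_powP m n) => _ _; apply.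
- by [].
- move=> n w; have [a ->] := adic_repr w; move=> /adic_levelP/ideal_powS Ja.
  apply/adic_levelP; apply: adic_ofD (adic_ofN (erefl _) (proj2_sig a n)) Ja.
  by rewrite opprB subrK.
- move=> k n u v; have [a ->] := adic_repr u; have [b ->] := adic_repr v.
  move=> /adic_levelP Ja /adic_levelP Jb; rewrite -rs_piM; apply/adic_levelP => /=.
  have lift (c : adic_car m) i j : (i <= j)%N -> JJ i (sval c i) -> JJ i (sval c j).
    move=> /subnK <- Jc; elim: (j - i)%N => [//|l IH].
    apply: adic_ofD (ideal_pow_le (leq_addl l i) (proj2_sig c (l + i)%N)) IH.
    by rewrite subrK.
  by apply: ideal_powM; apply: lift => //; [apply: leq_addr|apply: leq_addl].
- move=> w; have [a ->] := adic_repr w => aP; rewrite -(rs_pi0 (adic_setoid m)).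
  by apply/rs_piP => n /=; rewrite subr0; apply/adic_levelP.
(* The limit is the diagonal: its n-th component is that of the n-th term. *)
- move=> a aP; pose al n := rs_repr (a n); pose b n := sval (al n) n.
  have bP n : JJ n (b n.+1 - b n).
    have := aP n; rewrite -(rs_reprK (a n.+1)) -(rs_reprK (a n)) -rs_piN -rs_piD.
    move=> /adic_levelP H; apply: adic_ofD (proj2_sig (al n.+1) n) H.
    by rewrite /b /= /al; ring.
  exists (pi (exist _ b bP)) => n; rewrite -[a n]rs_reprK -rs_piN -rs_piD.
  by apply/adic_levelP; apply: adic_of0; rewrite /= subrr.
- move=> w; have [a ->] := adic_repr w => na.
  have am n : ~ m (sval a n.+1).
    elim: n => [ma|n IH ma].
      by apply/na/adic_levelP; rewrite ideal_pow1.
    apply: IH; have := proj2_sig a n.+1; rewrite -/(ideal_pow m) => /(ideal_pow_le (n := 1)).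
    rewrite ideal_pow1 // => /(_ isT) H; have [_ ID _] := mI.
    rewrite -[sval a n.+1](subrK (sval a n.+2)); apply: ID => //.
    by rewrite -opprB; apply: is_idealN.
  have /choice[b bE] : forall n, exists b, b * sval a n.+1 = 1.
    by move=> n; apply: local_ring_unit noeth loc (am n).
  (* Component 0 carries no information, as m^0 = R, and a_0 may fail to be a unit; inverses are
     taken from index 1 on. *)
  pose c n := if n is k.+1 then b k else 0.
  have cP n : JJ n (c n.+1 - c n).
    case: n => [//|n]; have [_ _ IM] := ideal_powP m n.+1.
    have -> : c n.+2 - c n.+1 = - (b n.+1 * b n) * (sval a n.+2 - sval a n.+1).
      transitivity (b n.+1 * (b n * sval a n.+1) - (b n.+1 * sval a n.+2) * b n).
        by rewrite !bE mulr1 mul1r.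
      by ring.
    by apply: IM; apply: (proj2_sig a n.+1).
  exists (pi (exist _ c cP)); rewrite -rs_piM -(rs_pi1 (adic_setoid m)).
  by apply/rs_piP => -[//|n]; apply: adic_of0; rewrite /= bE subrr.
- rewrite -(rs_pi1 (adic_setoid m)) => /adic_levelP; rewrite ideal_pow1 //=.
  by case: loc => -[].
Qed.

Lemma adic_level_map n r : adic_level n (adic_map m r) <-> JJ n r.
Proof. exact: adic_levelP. Qed.

(** Component n + s and the successive differences after it are expanded in the z_i with
    coefficients in ever higher powers of m; summing these coefficients gives elements of the
    completion. *)
Lemma adic_level_generators e (z : 'I_e -> R) s :
  JJ s `<=` ideal_gen (range z) -> forall n w, adic_level (n + s)%N w ->
  exists c : 'I_e -> W, (forall i, adic_level n (c i)) /\
    w = \sum_i c i * adic_map m (z i).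
Proof.
move=> zs n w; have [a ->] := adic_repr w => /adic_levelP Ja.
pose del j := if j is k.+1 then sval a (n + s + k).+1 - sval a (n + s + k)%N
  else sval a (n + s)%N.
have /choice[c cP] : forall j, exists c : 'I_e -> R,
    (forall i, JJ (n + j.-1)%N (c i)) /\ del j = \sum_i c i * z i.
  case=> [|j]; apply: (ideal_pow_generators zs); first by rewrite addn0.
  by rewrite /= addnAC; apply: (proj2_sig a).
pose t i N := \sum_(j < N.+1) c j i.
have tP i N : JJ N (t i N.+1 - t i N).
  rewrite /t big_ord_recr /= addrAC subrr add0r.
  by apply: ideal_pow_le ((cP N.+1).1 i); apply: leq_addl.
exists (fun i => pi (exist _ (t i) (tP i))); split=> [i|].
  apply/adic_levelP => /=; apply: (big_ind (JJ n)) => [||j _].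
  - by case: (ideal_powP m n).
  - by case: (ideal_powP m n).
  - by apply: ideal_pow_le ((cP j).1 i); apply: leq_addr.
have -> : \sum_i pi (exist _ (t i) (tP i)) * adic_map m (z i)
    = \sum_i pi (adic_mul (exist _ (t i) (tP i)) (adic_const m (z i))).
  by apply: eq_bigr => i _; rewrite -rs_piM.
have sumE (I : Type) (r : seq I) (F : I -> adic_car m) :
    \sum_(i <- r) pi (F i) = pi (\big[@adic_add R m/adic_const m 0]_(i <- r) F i).
  by elim/big_rec2: _ => [//|i u v _ ->]; rewrite -rs_piD.
have svalE (I : Type) (r : seq I) (F : I -> adic_car m) N :
    sval (\big[@adic_add R m/adic_const m 0]_(i <- r) F i) N = \sum_(i <- r) sval (F i) N.
  by elim/big_rec2: _ => [//|i u v _ <-].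
rewrite sumE; apply/rs_piP => N /=; rewrite svalE /=.
have tele : \sum_i t i N * z i = sval a (n + s + N)%N.
  rewrite /t; under eq_bigr do rewrite mulr_suml.
  rewrite exchange_big /=.
  transitivity (\sum_(j < N.+1) del j).
    by apply: eq_bigr => j _; rewrite (cP j).2.
  elim: N => [|N IH]; first by rewrite big_ord1 addn0.
  by rewrite big_ord_recr IH /= addnS addrC subrK.
(* Component N of the sum is a_(n+s+N), which agrees with a_N modulo m^N. *)
rewrite tele; elim: (n + s)%N => [|k IH]; first by apply: adic_of0; rewrite subrr.
apply: adic_ofD IH (adic_ofN (erefl _)
  (ideal_pow_le (leq_addl k N) (proj2_sig a (k + N)%N))).
by rewrite addSn; ring.
Qed.

(** Some m^s lies in (x_1^(k+1), ..., x_d^(k+1)). Truncating the coefficients at level s leaves an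
    error in m^s, absorbed by changing them. *)
Lemma monomially_degenerate_completion d (x : 'I_d -> R) :
  Vset (range x) = Vset m ->
  monomially_degenerate (adic_map m \o x) -> monomially_degenerate x.
Proof.
move=> xm [k [a aE]]; have [|s sP] := @ideal_pow_in_radical R m
    (range (fun i => x i ^+ k.+1)) noeth mI.
  move=> p pP xp; suff : Vset m p by case.
  rewrite -xm; split=> // _ [i _ <-].
  have : p (x i ^+ k.+1) by apply: xp; exists i.
  have [[p0 _ _] p1 pM] := pP.
  by elim: (k.+1) => [//|l IH]; rewrite exprS => /pM[].
have /choice[al alE] := fun i => adic_repr (a i).
have : adic_level s (adic_map m ((\prod_i x i) ^+ k
    - \sum_i sval (al i) s * x i ^+ k.+1)).
  rewrite rmorphB rmorphXn rmorph_prod [X in adic_level s (X - _)]aE rmorph_sum -sumrB.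
  apply: (cf_sum adic_filtration) => i _.
  rewrite rmorphM rmorphXn -mulrBl mulrC; apply: (cf_Ml adic_filtration).
  rewrite alE /adic_map -rs_piN -rs_piD; apply/adic_levelP; apply: adic_of0.
  by rewrite /= subrr.
move=> /adic_level_map/sP/ideal_gen_range[c cE].
exists k, (fun i => sval (al i) s + c i).
under [RHS]eq_bigr do rewrite mulrDl.
by rewrite big_split /= -cE addrC subrK.
Qed.

End Completion.

(** * Descent of degeneracy *)

Theorem degenerate_descent_pchar0 (R S R' : comPzRingType)
    (phi : {rmorphism R -> S}) (psi : {rmorphism R -> R'}) (m : set R')
    d (x : 'I_d -> R') :
  finite_extension phi -> noetherian R' -> local_ring m -> parameters m x ->
  (forall n, exists v : R', v * n.+1%:R = 1) ->
  monomially_degenerate (tens_r phi psi \o x) -> monomially_degenerate x.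
Proof.
move=> phi_fin noeth loc xm char0 degA.
have mI : is_ideal m by case: loc => -[].
have [s xs] : exists s, ideal_pow m s `<=` ideal_gen (range x).
  apply: ideal_pow_in_radical => // p pP xp.
  by suff : Vset m p; [case|rewrite -xm].
have xmem i : m (x i).
  suff [_] : Vset (range x) m by apply; exists i.
  by rewrite xm; split=> //; case: loc => mmax _; apply: maximal_prime.
have [ys ysE] := noeth m mI.
pose y (j : 'I_(size ys)) := ys`_j.
have my : ideal_pow m 1 `<=` ideal_gen (range y).
  rewrite ideal_pow1 // ysE; apply: ideal_gen_sub => [|z zy]; first exact: ideal_genP.
  apply: sub_ideal_gen; exists (Ordinal (etrans (index_mem z ys) zy)) => //.
  by rewrite /y /= nth_index.
pose W := adic_completion m.
have KP : complete_filtration (@adic_level _ m) by apply: adic_filtration.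
have W1 : (1 : W) != 0.
  by apply/eqP => W10; apply: (cf_proper KP); rewrite W10; apply: (cf_z KP).
pose W' := nonzero_ring W1.
apply: (monomially_degenerate_completion noeth loc xm).
have Kone z : m z -> adic_level 1%N (adic_map m z).
  by move=> mz; apply/adic_level_map; rewrite ideal_pow1.
pose psi' : {rmorphism R -> W} := adic_map m \o psi.
apply: (@degenerate_descent_complete W' _ KP _ d (adic_map m \o x) s _ _
   _ (adic_map m \o y) _ _ _ (tens_r phi psi' : {rmorphism W' -> tensor phi psi'})).
- move=> n; have [v vE] := char0 n; exists (adic_map m v).
  by rewrite -(rmorph_nat (adic_map m)) -[LHS](rmorphM (adic_map m)) vE; apply: rmorph1.
- by move=> i; apply: Kone.
- by move=> n w; apply: adic_level_generators.
- move=> j; apply: Kone; rewrite ysE; apply: sub_ideal_gen.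
  exact: mem_nth.
- move=> n w; rewrite -addn1 => /(adic_level_generators my)[c [Kc ->]].
  by exists c; split=> //; rewrite subrr; apply: (cf_z KP).
- exact/tens_r_module_finite/finite_extension_module_finite.
- by move=> w; apply: tens_r_nilpotent.
(* Degeneracy is carried from S (x)_R R' to S (x)_R W by the induced map. *)
have [F [_ Fr] _] := @tensor_univ _ _ _ phi psi (tensor phi psi')
  (tens_l phi psi') (tens_r phi psi' \o adic_map m) (fun r => tens_lr phi psi' r).
have := monomially_degenerate_rmorph F degA.
by apply: eq_monomially_degenerate => i /=; rewrite Fr.
Qed.

Theorem degenerate_descent (K : fieldType) (R S R' : comPzRingType)
    (iota : {rmorphism K -> R'})
    (phi : {rmorphism R -> S}) (psi : {rmorphism R -> R'}) (m : set R')
    d (x : 'I_d -> R') :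
  finite_extension phi -> noetherian R' -> local_ring m -> parameters m x ->
  monomially_degenerate (tens_r phi psi \o x) -> monomially_degenerate x.
Proof.
move=> phi_fin noeth loc xm.
have [[l lK]|noch] := pselect (exists l, l \in [pchar K]).
  apply: (@degenerate_descent_pchar _ _ _ l) => //.
  - exact: pcharf_prime lK.
  - by rewrite -(rmorph_nat iota) (pcharf0 lK) rmorph0.
  - exact/tens_r_module_finite/finite_extension_module_finite.
  - by move=> r; apply: tens_r_nilpotent.
apply: degenerate_descent_pchar0 loc xm _ => // n; exists (iota n.+1%:R^-1).
rewrite -(rmorph_nat iota) -rmorphM mulVf ?rmorph1 //.
by apply/negP => /natf0_pchar[//|l lK]; apply: noch; exists l.
Qed.

Theorem lemma3p8 (K : fieldType) (R : comPzRingType)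
    (iota : {rmorphism K -> R}) (R_noeth : noetherian R)
    (n : nat) (f : 'I_n -> R) (h : R)
    (S : comPzRingType) (phi : {rmorphism R -> S})
    (phi_fin : finite_extension phi)
    (h_in : ideal_ext phi (ideal_gen (range f)) (phi h)) :
  parasolid_closure (ideal_gen (range f)) h.
Proof.
move=> m m_max q q_prime _ fs fsE; set D := quot_prime q_prime.
set del := completion_quot_map q_prime.
(* The chain needs no intermediate elements: h itself belongs universally parasolidly to [fs]. *)
exists [::] => i; rewrite ltnS leqn0 => /eqP -> /=; rewrite cats0.
move=> R' m' psi noeth loc d x _ xm; apply: contra_neq.
rewrite cech_map_paraclass => /paraclass_eq0 deg; apply/paraclass_eq0.
pose psi0 : {rmorphism R -> R'} := psi \o del.
pose g := tens_r phi psi0.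
(* [fs] is any generating sequence of the extended ideal, so h is expressed through it by pulling
   [J] back to ideals of S and of [D] and comparing generators. *)
pose J := [set u | exists t : 'I_(size fs) -> tensor phi psi0,
  u = \sum_(i < size fs) g (psi fs`_i) * t i].
have JI : is_ideal J.
  split=> [|_ _ [t ->] [t' ->]|a _ [t ->]].
  - by exists (fun=> 0); rewrite big1 // => j _; rewrite mulr0.
  - exists (fun j => t j + t' j); rewrite -big_split.
    by apply: eq_bigr => j _; rewrite mulrDr.
  - exists (fun j => a * t j); rewrite mulr_sumr.
    by apply: eq_bigr => j _; rewrite mulrCA.
have Jpre (T : comPzRingType) (k : {rmorphism T -> tensor phi psi0}) :
    is_ideal [set z | J (k z)].
  have [J0 JD JM] := JI; split=> [|u v Ju Jv|u v Jv] /=; first by rewrite rmorph0.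
    by rewrite rmorphD; apply: JD.
  by rewrite rmorphM; apply: JM.
have JD z : ideal_gen [set` fs] z -> J (g (psi z)).
  move: z; apply: (ideal_gen_sub (Jpre D (g \o psi))) => z zfs.
  have zi : (index z fs < size fs)%N by rewrite index_mem.
  exists (fun j => (j == Ordinal zi)%:R); rewrite (bigD1 (Ordinal zi)) //= eqxx mulr1.
  by rewrite nth_index // big1 ?addr0 // => j /negbTE ->; rewrite mulr0.
have [t tE] : J (g (psi (del h))).
  suff : J (tens_l phi psi0 (phi h)) by rewrite [tens_l _ _ _]tens_lr.
  move: (phi h) h_in; apply: (ideal_gen_sub (Jpre S (tens_l phi psi0))).
  move=> _ [r Ir <-]; rewrite /= tens_lr; apply: JD; rewrite fsE.
  by apply: sub_ideal_gen; exists r.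
apply: (degenerate_descent (psi \o del \o iota) phi_fin noeth loc xm (psi := psi0)).
exact: monomially_degenerate_forcing tE deg.
Qed.
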